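(* Let $T>0$ be arbitrary. For every $u_0\in L^\infty(\mathbb{T})$ there exists a unique weak entropy solution of the periodic Fornberg–Whitham problem $u_t+uu_x+(1-\partial_x^2)^{-1}u_x=0$ ($x\in\mathbb{T}$, $t>0$), $u(x,0)=u_0(x)$, on the time interval $[0,T]$.
   Context: $\mathbb{T}=\mathbb{R}/\mathbb{Z}$, functions on $\mathbb{T}$ identified with $1$-periodic functions on $\mathbb{R}$. Let $K:\mathbb{T}\to\mathbb{R}$ be given on $[0,1]$ by $K(x)=\frac{\sqrt e}{e-1}\cosh(x-\tfrac12)$, extended periodically; then $(1-\partial_x^2)^{-1}w_x=K'\ast w$ (convolution in $x$ over $\mathbb{T}$), with $K'$ bounded. Given $u_0\in L^\infty(\mathbb{T})$ and $T>0$, a function $u\in L^\infty(\mathbb{T}\times[0,T])$ is a weak entropy solution if for every $\lambda\in\mathbb{R}$ and every nonnegative $C^1$ function $\phi$ with compact support in $\mathbb{T}\times\mathbb{R}$, $$0\le\int_0^T\!\!\int_{\mathbb{T}}\Big(|u-\lambda|\,\partial_t\phi+\operatorname{sgn}(u-\lambda)\tfrac{u^2-\lambda^2}{2}\partial_x\phi-\operatorname{sgn}(u-\lambda)\,\big(K'\ast(u(\cdot,t)-\lambda)\big)(x)\,\phi\Big)dx\,dt+\int_{\mathbb{T}}|u_0(x)-\lambda|\phi(x,0)\,dx,$$ where $u=u(x,t)$, $\phi=\phi(x,t)$. *)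

(* Defs.v *)
From mathcomp Require Import all_boot all_order all_algebra.
From mathcomp Require Import all_classical all_reals all_analysis.
Import Order.TTheory GRing.Theory Num.Theory.
Import numFieldNormedType.Exports.
Local Open Scope classical_set_scope.
Local Open Scope ring_scope.

Set Implicit Arguments.
Unset Strict Implicit.
Unset Printing Implicit Defensive.

Section FW.
Variable R : realType.

Local Notation leb := (@lebesgue_measure R).

(* Functions on the torus T = R/Z are 1-periodic functions on R. *)
Definition periodic1 (f : R -> R) : Prop := forall x, f (x + 1) = f x.

Definition Linf_T (u0 : R -> R) : Prop :=
  measurable_fun setT u0 /\ periodic1 u0 /\
  exists M : R, {ae leb, forall x, `|u0 x| <= M}.

Definition frac (x : R) : R := x - (Num.floor x)%:~R.
Definition coshR (y : R) : R := (expR y + expR (- y)) / 2.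
Definition sinhR (y : R) : R := (expR y - expR (- y)) / 2.

Definition Kfun (x : R) : R :=
  expR (2^-1) / (expR 1 - 1) * coshR (frac x - 2^-1).

(* Its derivative K' (defined off the integers, where it is given by the
   formula below; the value at integers is irrelevant, a null set). *)
Definition Kp (x : R) : R :=
  expR (2^-1) / (expR 1 - 1) * sinhR (frac x - 2^-1).

Definition convKp (w : R -> R) (x : R) : R :=
  Rintegral leb `[0, 1] (fun y => Kp (x - y) * w y).

Definition test_fun (phi phix phit : R -> R -> R) : Prop :=
  (forall x t, 0 <= phi x t) /\
  (forall t, periodic1 (fun x => phi x t)) /\
  continuous (fun p : R * R => phi p.1 p.2) /\
  continuous (fun p : R * R => phix p.1 p.2) /\
  continuous (fun p : R * R => phit p.1 p.2) /\
  (forall x t : R, is_derive x (1:R^o) (fun y : R^o => phi y t : R^o) (phix x t)) /\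
  (forall x t : R, is_derive t (1:R^o) (fun s : R^o => phi x s : R^o) (phit x t)) /\
  (exists B : R, forall x t, B < `|t| -> phi x t = 0).

Definition Linf_TT (T : R) (u : R -> R -> R) : Prop :=
  (forall t, periodic1 (fun x => u x t)) /\
  measurable_fun (setT `*` `[0, T]) (fun p : R * R => u p.1 p.2) /\
  exists M : R, {ae (leb \x leb)%E, forall p : R * R,
     p.2 \in `[0, T] -> `|u p.1 p.2| <= M}.

Definition entropy_integrand (u : R -> R -> R) (lam : R)
  (phi phix phit : R -> R -> R) (x t : R) : R :=
  `|u x t - lam| * phit x t
  + Num.sg (u x t - lam) * ((u x t ^+ 2 - lam ^+ 2) / 2) * phix x t
  - Num.sg (u x t - lam) * convKp (fun y => u y t - lam) x * phi x t.

Definition weak_entropy_solution (T : R) (u0 : R -> R) (u : R -> R -> R) : Prop :=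
  Linf_TT T u /\
  forall (lam : R) (phi phix phit : R -> R -> R),
    test_fun phi phix phit ->
    0 <= Rintegral leb `[0, T]
           (fun t => Rintegral leb `[0, 1]
              (fun x => entropy_integrand u lam phi phix phit x t))
         + Rintegral leb `[0, 1] (fun x => `|u0 x - lam| * phi x 0).

Definition ae_eq_TT (T : R) (u v : R -> R -> R) : Prop :=
  {ae (leb \x leb)%E, forall p : R * R, p.2 \in `[0, T] -> u p.1 p.2 = v p.1 p.2}.

End FW.

(* Main.v *)
Require Import Defs.
From mathcomp Require Import all_boot all_order all_algebra.
From mathcomp Require Import all_classical all_reals all_analysis.
From mathcomp Require Import measurable_realfun ring lra.
Import Order.TTheory GRing.Theory Num.Theory.
Import numFieldNormedType.Exports.
Local Open Scope classical_set_scope.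
Local Open Scope ring_scope.

Set Implicit Arguments.
Unset Strict Implicit.
Unset Printing Implicit Defensive.

(* Uniqueness and existence both follow from one stability estimate.  Call [u] an
   approximate entropy solution when Kruzhkov's inequality holds up to a defect
   proportional to a Lipschitz bound of the test function.  Doubling the variables with
   a test function [om (x - y) * ps t * de (t - s)], the Burgers fluxes cancel, and the
   nonlocal terms satisfy
     int int |K' * u - K' * v| om (x - y) <= kappa int int |u - v| om (x - y)
   because convolution commutes with translations, so that an exponentially decaying
   weight [ps] absorbs them.  Since [de] is supported in [0 < t - s < h], only the
   initial term of the inequality in [(y, s)] survives; it is controlled by testing the
   inequality in [(x, t)] with [om (x - y) * ch t].  Hence two approximate solutions with the same initial datum
   are close in L^1 when their defects are small.

   For existence, a Lax-Friedrichs step with continuous space variable, followed by an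
   explicit step for the nonlocal term, gives approximate solutions with arbitrarily
   small defect.  By stability a subsequence is summable-Cauchy in L^1, hence converges
   almost everywhere.  The entropy inequality passes to the limit at the levels [lam]
   with [u <> lam] almost everywhere, which are dense, and extends to all levels. *)

(** * Integration of bounded measurable functions *)

(** Solutions in the sense of the definition are neither continuous in time nor equipped with a
    trace at t = 0: the datum is seen only through the boundary term, which is why the initial layer
    takes a test function of its own. With [u0] merely bounded, no uniform bound on the total
    variation of the approximations is at hand, so the stability estimate itself takes the place of
    compactness. For this the order of its quantifiers matters: the mollifier and the cutoffs depend
    on [u0], [T], the bound [M] and the accuracy, never on the two solutions; they fix the constant
    [L] of the test functions, and the admissible defect is chosen last. Approximate inequalities
    are asked only for |lam| <= M, because doubling uses as levels only values of the other solution
    or of the datum, while the error of the scheme grows with |lam|. In the limit the one obstacle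
    is the factor sgn(u - lam) of the nonlocal term; in the flux the jump of the sign is cancelled
    by the vanishing of the difference of squares. *)

(* For [b < a] the interval is empty, so [itg a b f = 0]. *)
Definition itg {R : realType} (a b : R) (f : R -> R) : R :=
  Rintegral (@lebesgue_measure R) `[a, b] f.

(** Bounded everywhere, not just essentially: such functions are integrable on every segment, and
    they are stable under sections, products and parameter integrals, so that integrability becomes
    a syntactic matter. Essentially bounded data are brought into this class by [clamp]. *)
Definition bm {R : realType} {d} {T : measurableType d} (f : T -> R) : Prop :=
  measurable_fun setT f /\ exists M, forall x, `|f x| <= M.

Section Measurability.
Context {R : realType}.
Notation leb := (@lebesgue_measure R).
Context {d} {T : measurableType d}.
Implicit Types (f g : T -> R).

Lemma measurable_comp2 (u : R -> R -> R) f g :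
  measurable_fun setT (fun p : R * R => u p.1 p.2) ->
  measurable_fun setT f -> measurable_fun setT g ->
  measurable_fun setT (fun q => u (f q) (g q)).
Proof.
move=> mu mf mg.
exact: (measurableT_comp mu (measurable_fun_pair mf mg)).
Qed.

Lemma measurable_fun_sg f :
  measurable_fun setT f -> measurable_fun setT (fun x => Num.sg (f x)).
Proof.
move=> mf.
have -> : (fun x => Num.sg (f x)) =
   (fun x => if f x == 0 then 0 else if f x < 0 then -1 else 1).
  by apply/funext => x.
apply: measurable_fun_ifT => //.
  exact: measurable_fun_eqr.
apply: measurable_fun_ifT => //.
exact: measurable_fun_ltr.
Qed.

Lemma measurable_fun_norm f :
  measurable_fun setT f -> measurable_fun setT (fun x => `|f x|).
Proof. by move=> mf; apply: measurableT_comp. Qed.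

Lemma measurable_fun_max f g :
  measurable_fun setT f -> measurable_fun setT g ->
  measurable_fun setT (fun x => Num.max (f x) (g x)).
Proof. exact: measurable_maxr. Qed.

Lemma measurable_fun_floor f :
  measurable_fun setT f ->
  measurable_fun setT (fun x => (Num.floor (f x))%:~R : R).
Proof.
move=> mf.
apply: (@measurableT_comp _ _ _ _ _ _ (fun x : R => (Num.floor x)%:~R : R)) => //.
apply: nondecreasing_measurable => // x y xy.
by rewrite ler_int; exact: le_floor.
Qed.

(** Tonelli is applied to the positive and the negative part separately, so no integrability enters:
    where the integral is infinite, [fine] returns 0. *)
Lemma measurable_fun_itg (F : T -> R -> R) (a b : R) :
  measurable_fun setT (fun q : T * R => F q.1 q.2) ->
  measurable_fun setT (fun p => itg a b (F p)).
Proof.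
move=> mF; rewrite /itg /Rintegral.
apply: measurableT_comp => //.
under eq_fun do rewrite integral_mkcond.
set G : T * R -> \bar R := fun q => if q.2 \in `[a,b] then (F q.1 q.2)%:E else 0%E.
have mG : measurable_fun setT G.
  apply: measurable_fun_ifT => //; last first.
    by apply/measurable_EFinP.
  apply: (@measurableT_comp _ _ _ _ _ _ (fun x : R => x \in `[a,b])) => //.
  apply: (measurable_fun_bool true); rewrite setTI.
  exact: (measurable_itv `[a, b]).
have GE p : (fun x => ((fun x0 => (F p x0)%:E) \_ `[a, b]) x) = (fun y => G (p, y)).
  by apply/funext => y; rewrite /G /patch mem_setE.
under eq_fun do rewrite GE integralE.
apply: emeasurable_funB.
- have h x : (\int[leb]_y ((fun y => G (x, y))^\+ y) = \int[leb]_y G^\+ (x, y))%E.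
    by apply: eq_integral => y _; rewrite !unlock.
  under eq_fun do rewrite h.
  apply: (measurable_fun_fubini_tonelli_F (m2 := leb) (G^\+)%E) => //.
  exact: measurable_funepos.
- have h x : (\int[leb]_y ((fun y => G (x, y))^\- y) = \int[leb]_y G^\- (x, y))%E.
    by apply: eq_integral => y _; rewrite !unlock.
  under eq_fun do rewrite h.
  apply: (measurable_fun_fubini_tonelli_F (m2 := leb) (G^\-)%E) => //.
  exact: measurable_funeneg.
Qed.

End Measurability.

Section BoundedMeasurable.
Context {R : realType} {d} {T : measurableType d}.
Implicit Types (f g : T -> R).

Lemma bm_meas f : bm f -> measurable_fun setT f.
Proof. by case. Qed.

Lemma bm_cst (c : R) : bm (fun _ : T => c).
Proof. by split; [exact: measurable_cst|exists `|c|]. Qed.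

Lemma bmD f g : bm f -> bm g -> bm (fun x => f x + g x).
Proof.
move=> [mf [M hM]] [mg [N hN]]; split; first exact: measurable_funD.
by exists (M + N) => x; apply: (le_trans (ler_normD _ _)); apply: lerD.
Qed.

Lemma bmN f : bm f -> bm (fun x => - f x).
Proof.
move=> [mf [M hM]]; split; first exact: measurable_funN.
by exists M => x; rewrite normrN.
Qed.

Lemma bmB f g : bm f -> bm g -> bm (fun x => f x - g x).
Proof. by move=> bf bg; apply: bmD => //; apply: bmN. Qed.

Lemma bmM f g : bm f -> bm g -> bm (fun x => f x * g x).
Proof.
move=> [mf [M hM]] [mg [N hN]]; split; first exact: measurable_funM.
by exists (M * N) => x; rewrite normrM; apply: ler_pM.
Qed.

Lemma bm_norm f : bm f -> bm (fun x => `|f x|).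
Proof.
move=> [mf [M hM]]; split; first exact: measurable_fun_norm.
by exists M => x; rewrite normr_id.
Qed.

Lemma bm_sg f : measurable_fun setT f -> bm (fun x => Num.sg (f x)).
Proof.
move=> mf; split; first exact: measurable_fun_sg.
by exists 1 => x; rewrite normr_sg; case: (_ != _).
Qed.

Lemma bm_max f g : bm f -> bm g -> bm (fun x => Num.max (f x) (g x)).
Proof.
move=> [mf [M hM]] [mg [N hN]]; split; first exact: measurable_fun_max.
exists (M + N) => x; have := hM x; have := hN x.
have := normr_ge0 (f x); have := normr_ge0 (g x).
by case: (leP (f x) (g x)); lra.
Qed.

Lemma bmX f n : bm f -> bm (fun x => f x ^+ n).
Proof.
move=> [mf [M hM]]; split; first exact: measurable_funX.
by exists (M ^+ n) => x; rewrite normrX lerXn2r ?nnegrE ?normr_ge0 // (le_trans _ (hM x)).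
Qed.

Lemma bm_indicator (f : T -> bool) : measurable_fun setT f ->
  bm (fun x => if f x then 1 else 0 : R).
Proof.
move=> mf; split; first exact: measurable_fun_ifT.
by exists 1 => x; case: ifP; rewrite ?normr1 ?normr0.
Qed.

End BoundedMeasurable.

Lemma bm_comp {R : realType} d1 d2 (S : measurableType d1) (T : measurableType d2)
  (f : T -> R) (g : S -> T) : bm f -> measurable_fun setT g -> bm (fun x => f (g x)).
Proof.
move=> [mf [M hM]] mg; split; last by exists M.
exact: measurableT_comp.
Qed.

Lemma bm_comp2 {R : realType} d (T : measurableType d) (u : R -> R -> R) (f g : T -> R) :
  bm (fun p : R * R => u p.1 p.2) ->
  measurable_fun setT f -> measurable_fun setT g ->
  bm (fun q => u (f q) (g q)).
Proof.
move=> [mu [M hM]] mf mg; split; first exact: (measurable_comp2 mu).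
by exists M => x; apply: (hM (_, _)).
Qed.

Section Integral.
Context {R : realType}.
Notation leb := (@lebesgue_measure R).
Implicit Types (f g : R -> R) (a b c : R).

Lemma leb_itv_fin a b : (leb `[a, b] < +oo)%E.
Proof.
have -> := @lebesgue_measure_itv R `[a, b].
by case: ifP => _; rewrite /= -?EFinD ltry.
Qed.

Lemma bm_integrable a b f : bm f -> leb.-integrable `[a, b] (EFin \o f).
Proof.
move=> [mf [M hM]]; apply: measurable_bounded_integrable => //.
- exact: leb_itv_fin.
- exact: measurable_funTS.
- exists M; split; first exact: num_real.
  by move=> N MN x _ /=; apply: le_trans (hM x) (ltW MN).
Qed.

Lemma EFin_itg a b f : bm f -> (itg a b f)%:E = (\int[leb]_(x in `[a, b]) (f x)%:E)%E.
Proof.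
by move=> bf; rewrite /itg /Rintegral fineK //; apply: integrable_fin_num => //; exact: bm_integrable.
Qed.

Lemma itg_cst a b c : a <= b -> itg a b (fun _ => c) = c * (b - a).
Proof.
move=> ab; rewrite /itg Rintegral_cst //=.
have -> := @lebesgue_measure_itv R `[a, b]; rewrite /= lte_fin.
by case: ltP => // ba; have -> : a = b by [apply/eqP; rewrite eq_le ab ba]; rewrite subrr.
Qed.

Lemma itgD a b f g : bm f -> bm g -> itg a b (fun x => f x + g x) = itg a b f + itg a b g.
Proof. by move=> bf bg; apply: RintegralD => //; apply: bm_integrable. Qed.

Lemma itgB a b f g : bm f -> bm g -> itg a b (fun x => f x - g x) = itg a b f - itg a b g.
Proof. by move=> bf bg; apply: RintegralB => //; apply: bm_integrable. Qed.

Lemma itgZl a b k f : bm f -> itg a b (fun x => k * f x) = k * itg a b f.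
Proof. by move=> bf; apply: RintegralZl => //; apply: bm_integrable. Qed.

Lemma itgZr a b k f : bm f -> itg a b (fun x => f x * k) = itg a b f * k.
Proof. by move=> bf; apply: RintegralZr => //; apply: bm_integrable. Qed.

Lemma eq_itg a b f g : (forall x, a <= x <= b -> f x = g x) -> itg a b f = itg a b g.
Proof.
by move=> fg; apply: eq_Rintegral => x; rewrite inE /= in_itv /=; apply: fg.
Qed.

Lemma itg_ge0 a b f : (forall x, a <= x <= b -> 0 <= f x) -> 0 <= itg a b f.
Proof. by move=> h; apply: Rintegral_ge0 => x; rewrite /= in_itv /=; apply: h. Qed.

Lemma le_itg a b f g : bm f -> bm g -> (forall x, a <= x <= b -> f x <= g x) ->
  itg a b f <= itg a b g.
Proof.
move=> bf bg h; by apply: le_Rintegral => //; exact: bm_integrable.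
Qed.

Lemma le_norm_itg a b f : bm f -> `|itg a b f| <= itg a b (fun x => `|f x|).
Proof. by move=> bf; apply: le_normr_Rintegral => //; apply: bm_integrable. Qed.

Lemma norm_itg_le a b f M : a <= b -> bm f -> (forall x, a <= x <= b -> `|f x| <= M) ->
  `|itg a b f| <= M * (b - a).
Proof.
move=> ab bf h; apply: (le_trans (le_norm_itg _ _ bf)).
rewrite -(itg_cst _ ab); apply: le_itg => //; [exact: bm_norm|exact: bm_cst].
Qed.

Lemma itg_split a b c f : a <= b -> b <= c -> bm f ->
  itg a c f = itg a b f + itg b c f.
Proof.
move=> ab bc bf; apply/eqP; rewrite addrC -subr_eq; apply/eqP.
rewrite /itg (@Rintegral_itvB _ f (BLeft a) (BRight c) b) //.
  by rewrite -Rintegral_itv_obnd_cbnd //; apply: integrableS (bm_integrable b c bf) => //;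
    apply: subset_itv_oc_cc.
exact: bm_integrable.
Qed.

Lemma bm_itg d (T : measurableType d) (F : T -> R -> R) a b :
  bm (fun q : T * R => F q.1 q.2) -> bm (fun p => itg a b (F p)).
Proof.
move=> [mF [M hM]]; split; first exact: measurable_fun_itg.
exists (M * `|b - a|) => p.
have bF : bm (F p).
  by split; [exact: (measurableT_comp mF (pair1_measurable p))|exists M => x; apply: (hM (p, x))].
have [ab|ba] := leP a b.
  rewrite [X in _ * X]ger0_norm ?subr_ge0 //.
  by apply: norm_itg_le => // x _; apply: (hM (p, x)).
rewrite /itg set_itv_ge -?ltNge ?bnd_simp // Rintegral_set0 normr0.
by rewrite mulr_ge0 //; apply: le_trans (hM (p, 0)).
Qed.

Lemma itg_swap (F : R -> R -> R) a b a' b' :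
  bm (fun q : R * R => F q.1 q.2) ->
  itg a b (fun x => itg a' b' (F x)) = itg a' b' (fun y => itg a b (fun x => F x y)).
Proof.
move=> bF.
have bx x : bm (F x) by apply: (bm_comp bF (pair1_measurable x)).
have by_ y : bm (F ^~ y) by apply: (bm_comp bF (pair2_measurable y)).
(* Fubini is applied on the whole plane, to the integrand cut off outside the rectangle. *)
pose G (q : R * R) : \bar R :=
  if (q.1 \in `[a, b]) && (q.2 \in `[a', b']) then (F q.1 q.2)%:E else 0%E.
have mi (c e : R) : measurable_fun setT (fun x : R => x \in `[c, e]).
  by apply: (measurable_fun_bool true); rewrite setTI; exact: (measurable_itv `[c, e]).
have mG : measurable_fun setT G.
  apply: measurable_fun_ifT => //.
    by apply: measurable_and; apply: (measurableT_comp (mi _ _)).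
  by apply/measurable_EFinP; exact: bm_meas.
have restr1 (h : R -> R -> \bar R) (c e c' e' : R) x :
  (\int[leb]_y (if (x \in `[c, e]) && (y \in `[c', e']) then h x y else 0) =
   ((fun x => \int[leb]_(y in `[c', e']) h x y) \_ `[c, e]) x)%E.
  rewrite patchE mem_setE; case: ifP => _ /=; last by rewrite integral0.
  by rewrite [RHS]integral_mkcond; apply: eq_integral => y _; rewrite patchE mem_setE.
have [M hM] := bF.2.
have iG : (leb \x leb)%E.-integrable setT G.
  apply/integrable12ltyP => //.
  have GE x : (\int[leb]_y `|G (x, y)| = ((fun x => (itg a' b' (fun y => `|F x y|))%:E) \_ `[a, b]) x)%E.
    under eq_integral => y _ do rewrite /G (fun_if abse) abse0.
    rewrite (restr1 (fun x y => `|(F x y)%:E|)%E).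
    by rewrite !patchE; case: ifP => // _; rewrite EFin_itg //; exact: bm_norm.
  under eq_integral => x _ do rewrite GE.
  rewrite -integral_mkcond -EFin_itg ?ltry //.
  by apply: (@bm_itg _ _ (fun x y => `|F x y|)); exact: bm_norm.
have /= := Fubini iG.
have GE x : (\int[leb]_y G (x, y) = ((fun x => (itg a' b' (F x))%:E) \_ `[a, b]) x)%E.
  by rewrite (restr1 (fun x y => (F x y)%:E)%E) !patchE; case: ifP => // _; rewrite EFin_itg.
have GE' y : (\int[leb]_x G (x, y) = ((fun y => (itg a b (F ^~ y))%:E) \_ `[a', b']) y)%E.
  under eq_integral => x _ do rewrite /G andbC /=.
  by rewrite (restr1 (fun y x => (F x y)%:E)%E) !patchE; case: ifP => // _; rewrite EFin_itg.
under eq_integral => x _ do rewrite GE.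
under [X in _ = X -> _]eq_integral => x _ do rewrite GE'.
rewrite -!integral_mkcond -!EFin_itg; first by move=> [].
- apply: (@bm_itg _ _ (fun y x => F x y)).
  by apply: (bm_comp2 bF); [exact: measurable_snd|exact: measurable_fst].
- exact: bm_itg.
Qed.

End Integral.

(** * Translation invariance and periodic integrands *)

Section Translations.
Context {R : realType}.
Notation leb := (@lebesgue_measure R).
Implicit Types (f g : R -> R) (a b c : R).

(** The pushforward of Lebesgue measure under a translation agrees with it on half-open intervals,
    hence everywhere; the rest is a change of variables. *)
Lemma itg_translation a b c f : bm f ->
  itg a b (fun x => f (x + c)) = itg (a + c) (b + c) f.
Proof.
move=> bf.
pose phi : measurableTypeR R -> measurableTypeR R := fun x => x + c.
have mphi : measurable_fun setT phi.
  by apply: (@measurable_funD _ _ R setT (fun x => x) (fun _ => c)).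
have pre d e : phi @^-1` `[d + c, e + c] = `[d, e]%classic.
  by apply/seteqP; split => x /=; rewrite !in_itv /= !lerD2r.
have preoc d e : phi @^-1` `]d, e] = `]d - c, e - c]%classic.
  by apply/seteqP; split => x /=; rewrite !in_itv /= ltrBlDr lerBrDr.
have lebE A : measurable A -> leb A = pushforward leb phi A.
  apply: (lebesgue_measure_unique (mu := pushforward leb phi)) => _ [[d e]] _ <- /=.
  rewrite /pushforward preoc !lebesgue_measure_itv /= !lte_fin ltrD2r.
  by case: ifP => // _; rewrite -!EFinB; congr EFin; ring.
have mcomp : measurable_fun setT (f \o phi) by exact: (measurableT_comp (bm_meas bf)).
rewrite /itg /Rintegral; congr fine.
rewrite -(pre a b).
have := @integral_pushforward _ _ _ _ R phi mphi leb `[a + c, b + c] (EFin \o f).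
have mE : measurable_fun setT (EFin \o f) by apply/measurable_EFinP; exact: bm_meas.
have iE : leb.-integrable (phi @^-1` `[a + c, b + c]) ((EFin \o f) \o phi).
  by rewrite pre; apply: (bm_integrable a b (f := f \o phi)); apply: bm_comp.
move=> /(_ mE iE) <- //.
by apply: eq_measure_integral => A mA _; first [exact: lebE|exact: esym (lebE _ _)].
Qed.

Lemma bm_shift f c : bm f -> bm (fun x : R => f (x + c)).
Proof.
move=> bf; apply: (bm_comp bf).
by apply: (@measurable_funD _ _ R setT (fun x => x) (fun _ => c)).
Qed.

Lemma periodicZ f (n : int) x : periodic1 f -> f (x + n%:~R) = f x.
Proof.
move=> pf; have pn (k : nat) y : f (y + k%:R) = f y.
  elim: k => [|k IH]; first by rewrite addr0.
  by rewrite -addn1 natrD addrA pf.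
case: (intP n) => [|k|k]; first by rewrite addr0.
  exact: pn.
by rewrite -(pn k.+1 (x + _)) mulrNz addrNK.
Qed.

Lemma itg_periodic_shift f c : bm f -> periodic1 f ->
  itg 0 1 (fun x => f (x + c)) = itg 0 1 f.
Proof.
move=> bf pf.
suff H e : 0 <= e <= 1 -> itg 0 1 (fun x => f (x + e)) = itg 0 1 f.
  have -> : (fun x => f (x + c)) = fun x => f (x + (c - (Num.floor c)%:~R)).
    apply/funext => x; rewrite -(periodicZ (Num.floor c) (x + (c - _)) pf).
    by congr f; ring.
  apply: H; have := floor_le c; have := floorD1_gt c.
  by rewrite intrD /=; lra.
move=> /andP[e0 e1]; rewrite itg_translation // add0r.
have -> : itg e (1 + e) f = itg e 1 f + itg 1 (1 + e) f by apply: itg_split => //; lra.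
have -> : itg 0 1 f = itg 0 e f + itg e 1 f by apply: itg_split.
rewrite addrC; congr (_ + _).
have := itg_translation 0 e 1 bf; rewrite add0r [e + 1]addrC => <-.
by apply: eq_itg => x _; apply: pf.
Qed.

End Translations.

#[local] Instance ae_lebesgue_filter (R : realType) :
  Filter (nbhs (almost_everywhere (@lebesgue_measure R))).
Proof. exact: ae_filter_ringOfSetsType. Qed.

Section AlmostEverywhere.
Context {R : realType}.
Notation leb := (@lebesgue_measure R).
Implicit Types (f g : R -> R) (a b c : R).

Lemma ae_eq_itg a b f g : measurable_fun setT f -> measurable_fun setT g ->
  {ae leb, forall x, a <= x <= b -> f x = g x} -> itg a b f = itg a b g.
Proof.
move=> mf mg fg; rewrite /itg /Rintegral; congr fine.
apply: ae_eq_integral => //.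
- by apply/measurable_EFinP; apply: measurable_funTS.
- by apply/measurable_EFinP; apply: measurable_funTS.
- by apply: filterS fg => x h /=; rewrite in_itv /= => /h ->.
Qed.

Lemma itg_eq0_ae a b f : bm f -> (forall x, a <= x <= b -> 0 <= f x) ->
  itg a b f = 0 -> {ae leb, forall x, a <= x <= b -> f x = 0}.
Proof.
move=> bf f0 if0.
have mE : measurable_fun `[a, b]%classic (EFin \o f).
  by apply/measurable_EFinP; apply: measurable_funTS; exact: bm_meas.
have [H _] := @ae_eq_integral_abs _ _ R leb `[a, b]%classic (measurable_itv _) (EFin \o f) mE.
have := H _ => /(_ _) [].
  transitivity (itg a b f)%:E; last by rewrite if0.
  rewrite EFin_itg //; apply: eq_integral => x; rewrite inE /= in_itv /= => h.
  by rewrite ger0_norm // f0.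
move=> N [mN N0 hN]; exists N; split => // x nx; apply: hN => /= h; apply: nx => xab.
by have [] := h xab.
Qed.

Lemma itg_cvg_dominated a b (f_ : nat -> R -> R) f (M : R) :
  (forall n, measurable_fun setT (f_ n)) -> measurable_fun setT f ->
  (forall n x, a <= x <= b -> `|f_ n x| <= M) ->
  {ae leb, forall x, a <= x <= b -> f_ ^~ x @ \oo --> f x} ->
  (fun n => itg a b (f_ n)) @ \oo --> itg a b f.
Proof.
move=> mf_ mf fM fcvg.
have /= [] := @dominated_convergence _ _ R leb `[a, b]%classic (measurable_itv _)
  (fun n => EFin \o f_ n) (EFin \o f) (cst M%:E).
- by move=> n; apply/measurable_EFinP; apply: measurable_funTS; exact: mf_.
- by apply/measurable_EFinP; apply: measurable_funTS.
- apply: filterS fcvg => x h; rewrite /= in_itv /= => /h hx.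
  by apply/fine_cvgP; split => //; exact: nearW.
- by apply: (@bm_integrable _ a b (cst M)); exact: bm_cst.
- by apply: aeW => x n /=; rewrite in_itv /= => h; rewrite lee_fin fM.
move=> fi _ h; apply: fine_cvg; rewrite fineK //.
exact: integrable_fin_num.
Qed.

(** By monotone convergence the sum of the series has integral at most [C], so it is finite almost
    everywhere and bounds its own partial sums. *)
Lemma itg_series_ae a b (f_ : nat -> R -> R) (C : R) :
  (forall n, bm (f_ n)) -> (forall n x, 0 <= f_ n x) ->
  (forall N, \sum_(n < N) itg a b (f_ n) <= C) ->
  {ae leb, forall x, a <= x <= b -> exists C', forall N, \sum_(n < N) f_ n x <= C'}.
Proof.
move=> bf f0 hC.
pose F x := (\sum_(0 <= n <oo) (f_ n x)%:E)%E.
have F0 x : (0 <= F x)%E by apply: nneseries_ge0 => n _ _; rewrite lee_fin.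
have mfn n : measurable_fun `[a, b]%classic (fun x => (f_ n x)%:E).
  by apply/measurable_EFinP; apply: measurable_funTS; exact: bm_meas.
have mF : measurable_fun `[a, b]%classic F.
  by apply: ge0_emeasurable_sum => // n x _ _; rewrite lee_fin.
have iF : leb.-integrable `[a, b]%classic F.
  apply/integrableP; split => //.
  under eq_integral => x _ do rewrite gee0_abs //.
  rewrite integral_nneseries //; last by move=> n x _; rewrite lee_fin.
  apply: (@le_lt_trans _ _ C%:E); last exact: ltry.
  apply: lime_le; first by apply: is_cvg_nneseries => n _ _; apply: integral_ge0 => x _; rewrite lee_fin.
  apply: nearW => N; rewrite big_mkord.
  by under eq_bigr => n _ do rewrite -EFin_itg //; rewrite sumEFin lee_fin.
have mab : measurable (`[a, b]%classic : set (measurableTypeR R)) by exact: measurable_itv.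
have := integrable_ae mab iF; apply: filterS => x h xab.
have {h} Ffin : F x \is a fin_num by apply: h; rewrite /= in_itv.
exists (fine (F x)) => N; rewrite -lee_fin fineK // -sumEFin.
rewrite -(big_mkord xpredT (fun n => (f_ n x)%:E)).
by apply: nneseries_lim_ge => n _; rewrite lee_fin.
Qed.

End AlmostEverywhere.

Lemma cvg_of_bounded_variation {R : realType} (u : nat -> R) (C : R) :
  (forall N, \sum_(n < N) `|u n.+1 - u n| <= C) -> cvgn u.
Proof.
move=> hC.
pose w n := u n.+1 - u n.
have cvs : cvgn (series w).
  apply: normed_cvg; apply: (nondecreasing_is_cvgn (u_ := [normed series w])).
    by apply: nondecreasing_series => n _ _; exact: normr_ge0.
  by exists C => _ [N _ <-] /=; have := hC N; rewrite /series /= big_mkord.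
have -> : u = (fun n => series w n + u 0%N).
  apply/funext => n; rewrite /series /= telescope_sumr //.
  by rewrite subrK.
by apply: is_cvgD => //; exact: is_cvg_cst.
Qed.

(** * Continuity and approximation *)

(** Serves twice: for the rounding of one coordinate of a continuous function, and for the time
    index of the numerical solution. *)
Lemma measurable_countable_glue {R : realType} d (T : measurableType d)
  (I : countType) (N : T -> I) (h : I -> T -> R) :
  (forall k, measurable [set p | N p = k]) ->
  (forall k, measurable_fun setT (h k)) ->
  measurable_fun setT (fun p => h (N p) p).
Proof.
move=> mN mh _ Y mY; rewrite setTI.
have -> : (fun p => h (N p) p) @^-1` Y =
    \bigcup_k ([set p | N p = k] `&` (h k @^-1` Y)).
  apply/seteqP; split => [p Yp|p [k _ [<- //]]].
  by exists (N p).
apply: countable_bigcupT_measurable => [|k]; first exact: countableP.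
apply: measurableI => //.
by rewrite -[X in measurable X]setTI; apply: mh.
Qed.

Section ContinuousPlane.
Context {R : realType}.

Lemma cvg_pair_continuous (f : R * R -> R) (T : Type) (F : set_system T)
  {FF : Filter F} (f1 f2 : T -> R) (a b : R) :
  continuous f -> f1 @ F --> a -> f2 @ F --> b ->
  (fun x => f (f1 x, f2 x)) @ F --> f (a, b).
Proof.
move=> cf h1 h2; apply: (continuous2_cvg FF (h := fun x y => f (x, y)) _ h1 h2).
rewrite (_ : (fun z : R * R => f (z.1, z.2)) = f); first exact: cf.
by apply/funext => -[].
Qed.

(** Measurability refers to the product sigma-algebra. Rounding the first coordinate down to a
    multiple of 1/(n+1) gives a countable gluing of continuous functions of the second coordinate,
    and these converge pointwise to [f]. *)
Lemma continuous2_measurable (f : R * R -> R) :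
  continuous f -> measurable_fun setT f.
Proof.
move=> cf.
pose N n (p : R * R) : int := Num.floor (p.1 * n.+1%:R).
pose h (n : nat) (k : int) (p : R * R) := f (k%:~R / n.+1%:R, p.2).
have mh n k : measurable_fun setT (h n k).
  have c1 : continuous (fun t : R => f (k%:~R / n.+1%:R, t)).
    by move=> t; apply: (cvg_pair_continuous cf); [exact: cvg_cst|exact: cvg_id].
  exact: (measurableT_comp (continuous_measurable_fun c1) (@measurable_snd _ _ _ _)).
have mN n k : measurable [set p | N n p = k].
  have m1 : measurable_fun setT (fun p : R * R => (Num.floor (p.1 * n.+1%:R))%:~R : R).
    by apply: measurable_fun_floor; apply: measurable_funM.
  have := m1 measurableT [set (k%:~R : R)] (measurable_set1 _).
  rewrite setTI; congr measurable; apply/seteqP; split => p /=.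
    by move=> /eqP; rewrite eqr_int => /eqP.
  by rewrite /N => ->.
apply: (measurable_fun_cvg (h := fun n p => h n (N n p) p)) => [n|p _].
  exact: (measurable_countable_glue (mN n) (mh n)).
have lim1 : ((N n p)%:~R / n.+1%:R : R) @[n --> \oo] --> p.1.
  apply: (@squeeze_cvgr _ _ _ _ (fun n => p.1 - n.+1%:R^-1) (cst p.1)).
  - apply: nearW => n; have n0 : (0 : R) < n.+1%:R by [].
    have := floor_le (p.1 * n.+1%:R); have := floorD1_gt (p.1 * n.+1%:R).
    rewrite intrD -/(N n p) => h1 h2; apply/andP; split; last first.
      by rewrite ler_pdivrMr.
    rewrite ler_pdivlMr // mulrBl mulVf ?gt_eqF // lerBlDr.
    exact: ltW.
  - rewrite -[X in _ --> X]subr0; apply: cvgB; first exact: cvg_cst.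
    exact: cvg_harmonic.
  - exact: cvg_cst.
rewrite /h.
rewrite [X in _ --> f X]surjective_pairing.
by apply: (cvg_pair_continuous cf) => //; exact: cvg_cst.
Qed.

(** Only one of the two points has to lie in [K], so that a shift may leave the fundamental domain.
    Uniformity of the radius comes from the near-covering form of compactness. *)
Lemma uniform_continuity2 (f : R * R -> R) (K : set (R * R)) (e : R) :
  continuous f -> compact K -> 0 < e ->
  exists2 r : R, 0 < r & forall p q, K p -> `|q.1 - p.1| <= r ->
    `|q.2 - p.2| <= r -> `|f q - f p| <= e.
Proof.
move=> cf /compact_near_coveringP cK e0.
have e20 : 0 < e / 2 by rewrite divr_gt0.
have := cK R (0^'+) (fun r p => forall q : R * R, `|q.1 - p.1| <= r ->
    `|q.2 - p.2| <= r -> `|f q - f p| <= e) _ _.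
case.
- move=> p Kp.
  have /cvgrPdist_lt/(_ _ e20) := cf p.
  move=> /nbhs_ballP[d /= d0 hd].
  have d20 : 0 < d / 2 by rewrite divr_gt0.
  exists (ball p (d / 2), [set r : R | r < d / 2]).
    split; first exact: nbhsx_ballx.
    exact: nbhs_right_lt.
  move=> [p' r] [/= [pp1 pp2] rd] q q1 q2.
  rewrite /= in rd; rewrite /ball /= in pp1 pp2.
  have h1 : `|f p - f p'| < e / 2.
    by apply: hd; split; rewrite /ball /=; lra.
  have h2 : `|f p - f q| < e / 2.
    apply: hd; split; rewrite /ball /=.
      have := ler_distD p'.1 p.1 q.1; rewrite (distrC p'.1); lra.
    have := ler_distD p'.2 p.2 q.2; rewrite (distrC p'.2); lra.
  have := ler_distD (f p) (f q) (f p'); rewrite (distrC (f q) (f p)); lra.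
- move=> r /= r0 h.
  exists (r / 2); first by rewrite divr_gt0.
  move=> p q Kp; apply: h => //=; last by rewrite divr_gt0.
  rewrite sub0r normrN ger0_norm; lra.
Qed.
End ContinuousPlane.

(** Truncation to [-M, M]. It alters a function essentially bounded by [M] only on a null set, and
    being 1-Lipschitz it does not increase distances. *)
Definition clamp {R : realType} (M y : R) : R := Num.max (- M) (Num.min M y).

Section Clamp.
Context {R : realType}.
Implicit Types M : R.

Lemma clamp_norm M y : 0 <= M -> `|clamp M y| <= M.
Proof.
move=> M0; rewrite /clamp ler_norml le_max lexx /= ge_max ge_min lexx /=.
lra.
Qed.

Lemma clamp_id M y : `|y| <= M -> clamp M y = y.
Proof.
rewrite ler_norml => /andP[h1 h2]; rewrite /clamp.
by rewrite min_r // max_r.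
Qed.

Lemma clamp_lip M x y : `|clamp M x - clamp M y| <= `|x - y|.
Proof.
have lip_min (a b : R) : `|Num.min M a - Num.min M b| <= `|a - b|.
  rewrite ler_norml; have := ler_norm (a - b); have := ler_norm (b - a); rewrite (distrC b).
  by case: (leP M a) => h1; case: (leP M b) => h2 => *; apply/andP; split; lra.
rewrite /clamp; apply: le_trans (lip_min x y); move: (Num.min M x) (Num.min M y) => a b.
rewrite ler_norml; have := ler_norm (a - b); have := ler_norm (b - a); rewrite (distrC b).
by case: (leP (- M) a) => h1; case: (leP (- M) b) => h2 => *; apply/andP; split; lra.
Qed.

Lemma measurable_clamp d (T : measurableType d) (f : T -> R) M :
  measurable_fun setT f -> measurable_fun setT (fun x => clamp M (f x)).
Proof.
move=> mf; apply: measurable_fun_max => //.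
by apply: measurable_minr.
Qed.

Lemma continuous_lip_comp (T : topologicalType) (f : T -> R) (h : R -> R) :
  (forall x y, `|h x - h y| <= `|x - y|) -> continuous f -> continuous (fun x => h (f x)).
Proof.
move=> hl cf x; apply/cvgrPdist_lt => e e0.
have /cvgrPdist_lt/(_ _ e0) := cf x; apply: filterS => y.
exact: le_lt_trans (hl _ _).
Qed.

End Clamp.

Section Translation.
Context {R : realType}.
Notation leb := (@lebesgue_measure R).
Implicit Types (f g : R -> R) (a b c : R).

Lemma uniform_continuity1 f a b e : continuous f -> 0 < e ->
  exists2 r : R, 0 < r & forall x y, a <= x <= b -> `|y - x| <= r -> `|f y - f x| <= e.
Proof.
move=> cf e0.
have cf2 : continuous (fun p : R * R => f p.1).
  by move=> p; apply: continuous_comp; [exact: cvg_fst|exact: cf].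
have cK : compact (`[a, b]%classic `*` `[a, b]%classic : set (R * R)).
  by apply: compact_setX; exact: segment_compact.
have [r r0 hr] := uniform_continuity2 cf2 cK e0.
exists r => // x y xab yx; apply: (hr (x, x) (y, y)) => //=.
Qed.

(** Clamping the continuous approximations makes them bounded without increasing their distance to
    [f], which already takes its values in [-M, M]. *)
Lemma continuous_L1_approximation f a b (M e : R) : a <= b ->
  measurable_fun setT f -> (forall x, `|f x| <= M) -> 0 < e ->
  exists g, [/\ continuous g, bm g & itg a b (fun x => `|f x - g x|) <= e].
Proof.
move=> ab mf fM e0.
have bf : bm f by split => //; exists M.
have [g_ [cg ig cvg]] := approximation_continuous_integrable
  (measurable_itv `[a, b]) (leb_itv_fin a b) (bm_integrable a b bf).
have /fine_cvgP[fing] := cvg.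
move=> /cvgrPdist_lt/(_ _ e0) => /(filterI fing)[n _ /(_ n (leqnn n))] /= [fn].
rewrite sub0r normrN => hn.
pose g x := clamp M (g_ n x).
have M0 : 0 <= M by apply: le_trans (fM 0).
have gM x : `|g x| <= M by apply: clamp_norm.
have cgg : continuous g by apply: (continuous_lip_comp _ (cg n)) => x y; exact: clamp_lip.
have bg : bm g by split; [exact: continuous_measurable_fun|exists M].
exists g; split => //.
have -> : itg a b (fun x => `|f x - g x|) = fine (\int[leb]_(x in `[a, b]) `|(f x - g x)%:E|)%E by [].
apply: (@le_trans _ _ (fine (\int[leb]_(x in `[a, b]) `|(f x - g_ n x)%:E|)%E)); last first.
  by apply: le_trans (ltW hn); exact: ler_norm.
have mgn : measurable_fun setT (g_ n) by exact: continuous_measurable_fun.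
apply: fine_le => //.
  have := EFin_itg a b (bm_norm (bmB bf bg)) => /= <-; exact: fin_numE.
apply: ge0_le_integral => //.
- by apply: measurableT_comp => //; apply/measurable_EFinP; apply: measurable_funTS; exact: bm_meas (bmB bf bg).
- by apply: measurableT_comp => //; apply/measurable_EFinP; apply: measurable_funTS; exact: measurable_funB.
- move=> x _; rewrite lee_fin /g -[in leLHS](clamp_id (fM x)).
  exact: clamp_lip.
Qed.

Lemma translation_continuity f (M e : R) : periodic1 f ->
  measurable_fun setT f -> (forall x, `|f x| <= M) -> 0 < e ->
  exists2 r : R, 0 < r & forall z, `|z| <= r -> itg 0 1 (fun x => `|f (x + z) - f x|) <= e.
Proof.
move=> pf mf fM e0.
have bf : bm f by split => //; exists M.
have e30 : 0 < e / 3 by rewrite divr_gt0.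
(* The approximation is made on [-1, 2], which contains every translate of [0, 1] by at most 1. *)
have m12 : -1 <= 2 :> R by lra.
have [g [cg bg hg]] := continuous_L1_approximation m12 mf fM e30.
have [r r0 hr] := uniform_continuity1 0 1 cg e30.
exists (Num.min r 1) => [|z]; first by rewrite lt_min r0 ltr01.
rewrite le_min => /andP[zr z1].
have bfg : bm (fun x => `|f x - g x|) by apply: bm_norm; exact: bmB.
have sub c d : -1 <= c -> c <= d -> d <= 2 -> itg c d (fun x => `|f x - g x|) <= e / 3.
  move=> c1 cd d2; apply: le_trans hg.
  rewrite (@itg_split _ (-1) c 2) //; last by lra.
  rewrite (@itg_split _ c d 2) // addrCA -[leLHS]addr0 lerD2l.
  by apply: addr_ge0; apply: itg_ge0 => x _; exact: normr_ge0.
have bz := bm_shift z bfg; have bgz := bm_shift z bg.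
apply: (@le_trans _ _ (itg 0 1 (fun x => `|f (x + z) - g (x + z)| + e / 3 + `|f x - g x|))).
  apply: le_itg.
  - by apply: bm_norm; apply: bmB => //; apply: bm_shift.
  - by apply: bmD => //; apply: bmD => //; exact: bm_cst.
  - move=> x x01.
    have := hr x (x + z) x01; rewrite addrAC subrr add0r => /(_ zr) h1.
    have := ler_distD (g (x + z)) (f (x + z)) (f x).
    have := ler_distD (g x) (g (x + z)) (f x).
    rewrite (distrC (g x)); lra.
rewrite itgD //; last by apply: bmD => //; exact: bm_cst.
rewrite itgD //; last exact: bm_cst.
rewrite itg_cst // subr0 mulr1.
rewrite (itg_translation 0 1 z bfg).
move: z1; rewrite ler_norml => /andP[z1 z2].
have h1 : itg (0 + z) (1 + z) (fun x => `|f x - g x|) <= e / 3 by apply: sub; lra.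
have h2 : itg 0 1 (fun x => `|f x - g x|) <= e / 3 by apply: sub; lra.
lra.
Qed.
End Translation.

(** * The kernel *)

Section Projections.
Context {d d1 d2} {T : measurableType d} {T1 : measurableType d1} {T2 : measurableType d2}.

Lemma measurable_fun_fst (f : T -> T1 * T2) :
  measurable_fun setT f -> measurable_fun setT (fun q => (f q).1).
Proof. by move=> mf; apply: (measurableT_comp measurable_fst). Qed.

Lemma measurable_fun_snd (f : T -> T1 * T2) :
  measurable_fun setT f -> measurable_fun setT (fun q => (f q).2).
Proof. by move=> mf; apply: (measurableT_comp measurable_snd). Qed.

End Projections.

Section ConstantIdentity.
Context {d d1} {T : measurableType d} {T1 : measurableType d1}.
Lemma measurable_fun_cst (c : T1) : measurable_fun setT (fun _ : T => c).
Proof. exact: measurable_cst. Qed.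
Lemma measurable_fun_id : measurable_fun setT (fun x : T => x).
Proof. exact: measurable_id. Qed.
End ConstantIdentity.

Lemma measurable_fun_opp {R : realType} : measurable_fun setT (-%R : R -> R).
Proof. exact: oppr_measurable. Qed.

Lemma measurable_fun_addl {R : realType} (c : R) : measurable_fun setT (+%R c).
Proof. exact: (@measurable_funD _ _ R setT (fun _ => c) (fun x => x)). Qed.

Lemma measurable_fun_mull {R : realType} (c : R) : measurable_fun setT ( *%R c).
Proof. exact: mulrl_measurable. Qed.

Lemma bm_comp4 {R : realType} d (T : measurableType d) (F : R -> R -> R -> R -> R)
  (f1 f2 f3 f4 : T -> R) :
  bm (fun p : R * R * R * R => F p.1.1.1 p.1.1.2 p.1.2 p.2) ->
  measurable_fun setT f1 -> measurable_fun setT f2 ->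
  measurable_fun setT f3 -> measurable_fun setT f4 ->
  bm (fun q => F (f1 q) (f2 q) (f3 q) (f4 q)).
Proof.
move=> bF m1 m2 m3 m4.
apply: (bm_comp bF (g := fun q => (f1 q, f2 q, f3 q, f4 q))).
by do 3! (apply: measurable_fun_pair => //).
Qed.

Lemma convKpE {R : realType} (w : R -> R) x :
  convKp w x = itg 0 1 (fun y => Kp (x - y) * w y).
Proof. by []. Qed.

Lemma bm_conv {R : realType} d (T : measurableType d) (w : T -> R -> R) (f : T -> R) :
  bm (@Kp R) -> bm (fun q : T * R => w q.1 q.2) -> measurable_fun setT f ->
  bm (fun q => convKp (w q) (f q)).
Proof.
move=> bK bw mf; apply: (bm_itg (F := fun q y => Kp (f q - y) * w q y)).
apply: bmM => //; apply: (bm_comp bK); apply: measurable_funB.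
  by apply: (measurableT_comp mf).
exact: measurable_snd.
Qed.

Lemma bm_convKp {R : realType} (w : R -> R) : bm (@Kp R) -> bm w -> bm (convKp w).
Proof.
move=> bK bw; apply: (bm_conv (w := fun _ => w) (f := fun x => x)) => //.
exact: (bm_comp bw measurable_snd).
Qed.

Lemma measurable_conv {R : realType} d (T : measurableType d) (w : T -> R -> R) (f : T -> R) :
  bm (@Kp R) -> measurable_fun setT (fun q : T * R => w q.1 q.2) -> measurable_fun setT f ->
  measurable_fun setT (fun q => convKp (w q) (f q)).
Proof.
move=> bK mw mf; apply: (measurable_fun_itg (F := fun q y => Kp (f q - y) * w q y)).
apply: measurable_funM => //; apply: (measurableT_comp (bm_meas bK)); apply: measurable_funB.
  by apply: (measurableT_comp mf).
exact: measurable_snd.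
Qed.

Lemma measurable_convKp {R : realType} (w : R -> R) : bm (@Kp R) ->
  measurable_fun setT w -> measurable_fun setT (convKp w).
Proof.
move=> bK mw; apply: (measurable_conv (w := fun _ => w) (f := fun x => x)) => //.
exact: (measurableT_comp mw measurable_snd).
Qed.

(** Kruzhkov's entropy flux for u^2/2. It equals |a - b| (a + b) / 2, hence is continuous and
    symmetric; the symmetry is what makes the fluxes cancel under doubling. *)
Definition eflux {R : realType} (a b : R) : R := Num.sg (a - b) * ((a ^+ 2 - b ^+ 2) / 2).

Lemma measurable_eflux {R : realType} d (T : measurableType d) (f g : T -> R) :
  measurable_fun setT f -> measurable_fun setT g -> measurable_fun setT (fun q => eflux (f q) (g q)).
Proof.
move=> mf mg; apply: measurable_funM.
  by apply: measurable_fun_sg; exact: measurable_funB.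
apply: measurable_funM => //.
by apply: measurable_funB; exact: measurable_funX.
Qed.

Lemma bm_eflux {R : realType} d (T : measurableType d) (f g : T -> R) :
  bm f -> bm g -> bm (fun q => eflux (f q) (g q)).
Proof.
move=> bf bg; apply: bmM.
  by apply: bm_sg; apply: measurable_funB; exact: bm_meas.
apply: bmM; last exact: bm_cst.
by apply: bmB; exact: bmX.
Qed.

(** * Syntax-directed proofs of measurability and boundedness *)

Ltac measurability_step :=
  lazymatch goal with
  | |- measurable_fun _ (fun _ => ?c) => exact: measurable_fun_cst
  | |- measurable_fun _ (fun q => q) => exact: measurable_fun_id
  | |- measurable_fun _ id => exact: measurable_id
  | |- measurable_fun _ fst => exact: (measurable_fun_fst measurable_fun_id)
  | |- measurable_fun _ snd => exact: (measurable_fun_snd measurable_fun_id)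
  | |- measurable_fun _ (fun q => _ + _) => apply: measurable_funD
  | |- measurable_fun _ (fun q => - _) => apply: measurable_funN
  | |- measurable_fun _ (fun q => _ * _) => apply: measurable_funM
  | |- measurable_fun _ (fun q => _ ^+ _) => apply: measurable_funX
  | |- measurable_fun _ (fun q => `|_|) => apply: measurable_fun_norm
  | |- measurable_fun _ (fun q => Num.sg _) => apply: measurable_fun_sg
  | |- measurable_fun _ (fun q => Num.max _ _) => apply: measurable_fun_max
  | |- measurable_fun _ (fun q => (Num.floor _)%:~R) => apply: measurable_fun_floor
  | |- measurable_fun _ (fun q => expR _) => apply: (measurableT_comp (@measurable_expR _))
  | |- measurable_fun _ (fun q => itg _ _ _) => apply: measurable_fun_itg
  | |- measurable_fun _ (fun q => eflux _ _) => apply: measurable_eflux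
  | |- measurable_fun _ (fun q => convKp _ _) =>
      match goal with H : bm (@Kp _) |- _ => apply: (measurable_conv H) end
  | |- measurable_fun _ (fun q => (_).1) => apply: measurable_fun_fst
  | |- measurable_fun _ (fun q => (_).2) => apply: measurable_fun_snd
  | |- measurable_fun _ (fun q => ?u (@?f q) (@?g q)) =>
      first [ match goal with H : measurable_fun setT (fun p => u p.1 p.2) |- _ => apply: (measurable_comp2 H) end
            | match goal with H : bm (fun p => u p.1 p.2) |- _ => apply: (measurable_comp2 (bm_meas H)) end
            | match goal with H : measurable_fun setT (u _) |- _ => apply: (measurableT_comp H) end
            | match goal with H : bm (u _) |- _ => apply: (measurableT_comp (bm_meas H)) end ]
  | |- measurable_fun _ (fun q => ?u (@?f q)) =>
      first [ match goal with H : measurable_fun setT u |- _ => apply: (measurableT_comp H) end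
            | match goal with H : bm u |- _ => apply: (measurableT_comp (bm_meas H)) end ]
  | |- measurable_fun _ -%R => exact: measurable_fun_opp
  | |- measurable_fun _ (+%R _) => exact: measurable_fun_addl
  | |- measurable_fun _ ( *%R _) => exact: measurable_fun_mull
  | |- measurable_fun _ (convKp _) =>
      match goal with H : bm (@Kp _) |- _ => apply: (measurable_convKp H) end
  | |- measurable_fun ?S (?u ?a) =>
      first [ assumption
            | match goal with H : bm (u a) |- _ => exact: (bm_meas H) end
            | match goal with H : bm (fun p => u p.1 p.2) |- _ =>
                change (measurable_fun S (fun q => u a q)); apply: (measurable_comp2 (bm_meas H)) end
            | match goal with H : measurable_fun setT (fun p => u p.1 p.2) |- _ =>
                change (measurable_fun S (fun q => u a q)); apply: (measurable_comp2 H) end ]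
  | |- measurable_fun _ ?u =>
      first [ assumption | match goal with H : bm u |- _ => exact: (bm_meas H) end
       | match goal with H : measurable_fun setT (fun p => u p) |- _ => exact: H end
       | apply: bm_meas; eassumption ]
  end.
Ltac mtac := repeat (cbv beta; measurability_step).

Ltac bm_step2 :=
  lazymatch goal with
  | |- bm (fun q => ?u (@?f q) (@?g q)) =>
      first [ match goal with H : bm (fun p => u p.1 p.2) |- _ => apply: (bm_comp2 H); mtac end
            | match goal with H : bm (u _) |- _ => apply: (bm_comp H); mtac end ]
  | |- bm (fun q => ?u (@?f q)) =>
      match goal with H : bm u |- _ => apply: (bm_comp H); mtac end
  | |- bm (convKp _) => match goal with H : bm (@Kp _) |- _ => apply: (bm_convKp H) end
  | |- bm (?u ?a) =>
      first [ assumption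
            | match goal with H : bm (fun p => u p.1 p.2) |- _ =>
                change (bm (fun q => u a q)); apply: (bm_comp2 H); mtac end ]
  | |- bm _ => assumption
  end.

Ltac bm_step :=
  lazymatch goal with
  | |- bm (fun _ => ?c) => exact: bm_cst
  | |- bm (fun q => _ + _) => apply: bmD
  | |- bm (fun q => - _) => apply: bmN
  | |- bm (fun q => _ * _) => apply: bmM
  | |- bm (fun q => _ ^+ _) => apply: bmX
  | |- bm (fun q => `|_|) => apply: bm_norm
  | |- bm (fun q => Num.sg _) => apply: bm_sg; mtac
  | |- bm (fun q => Num.max _ _) => apply: bm_max
  | |- bm (fun q => itg _ _ _) => apply: bm_itg
  | |- bm (fun q => eflux _ _) => apply: bm_eflux
  | |- bm (fun q => convKp _ _) =>
      match goal with H : bm (@Kp _) |- _ => apply: (bm_conv H); [|mtac] end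
  | |- bm (fun q => ?u (@?f q) (@?g q) (@?h q) (@?k q)) =>
      first [ match goal with H : bm (fun p => u p.1.1.1 p.1.1.2 p.1.2 p.2) |- _ => apply: (bm_comp4 H); mtac end
            | match goal with H : bm (fun p => u ?a ?b p.1 p.2) |- _ => apply: (bm_comp2 H); mtac end
            | bm_step2 ]
  | |- _ => bm_step2 end.
Ltac btac := repeat (cbv beta; bm_step).

(** * The kernel K' and convolution with it *)

Section Kernel.
Context {R : realType}.
Notation leb := (@lebesgue_measure R).
Local Notation frac := Defs.frac.
Implicit Types (w : R -> R) (x y : R).

Lemma frac_ge0 x : 0 <= frac x.
Proof. by rewrite /frac subr_ge0 floor_le. Qed.

Lemma frac_lt1 x : frac x < 1.
Proof. by rewrite /frac ltrBlDl; have := floorD1_gt x; rewrite intrD. Qed.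

Lemma frac_id x : 0 <= x < 1 -> frac x = x.
Proof.
move=> h; rewrite /frac (_ : Num.floor x = 0) ?subr0 //.
by apply: floor_def; rewrite add0r.
Qed.

Lemma fracD1 x : frac (x + 1) = frac x.
Proof.
by rewrite /frac floorDrz ?int_num1 // floor1 intrD /=; ring.
Qed.

Lemma Kp_periodic : periodic1 (@Kp R).
Proof. by move=> x; rewrite /Kp fracD1. Qed.

(** A crude bound of |K'|: both exponentials in the sinh are at most e^(1/2) on a period, and the
    summand 1 gives [1 <= kappa] at once. *)
Definition kappa : R := `|expR (2^-1) / (expR 1 - 1) : R| * expR (2^-1) + 1.

Lemma kappa_ge1 : 1 <= kappa.
Proof. by rewrite /kappa lerDr mulr_ge0 // expR_ge0. Qed.

Lemma Kp_bound x : `|Kp x| <= kappa.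
Proof.
rewrite /Kp normrM /kappa.
apply: (@le_trans _ _ (`|expR 2^-1 / (expR 1 - 1) : R| * expR 2^-1)); last by rewrite lerDl.
apply: ler_wpM2l => //.
have := frac_ge0 x; have := frac_lt1 x => h1 h2.
have e1 : expR (frac x - 2^-1) <= expR (2^-1) :> R by rewrite ler_expR; lra.
have e2 : expR (- (frac x - 2^-1)) <= expR (2^-1) :> R by rewrite ler_expR; lra.
have := expR_gt0 (frac x - 2^-1); have := expR_gt0 (- (frac x - 2^-1)).
by rewrite /sinhR ler_norml => *; apply/andP; split; lra.
Qed.

Lemma bm_Kp : bm (@Kp R).
Proof.
split; last by exists kappa; exact: Kp_bound.
rewrite /Kp /sinhR /frac; mtac.
Qed.

Lemma itg_FTC (f F : R -> R) (a b : R) : a < b -> continuous f ->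
  (forall x, is_derive x 1 F (f x)) -> itg a b f = F b - F a.
Proof.
move=> ab cf dF.
have dF' x : derivable F x 1 by exact: (@ex_derive _ _ _ _ _ _ _ (dF x)).
have cF : continuous F by move=> x; apply/differentiable_continuous/derivable1_diffP.
rewrite /itg /Rintegral (continuous_FTC2 (F := F) ab) //.
- by apply: continuous_subspaceT => x; exact: cf.
- split => //.
  + by apply: cvg_at_right_filter; exact: cF.
  + by apply: cvg_at_left_filter; exact: cF.
- by move=> x _; rewrite derive1E; exact: (@derive_val _ _ _ _ _ _ _ (dF x)).
Qed.

(** K' has mean zero because K is periodic: inside a period the antiderivative is a multiple of
    cosh(1/2 - z), which takes equal values at both ends. The jump of [frac] concerns a null set
    only. *)
Lemma itg_Kp_opp : itg 0 1 (fun z : R => Kp (- z)) = 0.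
Proof.
pose c : R := expR (2^-1) / (expR 1 - 1).
pose f z : R := c * sinhR (2^-1 - z).
have -> : itg 0 1 (fun z : R => Kp (- z)) = itg 0 1 f.
  apply: ae_eq_itg.
  - by have bK := bm_Kp; mtac.
  - by rewrite /f /sinhR; mtac.
  exists [set 0; 1]; split.
  - by apply: measurableU; exact: measurable_set1.
  - by apply/eqP; rewrite -measure_le0; apply: (le_trans (measureU2 _ _ _)) => //=; rewrite !lebesgue_measure_set1 adde0.
  move=> z /= h; apply: contrapT => nz; apply: h => /andP[z0 z1].
  have z0' : 0 < z by rewrite lt_neqAle z0 andbT eq_sym; apply/eqP => ez; apply: nz; left.
  have z1' : z < 1 by rewrite lt_neqAle z1 andbT; apply/eqP => ez; apply: nz; right.
  rewrite /Kp -fracD1 frac_id; last by apply/andP; split; lra.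
  by rewrite /f /c; congr (_ * sinhR _); lra.
pose F z : R := - c * coshR (2^-1 - z).
have dF (z : R) : is_derive z 1 F (f z).
  rewrite /F /f /coshR /sinhR; apply: is_derive_eq.
  by rewrite /GRing.scale /=; field.
have df (z : R) : is_derive z 1 f (- c * coshR (2^-1 - z)).
  rewrite /f /coshR /sinhR; apply: is_derive_eq.
  by rewrite /GRing.scale /=; field.
rewrite (itg_FTC (F := F)) //.
  rewrite /F /coshR (_ : 2^-1 - 1 = - 2^-1 :> R); last by field.
  by rewrite subr0 opprK; ring.
move=> z; apply/differentiable_continuous/derivable1_diffP.
exact: (@ex_derive _ _ _ _ _ _ _ (df z)).
Qed.

(** Here the kernel no longer depends on [x], so convolutions taken at two different points can be
    compared under one integral. *)
Lemma conv_shift w x : bm w -> periodic1 w ->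
  convKp w x = itg 0 1 (fun z => Kp (- z) * w (x + z)).
Proof.
move=> bw pw; rewrite convKpE.
have bK := bm_Kp.
rewrite -(@itg_periodic_shift _ (fun y => Kp (x - y) * w y) x).
- by apply: eq_itg => z _; rewrite opprD addrCA subrr addr0 (addrC z).
- by btac.
- move=> y; rewrite pw; congr (_ * _).
  by rewrite -[LHS]Kp_periodic; congr Kp; ring.
Qed.

Lemma conv_bound w x (M : R) : bm w -> (forall y, `|w y| <= M) -> `|convKp w x| <= kappa * M.
Proof.
move=> bw wM; rewrite convKpE.
have bK := bm_Kp.
rewrite -[leRHS]mulr1 -[X in _ * X](subr0 1); apply: norm_itg_le => //; first by btac.
by move=> y _; rewrite normrM; apply: ler_pM => //; exact: Kp_bound.
Qed.

Lemma convB w w' x : bm w -> bm w' ->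
  convKp (fun y => w y - w' y) x = convKp w x - convKp w' x.
Proof.
move=> bw bw'; rewrite !convKpE.
have bK := bm_Kp.
rewrite -itgB; [|by btac|by btac].
by apply: eq_itg => y _; rewrite mulrBr.
Qed.

Lemma convZ w (c : R) x : bm w ->
  convKp (fun y => c * w y) x = c * convKp w x.
Proof.
move=> bw; rewrite !convKpE.
have bK := bm_Kp.
rewrite -itgZl; last by btac.
by apply: eq_itg => y _; rewrite mulrCA.
Qed.

(** A kernel of mean zero annihilates constants; this removes the level [lam] from the nonlocal
    term. *)
Lemma conv_subr_cst w (c : R) x : bm w -> convKp (fun y => w y - c) x = convKp w x.
Proof.
move=> bw; rewrite convB //; last exact: bm_cst.
rewrite (@conv_shift (fun _ => c)) //; last exact: bm_cst.
have bK := bm_Kp.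
by rewrite itgZr ?itg_Kp_opp ?mul0r ?subr0 //; btac.
Qed.

Lemma conv_periodic w : bm w -> periodic1 (convKp w).
Proof.
move=> bw x; rewrite !convKpE; apply: eq_itg => y _.
by rewrite addrAC Kp_periodic.
Qed.

End Kernel.

(* Keeps unification from unfolding iterated integrals. *)
#[global] Opaque itg.

(** * Approximate entropy solutions *)

Section Lipschitz.
Context {R : realType}.
Implicit Types (f g : R -> R) (T L : R).

Lemma mean_value (f f' : R -> R) (a b : R) : (forall x : R, is_derive x 1 f (f' x)) ->
  exists2 c, Num.min a b <= c <= Num.max a b & f b - f a = f' c * (b - a).
Proof.
move=> df.
have cf : continuous f.
  move=> x; apply/differentiable_continuous/derivable1_diffP.
  exact: (@ex_derive _ _ _ _ _ _ _ (df x)).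
have [ab|ba|->] := ltgtP a b; last by exists b; rewrite ?lexx // !subrr mulr0.
- have [c] := @MVT _ f f' a b ab (fun x _ => df x) (continuous_subspaceT cf).
  by rewrite in_itv /= => /andP[/ltW h1 /ltW h2] h; exists c; rewrite ?h1.
- have [c] := @MVT _ f f' b a ba (fun x _ => df x) (continuous_subspaceT cf).
  rewrite in_itv /= => /andP[/ltW h1 /ltW h2] h; exists c; rewrite ?h1 //.
  by rewrite -opprB h -mulrN opprB.
Qed.

Lemma lip_of_derive (f f' : R -> R) L : (forall x : R, is_derive x 1 f (f' x)) ->
  (forall x, `|f' x| <= L) -> forall x y, `|f x - f y| <= L * `|x - y|.
Proof.
move=> df hf x y; have [c _ ->] := mean_value y x df.
by rewrite normrM ler_wpM2r.
Qed.

Definition blip (g : R -> R) := exists2 L, 0 <= L & forall x y, `|g x| <= L /\ `|g x - g y| <= L * `|x - y|.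

Lemma blip_of_derive (f f' : R -> R) L : (forall x : R, is_derive x 1 f (f' x)) ->
  (forall x, `|f x| <= L) -> (forall x, `|f' x| <= L) -> blip f.
Proof.
move=> df hf hf'; exists L; first exact: le_trans (hf 0).
by move=> x y; split => //; exact: (lip_of_derive df).
Qed.

Definition ulip {I : Type} (P : I -> Prop) T (f : I -> R -> R -> R) :=
  exists2 L, 0 <= L & forall i, P i -> forall x t x' t', 0 <= t <= T -> 0 <= t' <= T ->
    `|f i x t| <= L /\ `|f i x t - f i x' t'| <= L * (`|x - x'| + `|t - t'|).

Section Families.
Context {I : Type} (P : I -> Prop) (T : R).
Implicit Types (F G : I -> R -> R -> R).

Lemma ulipD F G : ulip P T F -> ulip P T G -> ulip P T (fun i x t => F i x t + G i x t).
Proof.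
move=> [L L0 hL] [N N0 hN]; exists (L + N); first exact: addr_ge0.
move=> i Pi x t x' t' ht ht'.
have [a1 a2] := hL i Pi x t x' t' ht ht'; have [b1 b2] := hN i Pi x t x' t' ht ht'.
split; first by apply: (le_trans (ler_normD _ _)); exact: lerD.
rewrite opprD addrACA mulrDl; apply: (le_trans (ler_normD _ _)); exact: lerD.
Qed.

Lemma ulipN F : ulip P T F -> ulip P T (fun i x t => - F i x t).
Proof.
move=> [L L0 hL]; exists L => // i Pi x t x' t' ht ht'.
have [a1 a2] := hL i Pi x t x' t' ht ht'.
by rewrite normrN -opprD normrN.
Qed.

Lemma ulipM F G : ulip P T F -> ulip P T G -> ulip P T (fun i x t => F i x t * G i x t).
Proof.
move=> [L L0 hL] [N N0 hN]; exists (L * N + L * N); first by rewrite addr_ge0 // mulr_ge0.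
move=> i Pi x t x' t' ht ht'.
have [a1 a2] := hL i Pi x t x' t' ht ht'; have [b1 b2] := hN i Pi x t x' t' ht ht'.
have [b3 _] := hN i Pi x' t' x t ht' ht.
split.
  rewrite normrM; apply: (@le_trans _ _ (L * N)); first exact: ler_pM.
  by rewrite lerDl mulr_ge0.
have -> : F i x t * G i x t - F i x' t' * G i x' t' =
  F i x t * (G i x t - G i x' t') + (F i x t - F i x' t') * G i x' t' by ring.
apply: (le_trans (ler_normD _ _)); rewrite !normrM mulrDl; apply: lerD.
  by rewrite -mulrA; exact: ler_pM.
by rewrite mulrAC; exact: ler_pM.
Qed.

Lemma ulip_space g (c : I -> R) : blip g -> ulip P T (fun i x t => g (x - c i)).
Proof.
move=> [L L0 hL]; exists L => // i Pi x t x' t' ht ht'.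
have [h1 h2] := hL (x - c i) (x' - c i); split => //; apply: (le_trans h2).
by rewrite ler_wpM2l // opprB addrA subrK lerDl.
Qed.

Lemma ulip_space_sub g (c : I -> R) : blip g -> ulip P T (fun i x t => g (c i - x)).
Proof.
move=> [L L0 hL]; exists L => // i Pi x t x' t' ht ht'.
have [h1 h2] := hL (c i - x) (c i - x'); split => //; apply: (le_trans h2).
rewrite ler_wpM2l // (_ : c i - x - (c i - x') = - (x - x')); last by ring.
by rewrite normrN lerDl.
Qed.

Lemma ulip_time g (c : I -> R) : blip g -> ulip P T (fun i x t => g (t - c i)).
Proof.
move=> [L L0 hL]; exists L => // i Pi x t x' t' ht ht'.
have [h1 h2] := hL (t - c i) (t' - c i); split => //; apply: (le_trans h2).
by rewrite ler_wpM2l // opprB addrA subrK lerDr.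
Qed.

Lemma ulip_time_sub g (c : I -> R) : blip g -> ulip P T (fun i x t => g (c i - t)).
Proof.
move=> [L L0 hL]; exists L => // i Pi x t x' t' ht ht'.
have [h1 h2] := hL (c i - t) (c i - t'); split => //; apply: (le_trans h2).
rewrite ler_wpM2l // (_ : c i - t - (c i - t') = - (t - t')); last by ring.
by rewrite normrN lerDr.
Qed.

Lemma ulip_cst (c : I -> R) L : (forall i, P i -> `|c i| <= L) -> ulip P T (fun i x t => c i).
Proof.
move=> hc; exists `|L| => // i Pi x t x' t' _ _; rewrite subrr normr0 mulr_ge0 ?addr_ge0 //.
by split => //; apply: (le_trans (hc i Pi)); exact: ler_norm.
Qed.

End Families.
End Lipschitz.

Section Approximate.
Context {R : realType}.
Implicit Types (T M L rho lam : R) (u phi phix phit : R -> R -> R).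

(** This is what the consistency error of a scheme consumes: Lipschitz derivatives make difference
    quotients of [phi] accurate to first order in the step. *)
Definition regular T L phi phix phit : Prop := forall x t x' t',
  0 <= t <= T -> 0 <= t' <= T ->
  [/\ `|phi x t| <= L, `|phix x t| <= L, `|phit x t| <= L,
      `|phix x t - phix x' t'| <= L * (`|x - x'| + `|t - t'|) &
      `|phit x t - phit x' t'| <= L * (`|x - x'| + `|t - t'|)].

Lemma ulip_regular (I : Type) (P : I -> Prop) T (phi phix phit : I -> R -> R -> R) :
  ulip P T phi -> ulip P T phix -> ulip P T phit ->
  exists L, forall i, P i -> regular T L (phi i) (phix i) (phit i).
Proof.
move=> [L1 L10 h1] [L2 L20 h2] [L3 L30 h3]; exists (L1 + L2 + L3) => i Pi x t x' t' ht ht'.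
have [a1 a2] := h1 i Pi x t x' t' ht ht'; have [b1 b2] := h2 i Pi x t x' t' ht ht'.
have [c1 c2] := h3 i Pi x t x' t' ht ht'.
have d0 : 0 <= `|x - x'| + `|t - t'| by exact: addr_ge0.
split; [lra|lra|lra| |].
- by apply: (le_trans b2); rewrite ler_wpM2r //; lra.
- by apply: (le_trans c2); rewrite ler_wpM2r //; lra.
Qed.

Definition entropy_form T u lam phi phix phit : R :=
  itg 0 T (fun t => itg 0 1 (fun x => entropy_integrand u lam phi phix phit x t)).

(* [rho * L] is the defect left by a numerical scheme of small step. *)
Definition approx_entropy_solution T M rho (u0 : R -> R) u : Prop :=
  [/\ bm (fun p : R * R => u p.1 p.2), forall x t, `|u x t| <= M,
      forall t, periodic1 (u ^~ t) &
      forall lam L phi phix phit, `|lam| <= M -> test_fun phi phix phit ->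
        regular T L phi phix phit ->
        0 <= entropy_form T u lam phi phix phit
             + itg 0 1 (fun x => `|u0 x - lam| * phi x 0) + rho * L].

Lemma efluxC (a b : R) : eflux a b = eflux b a.
Proof. by rewrite /eflux -(opprB b a) sgrN; ring. Qed.

Lemma efluxE (a b : R) : eflux a b = `|a - b| * ((a + b) / 2).
Proof. by rewrite /eflux normrEsg; ring. Qed.

Lemma eflux_bound M (a b : R) : `|a| <= M -> `|b| <= M -> `|eflux a b| <= M * `|a - b|.
Proof.
move=> ha hb; rewrite efluxE normrM normr_id mulrC ler_wpM2r //.
have := ler_normD a b; rewrite normrM [ `|2^-1|]ger0_norm; lra.
Qed.

End Approximate.

(** * Doubling of variables *)

Section BoundedLipschitz.
Context {R : realType}.

Lemma blip_continuous (g : R -> R) : blip g -> continuous g.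
Proof.
move=> [L L0 hL] x; apply/cvgrPdist_lt => e e0.
have L1 : 0 < L + 1 by lra.
near=> y.
have [_ h] := hL x y; apply: (le_lt_trans h).
apply: (@le_lt_trans _ _ ((L + 1) * `|x - y|)).
  by rewrite ler_wpM2r // lerDl.
rewrite mulrC -ltr_pdivlMr //.
by near: y; apply: cvgr_dist_lt => //; exact: divr_gt0.
Unshelve. all: by end_near. Qed.

Lemma blip_bm (g : R -> R) : blip g -> bm g.
Proof.
move=> bg; split; first by apply: continuous_measurable_fun; exact: blip_continuous.
by case: bg => L _ hL; exists L => x; have [] := hL x x.
Qed.

End BoundedLipschitz.

Section FourFold.
Context {R : realType}.
Variables (T : R).

(** The outer integrals run over the first point (x, t), the inner ones over the second point (y,
    s). Each solution is tested with the other point frozen, so both orders of integration occur. *)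
Definition itg4 (F : R -> R -> R -> R -> R) : R :=
  itg 0 T (fun t => itg 0 1 (fun x => itg 0 T (fun s => itg 0 1 (fun y => F x t y s)))).

Lemma itg4_swap (F : R -> R -> R -> R -> R) :
  bm (fun p : R * R * R * R => F p.1.1.1 p.1.1.2 p.1.2 p.2) ->
  itg 0 T (fun s => itg 0 1 (fun y => itg 0 T (fun t => itg 0 1 (fun x => F x t y s)))) = itg4 F.
Proof.
move=> bF; rewrite /itg4.
transitivity (itg 0 T (fun s => itg 0 T (fun t => itg 0 1 (fun y => itg 0 1 (fun x => F x t y s))))).
  by apply: eq_itg => s _; apply: (itg_swap (F := fun y t => itg 0 1 (fun x => F x t y s))); btac.
transitivity (itg 0 T (fun t => itg 0 T (fun s => itg 0 1 (fun y => itg 0 1 (fun x => F x t y s))))).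
  by apply: (itg_swap (F := fun s t => itg 0 1 (fun y => itg 0 1 (fun x => F x t y s)))); btac.
apply: eq_itg => t _.
transitivity (itg 0 T (fun s => itg 0 1 (fun x => itg 0 1 (fun y => F x t y s)))).
  by apply: eq_itg => s _; apply: (itg_swap (F := fun y x => F x t y s)); btac.
by apply: (itg_swap (F := fun s x => itg 0 1 (fun y => F x t y s))); btac.
Qed.

Lemma itg4_xs (F : R -> R -> R -> R -> R) :
  bm (fun p : R * R * R * R => F p.1.1.1 p.1.1.2 p.1.2 p.2) ->
  itg4 F = itg 0 T (fun t => itg 0 T (fun s => itg 0 1 (fun x => itg 0 1 (fun y => F x t y s)))).
Proof.
move=> bF; apply: eq_itg => t _.
by apply: (itg_swap (F := fun x s => itg 0 1 (fun y => F x t y s))); btac.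
Qed.

Lemma itg4D F G :
  bm (fun p : R * R * R * R => F p.1.1.1 p.1.1.2 p.1.2 p.2) ->
  bm (fun p : R * R * R * R => G p.1.1.1 p.1.1.2 p.1.2 p.2) ->
  itg4 (fun x t y s => F x t y s + G x t y s) = itg4 F + itg4 G.
Proof.
move=> bF bG; rewrite /itg4 -itgD; [|btac|btac].
apply: eq_itg => t _; rewrite -itgD; [|btac|btac].
apply: eq_itg => x _; rewrite -itgD; [|btac|btac].
by apply: eq_itg => s _; rewrite -itgD; [|btac|btac].
Qed.

Lemma itg4Z c F :
  bm (fun p : R * R * R * R => F p.1.1.1 p.1.1.2 p.1.2 p.2) ->
  itg4 (fun x t y s => c * F x t y s) = c * itg4 F.
Proof.
move=> bF; rewrite /itg4 -itgZl; [|btac].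
apply: eq_itg => t _; rewrite -itgZl; [|btac].
apply: eq_itg => x _; rewrite -itgZl; [|btac].
by apply: eq_itg => s _; rewrite -itgZl; [|btac].
Qed.

Lemma itg4_le F G :
  bm (fun p : R * R * R * R => F p.1.1.1 p.1.1.2 p.1.2 p.2) ->
  bm (fun p : R * R * R * R => G p.1.1.1 p.1.1.2 p.1.2 p.2) ->
  (forall x t y s, 0 <= t <= T -> 0 <= s <= T -> F x t y s <= G x t y s) ->
  itg4 F <= itg4 G.
Proof.
move=> bF bG FG; rewrite /itg4.
apply: le_itg => [||t ht]; [btac|btac|].
apply: le_itg => [||x _ /=]; [btac|btac|].
apply: le_itg => [||s hs]; [btac|btac|].
by apply: le_itg => [||y _ /=]; [btac|btac|exact: FG].
Qed.

End FourFold.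

Section ConvolutionDoubling.
Context {R : realType}.

(* Simultaneous translation in [x] and [y] preserves [om (x - y)]. *)
Lemma conv_doubling (w1 w2 om : R -> R) :
  bm w1 -> bm w2 -> bm om -> periodic1 w1 -> periodic1 w2 -> periodic1 om ->
  (forall z, 0 <= om z) ->
  itg 0 1 (fun x => itg 0 1 (fun y => `|convKp w1 x - convKp w2 y| * om (x - y))) <=
  kappa * itg 0 1 (fun x => itg 0 1 (fun y => `|w1 x - w2 y| * om (x - y))).
Proof.
move=> b1 b2 bo p1 p2 po o0; have bK := @bm_Kp R.
pose H x y := `|w1 x - w2 y| * om (x - y).
have bH : bm (fun p : R * R => H p.1 p.2) by rewrite /H; btac.
have k0 : 0 <= @kappa R by apply: le_trans (kappa_ge1).
have pHy x y : H x (y + 1) = H x y.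
  by rewrite /H p2 -[in LHS]po; congr (_ * om _); ring.
have pHx x y : H (x + 1) y = H x y by rewrite /H p1 addrAC po.
have step x y : `|convKp w1 x - convKp w2 y| * om (x - y) <=
    itg 0 1 (fun z => kappa * H (x + z) (y + z)).
  rewrite !conv_shift // -itgB; [|btac|btac].
  apply: (@le_trans _ _ (itg 0 1 (fun z => kappa * `|w1 (x + z) - w2 (y + z)|) * om (x - y))).
    apply: ler_wpM2r => //; apply: (le_trans (le_norm_itg _ _ _)); first by btac.
    apply: le_itg => [||z _ /=]; [btac|btac|].
    by rewrite -mulrBr normrM ler_wpM2r // Kp_bound.
  rewrite -itgZr; last by btac.
  apply: le_itg => [||z _ /=]; [btac|btac|]; rewrite /H -mulrA.
  by rewrite (_ : x + z - (y + z) = x - y) //; ring.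
apply: (@le_trans _ _ (itg 0 1 (fun x => itg 0 1 (fun y => itg 0 1 (fun z => kappa * H (x + z) (y + z)))))).
  apply: le_itg => [||x _ /=]; [btac|btac|].
  by apply: le_itg => [||y _ /=]; [btac|btac|exact: step].
have -> : itg 0 1 (fun x => itg 0 1 (fun y => itg 0 1 (fun z => kappa * H (x + z) (y + z)))) =
   itg 0 1 (fun z => itg 0 1 (fun x => itg 0 1 (fun y => kappa * H (x + z) (y + z)))).
  transitivity (itg 0 1 (fun x => itg 0 1 (fun z => itg 0 1 (fun y => kappa * H (x + z) (y + z))))).
    by apply: eq_itg => x _; apply: (itg_swap (F := fun y z => kappa * H (x + z) (y + z))); btac.
  by apply: (itg_swap (F := fun x z => itg 0 1 (fun y => kappa * H (x + z) (y + z)))); btac.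
rewrite (eq_itg (g := fun z => kappa * itg 0 1 (fun x => itg 0 1 (H x)))); last first.
  move=> z _; rewrite -itgZl; last by btac.
  rewrite -(itg_periodic_shift z (f := fun x => kappa * itg 0 1 (H x))); [|by btac|]; last first.
    by move=> x; congr (_ * _); apply: eq_itg => y _; exact: pHx.
  apply: eq_itg => x _; rewrite itgZl; last by btac.
  by rewrite -[in RHS](itg_periodic_shift z (f := H (x + z))) //; btac.
by rewrite itg_cst ?ler01 // subr0 mulr1.
Qed.

End ConvolutionDoubling.

Section Derivatives.
Context {R : realType}.
Implicit Types (f g : R -> R).

Lemma is_derive_subr (g g' : R -> R) (c x : R) : (forall x : R, is_derive x 1 g (g' x)) ->
  is_derive x 1 (fun x => g (x - c)) (g' (x - c)).
Proof.
move=> dg.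
have d1 : is_derive x 1 (fun y : R => y - c) 1 by apply: is_derive_eq; rewrite subr0.
have := @is_derive1_comp R g (fun y => y - c) x _ _ (dg (x - c)) d1.
by rewrite mulr1.
Qed.

Lemma is_derive_rsubr (g g' : R -> R) (c x : R) : (forall x : R, is_derive x 1 g (g' x)) ->
  is_derive x 1 (fun x => g (c - x)) (- g' (c - x)).
Proof.
move=> dg.
have d1 : is_derive x 1 (fun y : R => c - y) (-1) by apply: is_derive_eq; ring.
have := @is_derive1_comp R g (fun y => c - y) x _ _ (dg (c - x)) d1.
by rewrite mulrN1.
Qed.

Lemma is_derive_mulr (f : R -> R) (f' c x : R) : is_derive x 1 f f' ->
  is_derive x 1 (fun x => f x * c) (f' * c).
Proof.
move=> df; apply: is_derive_eq.
by rewrite /GRing.scale /=; ring.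
Qed.

Lemma is_derive_mull (f : R -> R) (f' c x : R) : is_derive x 1 f f' ->
  is_derive x 1 (fun x => c * f x) (c * f').
Proof.
move=> df; apply: is_derive_eq.
by rewrite /GRing.scale /=; ring.
Qed.

Lemma is_derive_mul (f g : R -> R) (f' g' x : R) : is_derive x 1 f f' -> is_derive x 1 g g' ->
  is_derive x 1 (fun x => f x * g x) (f' * g x + f x * g').
Proof.
move=> df dg; apply: is_derive_eq.
by rewrite /GRing.scale /=; ring.
Qed.

Lemma continuous_mul2 (f g : R * R -> R) : continuous f -> continuous g ->
  continuous (fun p => f p * g p).
Proof. by move=> cf cg p; apply: cvgM; [exact: cf|exact: cg]. Qed.

Lemma continuous_add2 (f g : R * R -> R) : continuous f -> continuous g ->
  continuous (fun p => f p + g p).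
Proof. by move=> cf cg p; apply: cvgD; [exact: cf|exact: cg]. Qed.

Lemma continuous_opp2 (f : R * R -> R) : continuous f -> continuous (fun p => - f p).
Proof. by move=> cf p; apply: cvgN; exact: cf. Qed.

Lemma continuous_fst_subr (g : R -> R) (c : R) : blip g -> continuous (fun p : R * R => g (p.1 - c)).
Proof.
move=> bg p; apply: continuous_comp; last exact: blip_continuous.
by apply: cvgB; [exact: cvg_fst|exact: cvg_cst].
Qed.

Lemma continuous_snd_subr (g : R -> R) (c : R) : blip g -> continuous (fun p : R * R => g (p.2 - c)).
Proof.
move=> bg p; apply: continuous_comp; last exact: blip_continuous.
by apply: cvgB; [exact: cvg_snd|exact: cvg_cst].
Qed.

Lemma continuous_fst_rsubr (g : R -> R) (c : R) : blip g -> continuous (fun p : R * R => g (c - p.1)).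
Proof.
move=> bg p; apply: continuous_comp; last exact: blip_continuous.
by apply: cvgB; [exact: cvg_cst|exact: cvg_fst].
Qed.

Lemma continuous_snd_rsubr (g : R -> R) (c : R) : blip g -> continuous (fun p : R * R => g (c - p.2)).
Proof.
move=> bg p; apply: continuous_comp; last exact: blip_continuous.
by apply: cvgB; [exact: cvg_cst|exact: cvg_snd].
Qed.

Lemma continuous_snd_comp (g : R -> R) : blip g -> continuous (fun p : R * R => g p.2).
Proof.
by move=> bg p; apply: continuous_comp; [exact: cvg_snd|exact: blip_continuous].
Qed.

End Derivatives.

(** * Test functions for the doubling *)

Section Cutoffs.
Context {R : realType}.
Implicit Types (T h : R).

Definition space_mollifier (om om' : R -> R) : Prop :=
  [/\ periodic1 om, forall z, 0 <= om z,
      forall z : R, is_derive z 1 om (om' z), blip om & blip om'].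

Definition time_mollifier h (de de' : R -> R) : Prop :=
  [/\ forall t, 0 <= de t, forall t, (t <= 0) || (h <= t) -> de t = 0,
      forall t : R, is_derive t 1 de (de' t), blip de & blip de'].

(** The last clause ties [ch] to the time mollifier: the term with [ch'] in the entropy inequality
    then dominates the trace integral weighted by [de] near t = 0. *)
Definition initial_cutoff h (ch ch' de : R -> R) : Prop :=
  [/\ [/\ forall t, 0 <= ch t <= 1, ch 0 = 1 & forall t, h <= `|t| -> ch t = 0],
      forall t : R, is_derive t 1 ch (ch' t), blip ch, blip ch' &
      forall t, 0 <= t -> de t <= - ch' t].

(** In the rate [kappa + 1] the part [kappa] absorbs the nonlocal term and the remaining 1 leaves
    the distance of the two solutions with coefficient 1. *)
Definition decaying_weight (ps ps' : R -> R) : Prop :=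
  [/\ forall t, 0 < ps t <= 1, forall t : R, is_derive t 1 ps (ps' t), blip ps, blip ps' &
      forall t, 0 <= t -> ps' t <= - (kappa + 1) * ps t].

Section Tests.
Context {T h : R} {om om' de de' ch ch' ps ps' : R -> R}.
Hypothesis T0 : 0 < T.
Hypothesis mom : space_mollifier om om'.
Hypothesis mde : time_mollifier h de de'.
Hypothesis mch : initial_cutoff h ch ch' de.
Hypothesis mps : decaying_weight ps ps'.

(** The weight depends on [t] alone. Hence [Phix + Phiy] vanishes and [Phit + Phis] retains only the
    term with [ps']: all derivatives of the mollifiers cancel. *)
Definition Phi (x t y s : R) := om (x - y) * (ps t * de (t - s)).
Definition Phix (x t y s : R) := om' (x - y) * (ps t * de (t - s)).
Definition Phit (x t y s : R) := om (x - y) * (ps' t * de (t - s) + ps t * de' (t - s)).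
Definition Phiy (x t y s : R) := - om' (x - y) * (ps t * de (t - s)).
Definition Phis (x t y s : R) := om (x - y) * (ps t * - de' (t - s)).

Lemma Phi_ge0 x t y s : 0 <= Phi x t y s.
Proof.
case: mom mde mps => _ o0 _ _ _ [d0 _ _ _ _] [p0 _ _ _ _].
by rewrite /Phi !mulr_ge0 //; have /andP[/ltW] := p0 t.
Qed.

Lemma test_fun_xt y s : test_fun (fun x t => Phi x t y s) (fun x t => Phix x t y s)
  (fun x t => Phit x t y s).
Proof.
case: mom mde mps => om1 o0 dom bo bo' [d0 ds dd bd bd'] [p0 dp bp bp' _].
split; first by move=> x t; exact: Phi_ge0.
split; first by move=> t x; rewrite /Phi addrAC om1.
split.
  apply: continuous_mul2; first exact: continuous_fst_subr.
  by apply: continuous_mul2; [exact: continuous_snd_comp|exact: continuous_snd_subr].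
split.
  apply: continuous_mul2; first exact: continuous_fst_subr.
  by apply: continuous_mul2; [exact: continuous_snd_comp|exact: continuous_snd_subr].
split.
  apply: continuous_mul2; first exact: continuous_fst_subr.
  by apply: continuous_add2; apply: continuous_mul2;
    [exact: continuous_snd_comp|exact: continuous_snd_subr
    |exact: continuous_snd_comp|exact: continuous_snd_subr].
split; first by move=> x t; apply: is_derive_mulr; exact: is_derive_subr.
split.
  by move=> x t; apply: is_derive_mull; apply: is_derive_mul; exact: is_derive_subr.
exists (`|s| + `|h|) => x t ht; rewrite /Phi ds ?mulr0 //.
apply/orP; case: (lerP (t - s) 0) => ts; [by left|right].
have := ler_norm h; have := ler_norm (- s); have := ler_norm s; rewrite normrN.
by have [t0|t0] := leP 0 t; [rewrite (ger0_norm t0) in ht|rewrite (ltr0_norm t0) in ht];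
  have := normr_ge0 h; lra.
Qed.

Lemma test_fun_ys x t : test_fun (fun y s => Phi x t y s) (fun y s => Phiy x t y s)
  (fun y s => Phis x t y s).
Proof.
case: mom mde mps => om1 o0 dom bo bo' [d0 ds dd bd bd'] [p0 dp bp bp' _].
have pc : continuous (fun _ : R * R => ps t) by move=> p; exact: cvg_cst.
split; first by move=> y s; exact: Phi_ge0.
split.
  move=> s y; rewrite /Phi -[in LHS]om1; congr (om _ * _); ring.
split.
  apply: continuous_mul2; first exact: continuous_fst_rsubr.
  by apply: continuous_mul2; [exact: pc|exact: continuous_snd_rsubr].
split.
  apply: continuous_mul2; first by apply: continuous_opp2; exact: continuous_fst_rsubr.
  by apply: continuous_mul2; [exact: pc|exact: continuous_snd_rsubr].
split.
  apply: continuous_mul2; first exact: continuous_fst_rsubr.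
  by apply: continuous_mul2; [exact: pc|apply: continuous_opp2; exact: continuous_snd_rsubr].
split; first by move=> y s; apply: is_derive_mulr; exact: is_derive_rsubr.
split.
  by move=> y s; apply: is_derive_mull; apply: is_derive_mull; exact: is_derive_rsubr.
exists (`|t| + `|h|) => y s hs; rewrite /Phi ds ?mulr0 //.
apply/orP; case: (lerP (t - s) 0) => ts; [by left|right].
have := ler_norm h; have := ler_norm (- t); have := ler_norm t; rewrite normrN.
by have [t0|t0] := leP 0 s; [rewrite (ger0_norm t0) in hs|rewrite (ltr0_norm t0) in hs];
  have := normr_ge0 h; lra.
Qed.

Lemma test_fun_initial y : test_fun (fun x t => om (x - y) * ch t) (fun x t => om' (x - y) * ch t)
  (fun x t => om (x - y) * ch' t).
Proof.
case: mom mch => om1 o0 dom bo bo' [[c01 c0 cs] dc bc bc' _].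
split; first by move=> x t; rewrite mulr_ge0 //; have /andP[] := c01 t.
split; first by move=> t x; rewrite addrAC om1.
split; first by apply: continuous_mul2; [exact: continuous_fst_subr|exact: continuous_snd_comp].
split; first by apply: continuous_mul2; [exact: continuous_fst_subr|exact: continuous_snd_comp].
split; first by apply: continuous_mul2; [exact: continuous_fst_subr|exact: continuous_snd_comp].
split; first by move=> x t; apply: is_derive_mulr; exact: is_derive_subr.
split; first by move=> x t; apply: is_derive_mull; exact: dc.
by exists h => x t ht; rewrite cs ?mulr0 //; exact: ltW.
Qed.

Lemma blip_ulip_time (I : Type) (P : I -> Prop) (g : R -> R) : blip g -> ulip P T (fun _ _ t => g t).
Proof.
move=> bg; have := ulip_time P T (fun _ : I => 0) bg.
by under [X in ulip P T X -> _]eq_fun => i do under eq_fun => x do under eq_fun => t do rewrite subr0.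
Qed.

(** One constant serves all frozen points, because freezing a point only translates or reflects the
    fixed profiles [om] and [de], or replaces [ps] by a number in (0, 1]. *)
Lemma cutoffs_regular : exists L, [/\
  forall y s, regular T L (fun x t => Phi x t y s) (fun x t => Phix x t y s) (fun x t => Phit x t y s),
  forall x t, regular T L (fun y s => Phi x t y s) (fun y s => Phiy x t y s) (fun y s => Phis x t y s) &
  forall y, regular T L (fun x t => om (x - y) * ch t) (fun x t => om' (x - y) * ch t) (fun x t => om (x - y) * ch' t)].
Proof.
case: mom mde mps mch => om1 o0 dom bo bo' [d0 ds dd bd bd'] [p0 dp bp bp' _] [_ dc bc bc' _].
pose P (i : R * R) := True.
have [L1 h1] : exists L, forall i, P i -> regular T L (fun x t => Phi x t i.1 i.2) (fun x t => Phix x t i.1 i.2)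
    (fun x t => Phit x t i.1 i.2).
  apply: ulip_regular.
  - apply: ulipM; first exact: (ulip_space _ _ (fun i => i.1)).
    by apply: ulipM; [exact: blip_ulip_time|exact: (ulip_time _ _ (fun i => i.2))].
  - apply: ulipM; first exact: (ulip_space _ _ (fun i => i.1)).
    by apply: ulipM; [exact: blip_ulip_time|exact: (ulip_time _ _ (fun i => i.2))].
  - apply: ulipM; first exact: (ulip_space _ _ (fun i => i.1)).
    by apply: ulipD; apply: ulipM; [exact: blip_ulip_time|exact: (ulip_time _ _ (fun i => i.2))
       |exact: blip_ulip_time|exact: (ulip_time _ _ (fun i => i.2))].
have psc : ulip P T (fun (i : R * R) (x t : R) => ps i.2).
  apply: (@ulip_cst _ _ _ _ (fun i => ps i.2) 1) => i _.
  by have /andP[/ltW ? ?] := p0 i.2; rewrite ger0_norm.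
have [L2 h2] : exists L, forall i, P i -> regular T L (fun y s => Phi i.1 i.2 y s) (fun y s => Phiy i.1 i.2 y s)
    (fun y s => Phis i.1 i.2 y s).
  apply: ulip_regular.
  - apply: ulipM; first exact: (ulip_space_sub _ _ (fun i => i.1)).
    by apply: ulipM; [exact: psc|exact: (ulip_time_sub _ _ (fun i => i.2))].
  - apply: ulipM; first by apply: ulipN; exact: (ulip_space_sub _ _ (fun i => i.1)).
    by apply: ulipM; [exact: psc|exact: (ulip_time_sub _ _ (fun i => i.2))].
  - apply: ulipM; first exact: (ulip_space_sub _ _ (fun i => i.1)).
    by apply: ulipM; [exact: psc|apply: ulipN; exact: (ulip_time_sub _ _ (fun i => i.2))].
have [L3 h3] : exists L, forall y : R, True -> regular T L (fun x t => om (x - y) * ch t)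
    (fun x t => om' (x - y) * ch t) (fun x t => om (x - y) * ch' t).
  by apply: ulip_regular; apply: ulipM; [exact: (ulip_space _ _ id)|exact: blip_ulip_time
   |exact: (ulip_space _ _ id)|exact: blip_ulip_time
   |exact: (ulip_space _ _ id)|exact: blip_ulip_time].
have mono L L' phi phix phit : L <= L' -> regular T L phi phix phit -> regular T L' phi phix phit.
  move=> LL hr x t x' t' ht ht'; have [a1 a2 a3 a4 a5] := hr x t x' t' ht ht'.
  have d0' : 0 <= `|x - x'| + `|t - t'| by exact: addr_ge0.
  split; [lra|lra|lra| |].
  - by apply: (le_trans a4); rewrite ler_wpM2r.
  - by apply: (le_trans a5); rewrite ler_wpM2r.
exists (Num.max L1 (Num.max L2 L3)); split.
- by move=> y s; apply: mono (h1 (y, s) I); rewrite le_max lexx.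
- by move=> x t; apply: mono (h2 (x, t) I); rewrite !le_max lexx orbT.
- by move=> y; apply: mono (h3 y I); rewrite !le_max lexx !orbT.
Qed.

End Tests.
End Cutoffs.

Arguments Phi {R} om de ps x t y s.
Arguments Phix {R} om' de ps x t y s.
Arguments Phit {R} om de de' ps ps' x t y s.
Arguments Phiy {R} om' de ps x t y s.
Arguments Phis {R} om de' ps x t y s.

Lemma itg2_addr_cst {R : realType} (b : R) (A : R -> R -> R) (c : R) : 0 <= b ->
  bm (fun p : R * R => A p.1 p.2) ->
  itg 0 b (fun t => itg 0 1 (fun x => A x t + c)) = itg 0 b (fun t => itg 0 1 (fun x => A x t)) + b * c.
Proof.
move=> b0 bA; rewrite -[X in _ + X * _]subr0 mulrC -(itg_cst _ b0) -itgD; [|btac|btac].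
apply: eq_itg => t _; rewrite itgD; [|btac|btac].
by rewrite itg_cst ?ler01 // subr0 mulr1.
Qed.

Lemma entropy_integrandE {R : realType} (u : R -> R -> R) lam phi phix phit x t :
  bm (fun p : R * R => u p.1 p.2) ->
  entropy_integrand u lam phi phix phit x t =
  `|u x t - lam| * phit x t + eflux (u x t) lam * phix x t
   - Num.sg (u x t - lam) * convKp (u ^~ t) x * phi x t.
Proof.
move=> bu; rewrite /entropy_integrand conv_subr_cst //.
by btac.
Qed.

Section Doubling.
Context {R : realType} {T h M : R} {om om' de de' ch ch' ps ps' : R -> R}.
Hypothesis T0 : 0 < T.
Hypothesis hT : 0 < h <= T.
Hypothesis mom : space_mollifier om om'.
Hypothesis mde : time_mollifier h de de'.
Hypothesis mch : initial_cutoff h ch ch' de.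
Hypothesis mps : decaying_weight ps ps'.
Context {u0 : R -> R}.
Hypothesis bu0 : bm u0.
Hypothesis u0M : forall x, `|u0 x| <= M.

Let M0 : 0 <= M. Proof. exact: le_trans (u0M 0). Qed.
Let bom : bm om. Proof. by case: mom => _ _ _ /blip_bm. Qed.
Let bom' : bm om'. Proof. by case: mom => _ _ _ _ /blip_bm. Qed.
Let bde : bm de. Proof. by case: mde => _ _ _ /blip_bm. Qed.
Let bde' : bm de'. Proof. by case: mde => _ _ _ _ /blip_bm. Qed.
Let bch : bm ch. Proof. by case: mch => _ _ /blip_bm. Qed.
Let bch' : bm ch'. Proof. by case: mch => _ _ _ /blip_bm. Qed.
Let bps : bm ps. Proof. by case: mps => _ _ /blip_bm. Qed.
Let bps' : bm ps'. Proof. by case: mps => _ _ _ /blip_bm. Qed.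
Let bK : bm (@Kp R). Proof. exact: bm_Kp. Qed.

(** The inequality is tested at level [u0 y]. Since [ps t * de t <= de t <= - ch' t], its
    time-derivative term controls the left-hand side; flux and source are bounded by a constant
    times [ch t], whose integral is at most [h]. *)
Lemma initial_layer (u : R -> R -> R) (rho L Lo : R) :
  approx_entropy_solution T M rho u0 u ->
  (forall y, regular T L (fun x t => om (x - y) * ch t)
     (fun x t => om' (x - y) * ch t) (fun x t => om (x - y) * ch' t)) ->
  (forall z, `|om z| <= Lo /\ `|om' z| <= Lo) ->
  itg 0 T (fun t => itg 0 1 (fun x => itg 0 1 (fun y => `|u0 y - u x t| * (om (x - y) * (ps t * de t))))) <=
  itg 0 1 (fun y => itg 0 1 (fun x => `|u0 x - u0 y| * om (x - y)))
   + (M * (2 * M) + kappa * M) * Lo * h + rho * L.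
Proof.
move=> [bu uM pu hu] reg hLo.
have [pom o0 dom bo bo'] := mom.
have [[c01 c0 cs] dc bc bc' dech] := mch.
have [p0 dp bp bp' _] := mps.
have [d0 ds dd bd bd'] := mde.
have kap1 := @kappa_ge1 R; have M0_ := M0.
have Lo0 : 0 <= Lo by have [a _] := hLo 0; exact: le_trans a.
pose C := (M * (2 * M) + kappa * M) * Lo.
have C0 : 0 <= C by rewrite /C mulr_ge0 // addr_ge0 // mulr_ge0 //; lra.
have hh : itg 0 T ch <= h.
  have /andP[h0 hT'] := hT.
  rewrite (@itg_split _ 0 h T) //; last exact: ltW.
  have -> : itg h T ch = itg h T (fun _ => 0).
    by apply: eq_itg => t /andP[ht _]; rewrite cs // (le_trans ht) // ler_norm.
  rewrite itg_cst // mul0r addr0.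
  apply: (@le_trans _ _ (itg 0 h (fun _ => 1))); last by rewrite (itg_cst _ (ltW h0)) mul1r subr0.
  by apply: le_itg => [||t _]; [btac|btac|]; have /andP[] := c01 t.
have tst y : 0 <= itg 0 T (fun t => itg 0 1 (fun x => C * ch t - `|u0 y - u x t| * (om (x - y) * (ps t * de t))))
   + itg 0 1 (fun x => `|u0 x - u0 y| * om (x - y)) + rho * L.
  have := hu (u0 y) L _ _ _ (u0M y) (test_fun_initial mom mch y) (reg y).
  move/le_trans; apply; rewrite lerD2r; apply: lerD; last first.
    by rewrite c0; under eq_itg do rewrite mulr1.
  apply: le_itg => [||t /andP[t0 tT] /=].
  - rewrite /entropy_integrand; btac.
  - btac.
  apply: le_itg => [||x _ /=].
  - rewrite /entropy_integrand; btac.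
  - btac.
  rewrite entropy_integrandE //=.
  have bt : bm (u ^~ t) by btac.
  have hG : `|convKp (u ^~ t) x| <= kappa * M by apply: conv_bound.
  have hq := eflux_bound (uM x t) (u0M y).
  have h2M : `|u x t - u0 y| <= 2 * M.
    by apply: (le_trans (ler_normB _ _)); have := uM x t; have := u0M y; lra.
  have /andP[ct0 ct1] := c01 t.
  have /andP[/ltW pt0 pt1] := p0 t.
  have [ho ho'] := hLo (x - y).
  have hox := o0 (x - y).
  have t1 : eflux (u x t) (u0 y) * (om' (x - y) * ch t) <= M * (2 * M) * Lo * ch t.
    apply: (le_trans (ler_norm _)); rewrite mulrA normrM (ger0_norm ct0) ler_wpM2r //.
    rewrite normrM; apply: ler_pM => //; apply: (le_trans hq); exact: ler_wpM2l.
  have t2 : - (Num.sg (u x t - u0 y) * convKp (u ^~ t) x * (om (x - y) * ch t)) <= kappa * M * Lo * ch t.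
    apply: (le_trans (ler_norm _)); rewrite normrN mulrA normrM (ger0_norm ct0) ler_wpM2r //.
    rewrite normrM; apply: ler_pM => //.
    rewrite normrM -[leRHS]mul1r; apply: ler_pM => //.
    by rewrite normr_sg; case: (_ != _).
  have t3 : `|u x t - u0 y| * (om (x - y) * ch' t) <= - (`|u0 y - u x t| * (om (x - y) * (ps t * de t))).
    rewrite (distrC (u0 y)) -mulrN ler_wpM2l // -mulrN ler_wpM2l //.
    have := dech t t0; have := d0 t => h1 h2.
    have : ps t * de t <= de t by rewrite ler_piMl.
    lra.
  rewrite /C; lra.
have I1 : 0 <= itg 0 1 (fun y => itg 0 T (fun t => itg 0 1 (fun x => C * ch t - `|u0 y - u x t| * (om (x - y) * (ps t * de t))))
   + (itg 0 1 (fun x => `|u0 x - u0 y| * om (x - y)) + rho * L)).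
  by apply: itg_ge0 => y _; rewrite addrA.
rewrite itgD in I1; [|btac|btac].
rewrite [X in _ + X]itgD in I1; [|btac|btac].
rewrite itg_cst ?ler01 // subr0 mulr1 in I1.
have I2 : itg 0 1 (fun y => itg 0 T (fun t => itg 0 1 (fun x => C * ch t - `|u0 y - u x t| * (om (x - y) * (ps t * de t))))) =
   C * itg 0 T ch - itg 0 T (fun t => itg 0 1 (fun x => itg 0 1 (fun y => `|u0 y - u x t| * (om (x - y) * (ps t * de t))))).
  transitivity (itg 0 T (fun t => itg 0 1 (fun x => itg 0 1 (fun y => C * ch t - `|u0 y - u x t| * (om (x - y) * (ps t * de t)))))).
    transitivity (itg 0 T (fun t => itg 0 1 (fun y => itg 0 1 (fun x => C * ch t - `|u0 y - u x t| * (om (x - y) * (ps t * de t)))))).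
      by apply: (itg_swap (F := fun y t => itg 0 1 (fun x => C * ch t - `|u0 y - u x t| * (om (x - y) * (ps t * de t))))); btac.
    apply: eq_itg => t _.
    by apply: (itg_swap (F := fun y x => C * ch t - `|u0 y - u x t| * (om (x - y) * (ps t * de t)))); btac.
  rewrite -itgZl // -itgB; [|btac|btac].
  apply: eq_itg => t _.
  transitivity (itg 0 1 (fun x => C * ch t - itg 0 1 (fun y => `|u0 y - u x t| * (om (x - y) * (ps t * de t))))).
    apply: eq_itg => x _; rewrite itgB; [|btac|btac].
    by rewrite itg_cst ?ler01 // subr0 mulr1.
  rewrite itgB; [|btac|btac].
  by rewrite itg_cst ?ler01 // subr0 mulr1.
move: I1; rewrite I2 addrAC subr_ge0 => I1; apply: (le_trans I1).
by rewrite addrA lerD2r addrC lerD2l ler_wpM2l.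
Qed.

End Doubling.

Section DoublingEstimate.
Context {R : realType} {T h M : R} {om om' de de' ch ch' ps ps' : R -> R}.
Hypothesis T0 : 0 < T.
Hypothesis hT : 0 < h <= T.
Hypothesis mom : space_mollifier om om'.
Hypothesis mde : time_mollifier h de de'.
Hypothesis mch : initial_cutoff h ch ch' de.
Hypothesis mps : decaying_weight ps ps'.
Context {u0 : R -> R}.
Hypothesis bu0 : bm u0.
Hypothesis u0M : forall x, `|u0 x| <= M.

Let M0 : 0 <= M. Proof. exact: le_trans (u0M 0). Qed.
Let bom : bm om. Proof. by case: mom => _ _ _ /blip_bm. Qed.
Let bom' : bm om'. Proof. by case: mom => _ _ _ _ /blip_bm. Qed.
Let bde : bm de. Proof. by case: mde => _ _ _ /blip_bm. Qed.
Let bde' : bm de'. Proof. by case: mde => _ _ _ _ /blip_bm. Qed.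
Let bch : bm ch. Proof. by case: mch => _ _ /blip_bm. Qed.
Let bch' : bm ch'. Proof. by case: mch => _ _ _ /blip_bm. Qed.
Let bps : bm ps. Proof. by case: mps => _ _ /blip_bm. Qed.
Let bps' : bm ps'. Proof. by case: mps => _ _ _ /blip_bm. Qed.
Let bK : bm (@Kp R). Proof. exact: bm_Kp. Qed.

Section TwoSolutions.
Context {u v : R -> R -> R} {rhou rhov L Lo : R}.
Hypothesis au : approx_entropy_solution T M rhou u0 u.
Hypothesis av : approx_entropy_solution T M rhov u0 v.
Hypothesis reg1 : forall y s, regular T L (fun x t => Phi om de ps x t y s)
  (fun x t => Phix om' de ps x t y s) (fun x t => Phit om de de' ps ps' x t y s).
Hypothesis reg2 : forall x t, regular T L (fun y s => Phi om de ps x t y s)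
  (fun y s => Phiy om' de ps x t y s) (fun y s => Phis om de' ps x t y s).
Hypothesis reg3 : forall y, regular T L (fun x t => om (x - y) * ch t)
  (fun x t => om' (x - y) * ch t) (fun x t => om (x - y) * ch' t).
Hypothesis hLo : forall z, `|om z| <= Lo /\ `|om' z| <= Lo.

Let Fu x t y s := `|u x t - v y s| * Phit om de de' ps ps' x t y s
  + eflux (u x t) (v y s) * Phix om' de ps x t y s
  - Num.sg (u x t - v y s) * convKp (u ^~ t) x * Phi om de ps x t y s.
Let Fv x t y s := `|v y s - u x t| * Phis om de' ps x t y s
  + eflux (v y s) (u x t) * Phiy om' de ps x t y s
  - Num.sg (v y s - u x t) * convKp (v ^~ s) y * Phi om de ps x t y s.

Let bu : bm (fun p : R * R => u p.1 p.2). Proof. by case: au. Qed.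
Let bv : bm (fun p : R * R => v p.1 p.2). Proof. by case: av. Qed.

Let bPhi : bm (fun p : R * R * R * R => Phi om de ps p.1.1.1 p.1.1.2 p.1.2 p.2).
Proof. by rewrite /Phi; btac. Qed.

Let bFu : bm (fun p : R * R * R * R => Fu p.1.1.1 p.1.1.2 p.1.2 p.2).
Proof. by rewrite /Fu /Phit /Phix /Phi; btac. Qed.

Let bFv : bm (fun p : R * R * R * R => Fv p.1.1.1 p.1.1.2 p.1.2 p.2).
Proof. by rewrite /Fv /Phis /Phiy /Phi; btac. Qed.

Let entropy_u : 0 <= itg4 T Fu + T * (rhou * L).
Proof.
have [_ uM pu hu] := au; have [_ vM pv _] := av.
rewrite -(itg4_swap T bFu) -itg2_addr_cst; [|exact: ltW|btac].
apply: itg_ge0 => s /andP[s0 sT]; apply: itg_ge0 => y _.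
have := hu (v y s) L _ _ _ (vM y s) (test_fun_xt mom mde mps y s) (reg1 y s).
(* At t = 0 the argument -s of [de] is nonpositive, so the test function has no initial trace. *)
have -> : itg 0 1 (fun x => `|u0 x - v y s| * Phi om de ps x 0 y s) = 0.
  have [_ ds _ _ _] := mde.
  transitivity (itg 0 1 (fun _ : R => 0 : R)).
    by apply: eq_itg => x _; rewrite /Phi sub0r ds ?oppr_le0 ?s0 // !mulr0.
  by rewrite itg_cst ?ler01 // mul0r.
have -> : entropy_form T u (v y s) (fun x t => Phi om de ps x t y s)
  (fun x t => Phix om' de ps x t y s) (fun x t => Phit om de de' ps ps' x t y s) =
  itg 0 T (fun t => itg 0 1 (fun x => Fu x t y s)).
  apply: eq_itg => t _; apply: eq_itg => x _.
  by rewrite entropy_integrandE.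
by move: (itg 0 T _) => e; rewrite (addr0 e).
Qed.

Let entropy_v : 0 <= itg4 T Fv + itg 0 T (fun t => itg 0 1 (fun x => itg 0 1 (fun y =>
   `|u0 y - u x t| * (om (x - y) * (ps t * de t))))) + T * (rhov * L).
Proof.
have [_ uM pu _] := au; have [_ vM pv hv] := av.
have -> : itg4 T Fv + itg 0 T (fun t => itg 0 1 (fun x => itg 0 1 (fun y =>
   `|u0 y - u x t| * (om (x - y) * (ps t * de t))))) =
   itg 0 T (fun t => itg 0 1 (fun x => itg 0 T (fun s => itg 0 1 (fun y => Fv x t y s))
     + itg 0 1 (fun y => `|u0 y - u x t| * (om (x - y) * (ps t * de t))))).
  rewrite /itg4 -itgD; [|btac|btac].
  by apply: eq_itg => t _; rewrite -itgD; [|btac|btac].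
rewrite -itg2_addr_cst; [|exact: ltW|btac].
apply: itg_ge0 => t /andP[t0 tT]; apply: itg_ge0 => x _.
have := hv (u x t) L _ _ _ (uM x t) (test_fun_ys mom mde mps x t) (reg2 x t).
have -> : entropy_form T v (u x t) (fun y s => Phi om de ps x t y s)
  (fun y s => Phiy om' de ps x t y s) (fun y s => Phis om de' ps x t y s) =
  itg 0 T (fun s => itg 0 1 (fun y => Fv x t y s)).
  apply: eq_itg => s _; apply: eq_itg => y _.
  by rewrite entropy_integrandE.
suff -> : itg 0 1 (fun y => `|u0 y - u x t| * Phi om de ps x t y 0) =
  itg 0 1 (fun y => `|u0 y - u x t| * (om (x - y) * (ps t * de t))) by [].
by apply: eq_itg => y _; rewrite /Phi subr0.
Qed.

(** Symmetry of [eflux] and [Phiy = - Phix] remove the fluxes, antisymmetry of the sign merges the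
    two sources into the difference of the convolutions, and of the time derivatives only [ps']
    remains. *)
Let sum_le x t y s : 0 <= t <= T ->
  Fu x t y s + Fv x t y s <= - (kappa + 1) * (`|u x t - v y s| * Phi om de ps x t y s)
    + `|convKp (u ^~ t) x - convKp (v ^~ s) y| * Phi om de ps x t y s.
Proof.
move=> /andP[t0 _].
have [_ _ _ _ dps] := mps; have [_ o0 _ _ _] := mom; have [d0 _ _ _ _] := mde.
have P0 := Phi_ge0 mom mde mps x t y s.
have -> : Fu x t y s + Fv x t y s =
  `|u x t - v y s| * (om (x - y) * (ps' t * de (t - s)))
  - Num.sg (u x t - v y s) * (convKp (u ^~ t) x - convKp (v ^~ s) y) * Phi om de ps x t y s.
  rewrite /Fu /Fv (efluxC (v y s)) (distrC (v y s)) -(opprB (u x t) (v y s)) sgrN.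
  by rewrite /Phit /Phix /Phiy /Phis /Phi; ring.
apply: lerD.
  rewrite [leRHS]mulrCA ler_wpM2l // /Phi [leRHS]mulrCA ler_wpM2l //.
  by rewrite mulrA ler_wpM2r // dps.
apply: (le_trans (ler_norm _)); rewrite normrN normrM (ger0_norm P0) ler_wpM2r //.
rewrite normrM -[leRHS]mul1r ler_wpM2r // normr_sg.
by case: (_ != _).
Qed.

Lemma doubling_estimate :
  itg4 T (fun x t y s => `|u x t - v y s| * Phi om de ps x t y s) <=
  itg 0 1 (fun y => itg 0 1 (fun x => `|u0 x - u0 y| * om (x - y)))
   + (M * (2 * M) + kappa * M) * Lo * h + rhou * L + T * (rhou * L) + T * (rhov * L).
Proof.
have [_ uM pu _] := au; have [_ vM pv _] := av.
have [pom o0 _ _ _] := mom; have [d0 _ _ _ _] := mde.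
have [p0 _ _ _ _] := mps.
pose W x t y s := `|u x t - v y s| * Phi om de ps x t y s.
pose V x t y s := `|convKp (u ^~ t) x - convKp (v ^~ s) y| * Phi om de ps x t y s.
have bW : bm (fun p : R * R * R * R => W p.1.1.1 p.1.1.2 p.1.2 p.2) by rewrite /W; btac.
have bV : bm (fun p : R * R * R * R => V p.1.1.1 p.1.1.2 p.1.2 p.2) by rewrite /V; btac.
have VW : itg4 T V <= kappa * itg4 T W.
  rewrite !itg4_xs // -itgZl; [|btac].
  apply: le_itg => [||t _]; [btac|btac|].
  rewrite -itgZl; [|btac].
  apply: le_itg => [||s _]; [btac|btac|].
  have bt : bm (u ^~ t) by btac.
  have bs : bm (v ^~ s) by btac.
  have c0 : 0 <= ps t * de (t - s) by rewrite mulr_ge0 //; have /andP[/ltW] := p0 t.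
  have pull (A : R -> R -> R) : bm (fun p : R * R => A p.1 p.2) ->
      itg 0 1 (fun x => itg 0 1 (fun y => A x y * Phi om de ps x t y s)) =
      itg 0 1 (fun x => itg 0 1 (fun y => A x y * om (x - y))) * (ps t * de (t - s)).
    move=> bA; rewrite -itgZr; [|btac].
    apply: eq_itg => x _; rewrite -itgZr; [|btac].
    by apply: eq_itg => y _; rewrite -mulrA.
  rewrite /V /W (pull (fun x y => `|convKp (u ^~ t) x - convKp (v ^~ s) y|)); [|btac].
  rewrite (pull (fun x y => `|u x t - v y s|)); [|btac].
  rewrite [leRHS]mulrA; apply: ler_wpM2r => //.
  exact: conv_doubling.
have S : itg4 T Fu + itg4 T Fv <= - itg4 T W.
  rewrite -itg4D //.
  apply: (@le_trans _ _ (itg4 T (fun x t y s => - (kappa + 1) * W x t y s + V x t y s))).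
    apply: itg4_le => [||x t y s ht _]; [btac|btac|exact: sum_le].
  rewrite itg4D; [|btac|btac].
  rewrite itg4Z // opprD mulrDl mulN1r.
  by rewrite addrAC -[leRHS]add0r lerD2r mulNr addrC subr_le0.
have e1 := entropy_u; have e2 := entropy_v.
have e3 := initial_layer hT mom mde mch mps bu0 u0M au reg3 hLo.
move: S e1 e2 e3; rewrite -/W {VW}.
move: (itg4 T W) (itg4 T Fu) (itg4 T Fv) (itg 0 T _) (itg 0 1 _) => w fu fv i0 om0.
move: (_ * Lo * h) (rhou * L) (T * _) (T * _) => *; lra.
Qed.

End TwoSolutions.
End DoublingEstimate.

(** * Mollifiers and cutoffs *)

Section BlipAlgebra.
Context {R : realType}.
Implicit Types (f g : R -> R).

Lemma blip_cst (c : R) : blip (fun _ => c).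
Proof. by exists `|c| => // x y; split => //; rewrite subrr normr0 mulr_ge0. Qed.

Lemma blipD f g : blip f -> blip g -> blip (fun x => f x + g x).
Proof.
move=> [L L0 hL] [N N0 hN]; exists (L + N); first exact: addr_ge0.
move=> x y; have [a1 a2] := hL x y; have [b1 b2] := hN x y.
split; first by apply: (le_trans (ler_normD _ _)); exact: lerD.
rewrite opprD addrACA mulrDl; apply: (le_trans (ler_normD _ _)); exact: lerD.
Qed.

Lemma blipM f g : blip f -> blip g -> blip (fun x => f x * g x).
Proof.
move=> [L L0 hL] [N N0 hN]; exists (L * N + L * N); first by rewrite addr_ge0 // mulr_ge0.
move=> x y; have [a1 a2] := hL x y; have [b1 b2] := hN x y; have [b3 _] := hN y x.
split.
  rewrite normrM; apply: (@le_trans _ _ (L * N)); first exact: ler_pM.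
  by rewrite lerDl mulr_ge0.
have -> : f x * g x - f y * g y = f x * (g x - g y) + (f x - f y) * g y by ring.
apply: (le_trans (ler_normD _ _)); rewrite !normrM mulrDl; apply: lerD.
  by rewrite -mulrA; exact: ler_pM.
by rewrite mulrAC; exact: ler_pM.
Qed.

Lemma blipN f : blip f -> blip (fun x => - f x).
Proof.
move=> [L L0 hL]; exists L => // x y; have [a1 a2] := hL x y.
by rewrite normrN -opprD normrN.
Qed.

Lemma blip_affine f a b : blip f -> blip (fun x => f (a * x + b)).
Proof.
move=> [L L0 hL]; exists (L * (1 + `|a|)); first by rewrite mulr_ge0 // addr_ge0.
move=> x y; have [a1 a2] := hL (a * x + b) (a * y + b).
split; first by apply: (le_trans a1); rewrite ler_peMr // lerDl.
apply: (le_trans a2); rewrite opprD addrACA subrr addr0 -mulrBr normrM mulrA.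
by rewrite ler_wpM2r // ler_wpM2l // lerDr.
Qed.

Lemma blip_contraction f (h : R -> R) : h 0 = 0 -> (forall x y, `|h x - h y| <= `|x - y|) ->
  blip f -> blip (fun x => h (f x)).
Proof.
move=> h0 hl [L L0 hL]; exists L => // x y; have [a1 a2] := hL x y; split.
  by have := hl (f x) 0; rewrite h0 !subr0 => /le_trans; apply.
exact: le_trans (hl _ _) a2.
Qed.

Lemma blip_clamp1 : blip (@clamp R 1).
Proof.
exists 1 => // x y; split; first exact: clamp_norm.
by rewrite mul1r; exact: clamp_lip.
Qed.

End BlipAlgebra.

Section PositiveSquare.
Context {R : realType}.
Implicit Types (x y : R).

Definition ppart x : R := Num.max 0 x.

Lemma ppart_ge0 x : 0 <= ppart x. Proof. by rewrite /ppart le_max lexx. Qed.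

Lemma ppart_lip x y : `|ppart x - ppart y| <= `|x - y|.
Proof.
have := ler_norm (x - y); have := ler_norm (y - x); rewrite (distrC y) ler_norml /ppart => h1 h2.
case: (leP 0 x) => h3; case: (leP 0 y) => h4; apply/andP; split; lra.
Qed.

Lemma ppart0 : ppart 0 = 0. Proof. by rewrite /ppart maxxx. Qed.

(** A quadratic remainder gives the derivative without separate one-sided limits at the kink of
    [ppart]. *)
Lemma is_derive_quadratic (f : R -> R) (x c K : R) :
  (forall h, `|f (x + h) - f x - c * h| <= K * h ^+ 2) -> is_derive x 1 f c.
Proof.
move=> hf.
have K0 : 0 <= K by have := le_trans (normr_ge0 _) (hf 1); rewrite expr1n (mulr1 K).
have hcvg : (fun h => h^-1 *: (f (h *: 1 + x) - f x)) @ (0 : R)^' --> c.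
  apply/cvgrPdist_le => e e0; near=> h.
  have h0 : h != 0 by near: h; exact: nbhs_dnbhs_neq.
  have := hf h; rewrite /GRing.scale /= mulr1 (addrC h) => hh.
  have -> : c - h^-1 * (f (x + h) - f x) = - (h^-1 * (f (x + h) - f x - c * h)) by field.
  rewrite normrN normrM normfV.
  apply: (@le_trans _ _ (`|h|^-1 * (K * h ^+ 2))); first by rewrite ler_wpM2l // invr_ge0.
  rewrite -[h ^+ 2]real_normK ?num_real // mulrCA expr2 mulKf ?normr_eq0 //.
  have Kh : `|h| < e / (K + 1).
    near: h; apply: (@dnbhs0_lt _ R); rewrite divr_gt0 //; lra.
  apply: (@le_trans _ _ ((K + 1) * (e / (K + 1)))).
    by apply: ler_pM => //; [rewrite lerDl|exact: ltW].
  by rewrite mulrCA divff ?mulr1 // gt_eqF //; lra.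
apply: DeriveDef.
  by apply/cvg_ex; exists c.
by apply: cvg_lim.
Unshelve. all: by end_near. Qed.

Lemma is_derive_ppart2 x : is_derive x 1 (fun y => ppart y ^+ 2) (2 * ppart x).
Proof.
apply: (@is_derive_quadratic _ _ _ 1) => h; rewrite mul1r /ppart.
have -> : forall a b : R, (`|a| <= b) = (- b <= a <= b) by move=> a b; exact: ler_norml.
by case: (leP 0 (x + h)) => h1; case: (leP 0 x) => h2; apply/andP; split; nra.
Qed.

(** A polynomial profile that is C^1 with Lipschitz derivative, which is all that [regular] asks of
    a test function. *)
Definition bump x : R := ppart (1 - x ^+ 2) ^+ 2.
Definition bump' x : R := 2 * ppart (1 - x ^+ 2) * (- (2 * x)).

Lemma is_derive_bump x : is_derive x 1 bump (bump' x).
Proof.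
have d1 : is_derive x 1 (fun y : R => 1 - y ^+ 2) (- (2 * x)).
  by apply: is_derive_eq; rewrite /GRing.scale /=; ring.
exact: (@is_derive1_comp R (fun y => ppart y ^+ 2) (fun y => 1 - y ^+ 2) x _ _ (is_derive_ppart2 _) d1).
Qed.

(** Turns the bump and its derivative into polynomials in the bounded Lipschitz function [clamp 1],
    so that [blip] follows by algebra. *)
Lemma ppart_clamp x : ppart (1 - x ^+ 2) = 1 - clamp 1 x ^+ 2.
Proof.
have [h|h] := leP `|x| 1.
  rewrite clamp_id // /ppart max_r // subr_ge0 -(real_normK (num_real x)).
  by rewrite expr_le1.
have x2 : 1 < x ^+ 2.
  by rewrite -(real_normK (num_real x)) -[X in X < _](expr1n _ 2) ltrXn2r // nnegrE.
rewrite /ppart max_l; last by lra.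
have [x0|x0] := leP 0 x.
  rewrite /clamp min_l; last by move: h; rewrite ger0_norm // => /ltW.
  by rewrite max_r ?expr1n ?subrr //; lra.
move: h; rewrite ltr0_norm // => h.
by rewrite /clamp min_r ?max_l ?sqrrN ?expr1n ?subrr //; lra.
Qed.

Lemma bump'_clamp x : bump' x = 2 * (1 - clamp 1 x ^+ 2) * (- (2 * clamp 1 x)).
Proof.
rewrite /bump' ppart_clamp; case: (leP `|x| 1) => h; first by rewrite clamp_id.
have -> : 1 - clamp 1 x ^+ 2 = 0; last by rewrite !mulr0 !mul0r.
rewrite -ppart_clamp /ppart; case: leP => // h2.
have : 1 < `|x| ^+ 2 by rewrite -[X in X < _](expr1n _ 2) ltrXn2r // nnegrE.
rewrite real_normK ?num_real //; lra.
Qed.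

Lemma blip_bump : blip bump.
Proof.
have -> : bump = fun x => (1 - clamp 1 x * clamp 1 x) * (1 - clamp 1 x * clamp 1 x).
  by apply/funext => x; rewrite /bump ppart_clamp !expr2.
have bc := @blip_clamp1 R.
by apply: blipM; apply: blipD; try exact: blip_cst; apply: blipN; apply: blipM.
Qed.

Lemma blip_bump' : blip bump'.
Proof.
have -> : bump' = fun x => 2 * (1 - clamp 1 x * clamp 1 x) * (- (2 * clamp 1 x)).
  by apply/funext => x; rewrite bump'_clamp !expr2.
have bc := @blip_clamp1 R; have b2 := blip_cst (2 : R).
apply: blipM; last by apply: blipN; apply: blipM.
by apply: blipM => //; apply: blipD; [exact: blip_cst|apply: blipN; apply: blipM].
Qed.

Lemma bump_ge0 x : 0 <= bump x. Proof. exact: sqr_ge0. Qed.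

Lemma bump_le1 x : bump x <= 1.
Proof.
rewrite /bump -[leRHS](expr1n _ 2) lerXn2r ?nnegrE ?ppart_ge0 //.
by rewrite /ppart ge_max ler01 gerBl sqr_ge0.
Qed.

Lemma bump_out x : 1 <= `|x| -> bump x = 0.
Proof.
move=> h; rewrite /bump /ppart max_l ?expr0n // subr_le0.
by rewrite -(real_normK (num_real x)) expr_ge1.
Qed.

Lemma bump0 : bump 0 = 1.
Proof. by rewrite /bump /ppart expr0n subr0 max_r ?expr1n. Qed.

End PositiveSquare.

Section ConcreteCutoffs.
Context {R : realType}.
Implicit Types (h T : R).

Lemma is_derive_affine (f f' : R -> R) (a b x : R) : (forall x : R, is_derive x 1 f (f' x)) ->
  is_derive x 1 (fun x => f (a * x + b)) (f' (a * x + b) * a).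
Proof.
move=> df.
have d1 : is_derive x 1 (fun y : R => a * y + b) a.
  by apply: is_derive_eq; rewrite /GRing.scale /=; ring.
exact: (@is_derive1_comp R f (fun y => a * y + b) x _ _ (df _) d1).
Qed.

(** With a = t/h in [0, 1], [de] is a^2 (1-a)^2 / h and [- ch'] is 4 a (1-a) (1+a) / h; the factor
    1/16 in [de] gives this form and makes the comparison plain. On the middle half a (1-a) >= 3/16,
    so the mass of [de] is at least (9/256) / h times h/2, that is 9/512. Independence of [h] is
    essential, since [h] is chosen after this constant. *)
Lemma time_cutoffs_exist h : 0 < h -> exists de de' ch ch',
  [/\ time_mollifier h de de', initial_cutoff h ch ch' de &
      forall T t, h <= t <= T -> 9 / 512 <= itg 0 T (fun s => de (t - s))].
Proof.
move=> h0.
have hn0 : h != 0 by rewrite gt_eqF.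
pose de (t : R) := (16 * h)^-1 * bump (2 / h * t + (-1)).
pose de' (t : R) := (16 * h)^-1 * (bump' (2 / h * t + (-1)) * (2 / h)).
pose ch (t : R) := bump (h^-1 * t + 0).
pose ch' (t : R) := bump' (h^-1 * t + 0) * h^-1.
have bde : blip de by apply: blipM; [exact: blip_cst|exact: (blip_affine _ _ blip_bump)].
exists de, de', ch, ch'; split.
- split => //.
  + by move=> t; rewrite mulr_ge0 ?bump_ge0 // invr_ge0; lra.
  + move=> t ht; rewrite /de bump_out ?mulr0 //.
    have e : 2 / h * t = 2 * (t / h) by field.
    case/orP: ht => ht; last first.
      have : 1 <= t / h by rewrite ler_pdivlMr // mul1r.
      have := ler_norm (2 / h * t - 1); lra.
    have : t / h <= 0 by rewrite ler_pdivrMr // mul0r.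
    have := ler_norm (- (2 / h * t - 1)); rewrite normrN; lra.
  + by move=> t; apply: is_derive_mull; apply: is_derive_affine => x; exact: is_derive_bump.
  + apply: blipM; first exact: blip_cst.
    by apply: blipM; [exact: (blip_affine _ _ blip_bump')|exact: blip_cst].
- split.
  + split; first by move=> t; rewrite bump_ge0 bump_le1.
      by rewrite /ch mulr0 add0r bump0.
    move=> t ht; rewrite /ch bump_out // addr0 normrM gtr0_norm ?invr_gt0 //.
    by rewrite mulrC ler_pdivlMr // mul1r.
  + by move=> t; apply: is_derive_affine => x; exact: is_derive_bump.
  + exact: (blip_affine _ _ blip_bump).
  + by apply: blipM; [exact: (blip_affine _ _ blip_bump')|exact: blip_cst].
  + move=> t t0; rewrite /de /ch' addr0.
    pose a := t / h.
    have a0 : 0 <= a by rewrite divr_ge0 // ltW.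
    have -> : 2 / h * t + (-1) = 2 * a - 1 by rewrite /a; field.
    have -> : h^-1 * t = a by rewrite /a mulrC.
    have -> : (16 * h)^-1 * bump (2 * a - 1) = bump (2 * a - 1) / 16 * h^-1 by field.
    rewrite -mulNr; apply: ler_wpM2r; first by rewrite invr_ge0 ltW.
    rewrite /bump /bump' /ppart.
    have [a1|a1] := leP a 1; last first.
      rewrite max_l; last by nra.
      by rewrite max_l; [rewrite expr0n /=; lra|nra].
    rewrite max_r; last by nra.
    rewrite max_r; last by nra.
    have : a * (1 - a) * (a * (1 - a)) <= a * (1 - a) * (4 * (1 + a)).
      by apply: ler_wpM2l; nra.
    rewrite !expr2; nra.
- move=> T t /andP[ht tT].
  have bd : bm (fun s : R => de (t - s)).
    by have bdd := blip_bm bde; btac.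
  have d0 s : 0 <= de (t - s) by rewrite mulr_ge0 ?bump_ge0 // invr_ge0; lra.
  rewrite (@itg_split _ 0 (t - 3 / 4 * h) T) //; [|lra|lra].
  rewrite (@itg_split _ (t - 3 / 4 * h) (t - h / 4) T) //; [|lra|lra].
  have i1 : 0 <= itg 0 (t - 3 / 4 * h) (fun s => de (t - s)) by apply: itg_ge0.
  have i3 : 0 <= itg (t - h / 4) T (fun s => de (t - s)) by apply: itg_ge0.
  apply: (@le_trans _ _ (itg (t - 3 / 4 * h) (t - h / 4) (fun s => de (t - s)))); last by lra.
  apply: (@le_trans _ _ (itg (t - 3 / 4 * h) (t - h / 4) (fun s => 9 / 256 / h))).
    rewrite itg_cst; last by lra.
    have -> : 9 / 256 / h * (t - h / 4 - (t - 3 / 4 * h)) = 9 / 512 by field.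
    by [].
  apply: le_itg => [||s /andP[s1 s2]]; [exact: bm_cst|exact: bd|].
  rewrite /de.
  pose a := (t - s) / h.
  have a1 : 1 / 4 <= a by rewrite ler_pdivlMr //; lra.
  have a2 : a <= 3 / 4 by rewrite ler_pdivrMr //; lra.
  have -> : 2 / h * (t - s) + (-1) = 2 * a - 1 by rewrite /a; field.
  have -> : (16 * h)^-1 * bump (2 * a - 1) = bump (2 * a - 1) / 16 * h^-1 by field.
  apply: ler_wpM2r; first by rewrite invr_ge0 ltW.
  rewrite /bump /ppart max_r; last by nra.
  have : 3 / 16 <= a * (1 - a) by nra.
  rewrite !expr2 => ha; nra.
Qed.
End ConcreteCutoffs.

Section WeightAndMollifier.
Context {R : realType}.

(** A logistic function replaces the exponential in order to stay bounded with bounded derivatives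
    on the whole line. It satisfies ps' = - c ps (1 - ps), and ps <= 1/2 for t >= 0, so c = 2 (kappa
    + 1) yields the required rate. *)
Lemma decaying_weight_exists (T : R) : 0 < T -> exists ps ps', decaying_weight ps ps' /\
  exists2 p : R, 0 < p & forall t, 0 <= t <= T -> p <= ps t.
Proof.
move=> T0.
pose c : R := 2 * (kappa + 1).
have kap1 := @kappa_ge1 R.
have c0 : 0 < c by rewrite /c; lra.
pose ps (t : R) := (1 + expR (c * t))^-1.
pose ps' (t : R) := - c * (ps t * (1 - ps t)).
have den t : 1 < 1 + expR (c * t) by rewrite ltrDl expR_gt0.
have den0 t : 0 < 1 + expR (c * t) by apply: lt_trans (den t).
have p01 t : 0 < ps t <= 1.
  by rewrite /ps invr_gt0 den0 /= invf_le1 // ltW.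
have dps (t : R) : is_derive t 1 ps (ps' t).
  have d1 : is_derive t 1 (fun y : R => 1 + expR (c * y)) (c * expR (c * t)).
    by apply: is_derive_eq; rewrite /GRing.scale /=; ring.
  have := is_deriveV (f := fun y : R => 1 + expR (c * y)) (x := t) (v := 1) (t := c * expR (c * t)).
  rewrite gt_eqF // => /(_ isT d1).
  rewrite (_ : _ *: _ = ps' t) // /ps' /ps /GRing.scale /=.
  by field; rewrite gt_eqF.
have bps : blip ps.
  apply: (blip_of_derive (f' := ps') (L := 1 + c)) => // t.
    have /andP[/ltW h1 h2] := p01 t; rewrite ger0_norm //; lra.
  have /andP[/ltW h1 h2] := p01 t.
  rewrite normrM normrN (gtr0_norm c0) -[leRHS]addrC -[leLHS]addr0; apply: lerD => //.
  rewrite -[leRHS]mulr1; apply: ler_pM => //; first exact: ltW.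
  by rewrite ger0_norm; nra.
exists ps, ps'; split.
  split => //.
    apply: blipM; first exact: blip_cst.
    by apply: blipM => //; apply: blipD; [exact: blip_cst|exact: blipN].
  move=> t t0; have /andP[/ltW h1 h2] := p01 t.
  have h3 : ps t <= 1 / 2.
    rewrite /ps div1r lef_pV2 ?posrE //.
    have : 1 <= expR (c * t) by rewrite -expR0 ler_expR mulr_ge0 // ltW.
    lra.
  have h4 : 0 <= (kappa + 1) * (ps t * (1 - 2 * ps t)).
    by rewrite mulr_ge0 // ?mulr_ge0 //; lra.
  have -> : ps' t = - (kappa + 1) * ps t - (kappa + 1) * (ps t * (1 - 2 * ps t)).
    by rewrite /ps' /c; ring.
  by rewrite gerDl oppr_le0.
exists (ps T); first by have /andP[] := p01 T.
move=> t /andP[t0 tT]; rewrite /ps lef_pV2 ?posrE // lerD2l ler_expR.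
by rewrite ler_pM2l.
Qed.

(** The square of the positive part of cos(2 pi z) - cos(2 pi r) is periodic, even and C^1 with
    Lipschitz derivative, and it lives within distance [r] of the integers. After the substitution x
    = z + y the bound is continuity of translations in L^1, applied for each [z] in the support; it
    is stated relative to the mass of [om], which is not normalised. *)
Lemma space_mollifier_exists (w : R -> R) (M e : R) : periodic1 w -> measurable_fun setT w ->
  (forall x, `|w x| <= M) -> 0 < e ->
  exists om om', [/\ space_mollifier om om', forall z, om (- z) = om z, 0 < itg 0 1 om &
    itg 0 1 (fun y => itg 0 1 (fun x => `|w x - w y| * om (x - y))) <= e * itg 0 1 om].
Proof.
move=> pw mw wM e0.
have bw : bm w by split => //; exists M.
have [r1 r10 hr1] := translation_continuity pw mw wM e0.
(* With r <= 1/4 the angle 2 pi r stays in [0, pi], where the cosine decreases. *)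
pose r := Num.min r1 (1 / 4).
have r0 : 0 < r by rewrite lt_min r10 /=; lra.
have r4 : r <= 1 / 4 by rewrite ge_min lexx orbT.
have rr1 : r <= r1 by rewrite ge_min lexx.
pose tp : R := 2 * pi.
have pi0 := pi_gt0 R.
have tp0 : 0 < tp by rewrite /tp; lra.
pose c := cos (tp * r).
pose g z := cos (tp * z) - c.
pose om z := ppart (g z) ^+ 2.
pose om' z := 2 * ppart (g z) * (- (tp * sin (tp * z))).
have pcos z : cos (tp * (z + 1)) = cos (tp * z).
  have tpE : tp = pi *+ 2 by rewrite /tp mulr_natl.
  by rewrite tpE mulrDr mulr1 cosD2pi.
have dg (z : R) : is_derive z 1 g (- (tp * sin (tp * z))).
  by apply: is_derive_eq; rewrite /GRing.scale /=; ring.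
have dom (z : R) : is_derive z 1 om (om' z).
  exact: (@is_derive1_comp R (fun y => ppart y ^+ 2) g z _ _ (is_derive_ppart2 _) (dg z)).
have bcos : blip (fun z => cos (tp * z)).
  have b1 : blip (@cos R).
    apply: (blip_of_derive (f' := fun x => - sin x) (L := 1)) => // x; first exact: cos_max.
    by rewrite normrN sin_max.
  by have := blip_affine tp 0 b1; under [X in blip X -> _]eq_fun => z do rewrite addr0.
have bsin : blip (fun z => sin (tp * z)).
  have b1 : blip (@sin R).
    by apply: (blip_of_derive (f' := cos) (L := 1)) => // x; [exact: sin_max|exact: cos_max].
  by have := blip_affine tp 0 b1; under [X in blip X -> _]eq_fun => z do rewrite addr0.
have bg : blip g by apply: blipD => //; exact: blip_cst.
have bpg : blip (fun z => ppart (g z)).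
  by apply: (blip_contraction (h := ppart)) => //; [exact: ppart0|exact: ppart_lip].
have bom : blip om.
  by have := blipM bpg bpg; under [X in blip X -> _]eq_fun => z do rewrite -expr2.
have bom' : blip om'.
  apply: blipM; first by apply: blipM => //; exact: blip_cst.
  by apply: blipN; apply: blipM => //; exact: blip_cst.
have o0 z : 0 <= om z by exact: sqr_ge0.
have oN z : om (- z) = om z by rewrite /om /g mulrN cosN.
have pom : periodic1 om by move=> z; rewrite /om /g pcos.
have supp z : 0 <= z <= 1 -> om z = 0 \/ z <= r \/ 1 - r <= z.
  move=> /andP[z0 z1].
  case: (leP z r) => zr; first by right; left.
  case: (leP (1 - r) z) => zr'; first by right; right.
  left; rewrite /om /g /ppart max_l ?expr0n // subr_le0 /c.
  have hr : tp * r \in `[0, pi] by rewrite in_itv /= /tp; apply/andP; split; nra.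
  case: (leP z (1 / 2)) => z2.
    rewrite leNgt ltr_cos //; last by rewrite in_itv /= /tp; apply/andP; split; nra.
    by rewrite -leNgt ler_pM2l // ltW.
  have -> : cos (tp * z) = cos (tp * (1 - z)).
    by rewrite -[LHS]cosN -mulrN -(pcos (- z)) (addrC (- z)).
  rewrite leNgt ltr_cos //; last by rewrite in_itv /= /tp; apply/andP; split; nra.
  by rewrite -leNgt ler_pM2l //; lra.
have bo := blip_bm bom.
exists om, om'; split => //.
  have rhalf : 0 < r / 2 by lra.
  pose k := (cos (tp * (r / 2)) - c) ^+ 2.
  have ck : 0 < cos (tp * (r / 2)) - c.
    rewrite subr_gt0 /c ltr_cos ?ltr_pM2l //; first by lra.
      by rewrite in_itv /= /tp; apply/andP; split; nra.
    by rewrite in_itv /= /tp; apply/andP; split; nra.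
  have k0 : 0 < k by rewrite exprn_gt0.
  rewrite (@itg_split _ 0 (r / 2) 1) //; [|lra|lra].
  apply: ltr_wpDr; first by apply: itg_ge0.
  apply: (@lt_le_trans _ _ (itg 0 (r / 2) (fun _ => k))).
    by rewrite itg_cst ?subr0 ?mulr_gt0 // ltW.
  apply: le_itg => [||z /andP[z0 z1]]; [exact: bm_cst|exact: bo|].
  have : cos (tp * (r / 2)) <= cos (tp * z).
    rewrite leNgt ltr_cos; last 2 first.
    - by rewrite in_itv /= /tp; apply/andP; split; nra.
    - by rewrite in_itv /= /tp; apply/andP; split; nra.
    by rewrite -leNgt ler_pM2l.
  rewrite /k /om /g /ppart => h; rewrite max_r; last by lra.
  by rewrite lerXn2r ?nnegrE; lra.
have bw1 : bm (fun p : R * R => `|w (p.1 + p.2) - w p.2| * om p.1) by btac.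
have -> : itg 0 1 (fun y => itg 0 1 (fun x => `|w x - w y| * om (x - y))) =
    itg 0 1 (fun y => itg 0 1 (fun z => `|w (z + y) - w y| * om z)).
  apply: eq_itg => y _.
  rewrite -(@itg_periodic_shift _ (fun x => `|w x - w y| * om (x - y)) y); [|btac|].
    by apply: eq_itg => z _; rewrite addrK.
  by move=> x; rewrite pw addrAC pom.
have -> : itg 0 1 (fun y => itg 0 1 (fun z => `|w (z + y) - w y| * om z)) =
    itg 0 1 (fun z => itg 0 1 (fun y => `|w (z + y) - w y| * om z)).
  by apply: (itg_swap (F := fun y z => `|w (z + y) - w y| * om z)); btac.
rewrite -itgZl //; apply: le_itg => [||z hz]; [btac|btac|].
rewrite itgZr; [|btac].
case: (supp z hz) => [->|hz']; first by rewrite !mulr0.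
rewrite ler_wpM2r //.
move: hz => /andP[z0 z1].
case: hz' => hz'.
  apply: le_trans (hr1 z _); last by rewrite ger0_norm //; lra.
  by apply: le_itg => [||y _]; [btac|btac|rewrite (addrC y)].
(* For [z] near 1, periodicity of [w] replaces the translation by [z] with the short translation by
   z - 1. *)
apply: le_trans (hr1 (z - 1) _); last by rewrite ler0_norm //; lra.
apply: le_itg => [||y _]; [btac|btac|].
by rewrite -[w (y + (z - 1))]pw addrA subrK (addrC y).
Qed.

End WeightAndMollifier.

(** * Stability and uniqueness *)

Section Stability.
Context {R : realType}.

(* [`|u x t - v x t| <= `|u x t - u y s| + `|v x t - u y s|]: comparing both solutions
   with [u] at the doubled point needs the doubling estimate twice, but no continuity
   in time of [u] or [v]. *)
Lemma L1_distance_le (T h p m c : R) (u v : R -> R -> R) (M : R) (om de ps : R -> R) :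
  0 < h <= T -> 0 <= p -> 0 <= m -> 0 <= c -> bm om -> bm de -> bm ps ->
  periodic1 om -> (forall z, 0 <= om z) -> (forall z, om (- z) = om z) -> itg 0 1 om = m ->
  (forall s, 0 <= de s) -> (forall t, 0 <= ps t) ->
  (forall t, 0 <= t <= T -> p <= ps t) ->
  (forall t, h <= t <= T -> c <= itg 0 T (fun s => de (t - s))) ->
  bm (fun q : R * R => u q.1 q.2) -> bm (fun q : R * R => v q.1 q.2) ->
  (forall x t, `|u x t| <= M) -> (forall x t, `|v x t| <= M) ->
  p * (c * m) * itg 0 T (fun t => itg 0 1 (fun x => `|u x t - v x t|)) <=
  itg4 T (fun x t y s => `|u x t - u y s| * Phi om de ps x t y s) +
  itg4 T (fun x t y s => `|v x t - u y s| * Phi om de ps x t y s) + p * (c * m) * (2 * M) * h.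
Proof.
move=> /andP[h0 hT] p0 m0 c0 bom bde bps pom o0 oN mE d0 ps0 hp hc bu bv uM vM.
have M0 : 0 <= M by apply: le_trans (uM 0 0).
have T0 : 0 <= T by apply: le_trans hT; exact: ltW.
pose F x t y s := `|u x t - u y s| * Phi om de ps x t y s.
pose F' x t y s := `|v x t - u y s| * Phi om de ps x t y s.
have bPhi : bm (fun q : R * R * R * R => Phi om de ps q.1.1.1 q.1.1.2 q.1.2 q.2).
  by rewrite /Phi; btac.
have bF : bm (fun q : R * R * R * R => F q.1.1.1 q.1.1.2 q.1.2 q.2) by rewrite /F; btac.
have bF' : bm (fun q : R * R * R * R => F' q.1.1.1 q.1.1.2 q.1.2 q.2) by rewrite /F'; btac.
have bI : bm (fun t : R => if t < h then 1 else 0 : R).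
  by apply: bm_indicator; apply: measurable_fun_ltr.
(* For t >= h the support of [de (t - s)] in [s] lies inside [0, T], so the inner mass of [Phi] is
   bounded below. *)
have inner x t : h <= t <= T -> p * (c * m) <= itg 0 T (fun s => itg 0 1 (fun y => Phi om de ps x t y s)).
  move=> ht; have /andP[h1 h2] := ht.
  have -> : itg 0 T (fun s => itg 0 1 (fun y => Phi om de ps x t y s)) =
      m * ps t * itg 0 T (fun s => de (t - s)).
    rewrite -itgZl; [|btac]; apply: eq_itg => s _.
    rewrite -mulrA -mE -itgZr //; [].
    rewrite -(itg_periodic_shift (- x) (f := fun y => om y * (ps t * de (t - s)))).
    + by apply: eq_itg => y _; rewrite /Phi -oN opprB.
    + by btac.
    + by move=> y; rewrite pom.
  have ht0 : 0 <= t <= T by rewrite h2 (le_trans (ltW h0) h1).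
  have -> : p * (c * m) = m * p * c by ring.
  apply: ler_pM => //; [exact: mulr_ge0| |exact: hc].
  by rewrite ler_wpM2l // hp.
have step x t : 0 <= t <= T -> p * (c * m) * `|u x t - v x t| <=
   itg 0 T (fun s => itg 0 1 (fun y => F x t y s)) + itg 0 T (fun s => itg 0 1 (fun y => F' x t y s))
   + p * (c * m) * (2 * M) * (if t < h then 1 else 0).
  move=> /andP[t0 tT].
  have pcm : 0 <= p * (c * m) by rewrite !mulr_ge0.
  have P0 y s : 0 <= Phi om de ps x t y s by rewrite /Phi !mulr_ge0.
  have A0 : 0 <= itg 0 T (fun s => itg 0 1 (fun y => F x t y s)).
    by apply: itg_ge0 => s _; apply: itg_ge0 => y _; rewrite mulr_ge0.
  have B0 : 0 <= itg 0 T (fun s => itg 0 1 (fun y => F' x t y s)).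
    by apply: itg_ge0 => s _; apply: itg_ge0 => y _; rewrite mulr_ge0.
  (* For t < h the support of the time mollifier sticks out of [0, T]; there the trivial bound 2 M
     is used, at a total cost proportional to [h]. *)
  case: (ltP t h) => th.
    rewrite mulr1; apply: (@le_trans _ _ (p * (c * m) * (2 * M))); last first.
      by apply: ler_wpDl; [exact: addr_ge0|exact: lexx].
    apply: ler_wpM2l => //; apply: (le_trans (ler_normB _ _)).
    by rewrite mulr_natl mulr2n; exact: lerD.
  rewrite mulr0 addr0.
  apply: (@le_trans _ _ (`|u x t - v x t| * itg 0 T (fun s => itg 0 1 (fun y => Phi om de ps x t y s)))).
    rewrite [leLHS]mulrC; apply: ler_wpM2l; first exact: normr_ge0.
    by apply: inner; apply/andP.
  rewrite -itgZl; [|btac].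
  rewrite -itgD; [|btac|btac].
  apply: le_itg => [||s _]; [btac|btac|].
  rewrite -itgZl; [|btac].
  rewrite -itgD; [|btac|btac].
  apply: le_itg => [||y _]; [btac|btac|].
  rewrite -mulrDl ler_wpM2r //.
  by rewrite [X in _ <= _ + X]distrC ler_distD.
rewrite -itgZl; [|btac].
have hI : itg 0 T (fun t => if t < h then 1 else 0 : R) <= h.
  rewrite (@itg_split _ 0 h T) //; last exact: ltW.
  have -> : itg h T (fun t => if t < h then 1 else 0 : R) = itg h T (fun _ => 0).
    by apply: eq_itg => t /andP[ht _]; rewrite ltNge ht.
  rewrite itg_cst // mul0r addr0.
  apply: (@le_trans _ _ (itg 0 h (fun _ => 1))); last by rewrite (itg_cst _ (ltW h0)) mul1r subr0.
  by apply: le_itg => [||t _]; [exact: bI|exact: bm_cst|case: ifP].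
have hI' : p * (c * m) * (2 * M) * itg 0 T (fun t => if t < h then 1 else 0 : R) <= p * (c * m) * (2 * M) * h.
  by rewrite ler_wpM2l // !mulr_ge0 //; lra.
apply: le_trans (lerD (lexx _) hI').
rewrite -itgZl // /itg4 -!itgD; [|btac|btac|btac|btac].
apply: le_itg => [||t ht]; [btac|btac|].
rewrite -itgZl; [|btac].
rewrite -[X in _ <= _ + X]mulr1 -[X in _ <= _ + _ * X](subr0 1) -itg_cst ?ler01 // -!itgD; [|btac|btac|btac|btac].
by apply: le_itg => [||x _]; [btac|btac|exact: step].
Qed.

(** The accuracy fixes [om] and hence [Lo]; these fix [h], hence [de], [ch] and the constant [L];
    only then is [rho0] chosen. The three sources of error, mollification of the datum, the width
    [h] and the defects, each receive at most a quarter of [p * (c * m) * e]. *)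
Lemma stability (T M e : R) (u0 : R -> R) : 0 < T ->
  measurable_fun setT u0 -> periodic1 u0 -> (forall x, `|u0 x| <= M) -> 0 < e ->
  exists2 rho0 : R, 0 < rho0 & forall (r1 r2 : R) (u v : R -> R -> R),
    0 <= r1 <= rho0 -> 0 <= r2 <= rho0 ->
    approx_entropy_solution T M r1 u0 u -> approx_entropy_solution T M r2 u0 v ->
    itg 0 T (fun t => itg 0 1 (fun x => `|u x t - v x t|)) <= e.
Proof.
move=> T0 mu0 pu0 u0M e0.
have bu0 : bm u0 by split => //; exists M.
have M0 : 0 <= M by apply: le_trans (u0M 0).
have kap1 := @kappa_ge1 R.
have [ps [ps' [mps [p p0 hp]]]] := @decaying_weight_exists R T T0.
pose c : R := 9 / 512.
have c0 : 0 < c by rewrite /c; lra.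
(* One eighth, because the mollification error occurs in both uses of the doubling estimate. *)
have e'0 : 0 < p * c * e / 8.
  by apply: divr_gt0 => //; apply: mulr_gt0 => //; exact: mulr_gt0.
have [om [om' [mom oN m0 hOm]]] := space_mollifier_exists pu0 mu0 u0M e'0.
set m := itg 0 1 om in m0 hOm.
have pcm0 : 0 < p * (c * m) by apply: mulr_gt0 => //; exact: mulr_gt0.
have pcme0 : 0 < p * (c * m) * e by exact: mulr_gt0.
have [Lo Lo0 hLo] : exists2 Lo : R, 0 <= Lo & forall z, `|om z| <= Lo /\ `|om' z| <= Lo.
  have [_ _ _ [L1 L10 hL1] [L2 L20 hL2]] := mom.
  exists (L1 + L2); first exact: addr_ge0.
  by move=> z; have [a1 _] := hL1 z z; have [a2 _] := hL2 z z; split; lra.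
pose C := (M * (2 * M) + kappa * M) * Lo.
have C0 : 0 <= C by rewrite /C mulr_ge0 // addr_ge0 // mulr_ge0 //; lra.
(* Collects the terms proportional to [h]: two initial layers and the interval t < h of
   [L1_distance_le]; the 1 makes [D] positive. *)
pose D := 2 * C + p * (c * m) * (2 * M) + 1.
have D0 : 0 < D.
  have : 0 <= p * (c * m) * (2 * M) by rewrite mulr_ge0 ?(ltW pcm0) //; lra.
  by rewrite /D; lra.
pose h := Num.min T (p * (c * m) * e / 4 / D).
have h0 : 0 < h by rewrite lt_min T0 /=; do 2 apply: divr_gt0 => //.
have hT : 0 < h <= T by rewrite h0 ge_min lexx.
have hD : D * h <= p * (c * m) * e / 4.
  by rewrite mulrC -ler_pdivlMr // ge_min lexx orbT.
have [de [de' [ch [ch' [mde mch hde]]]]] := time_cutoffs_exist h0.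
have [L [reg1 reg2 reg3]] := cutoffs_regular (T := T) mom mde mch mps.
have L0 : 0 <= L.
  have := reg3 0 0 0 0 0; rewrite lexx (ltW T0) => /(_ isT isT)[a _ _ _ _].
  exact: le_trans a.
(* Each of the two doubling estimates leaves at most (1 + 2 T) L times the larger defect. *)
pose N := 2 * (1 + 2 * T) * L + 1.
have N0 : 0 < N.
  have : 0 <= 2 * (1 + 2 * T) * L by rewrite mulr_ge0 //; lra.
  by rewrite /N; lra.
pose rho0 := p * (c * m) * e / 4 / N.
have rho00 : 0 < rho0 by do 2 apply: divr_gt0 => //.
have hN : N * rho0 <= p * (c * m) * e / 4.
  by rewrite mulrC -ler_pdivlMr.
exists rho0 => // r1 r2 u v /andP[r10 r1r] /andP[r20 r2r] au av.
have [bu uM pu _] := au; have [bv vM pv _] := av.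
have [pom o0 _ bo bo'] := mom; have [d0 _ _ bd bd'] := mde; have [p01 _ bp bp' _] := mps.
have := L1_distance_le hT (ltW p0) (ltW m0) (ltW c0) (blip_bm bo) (blip_bm bd) (blip_bm bp)
  pom o0 oN erefl d0 (fun t => ltW (proj1 (andP (p01 t)))) hp (fun t ht => hde T t ht) bu bv uM vM.
rewrite -/m => hdist.
have est1 := doubling_estimate T0 hT mom mde mch mps bu0 u0M au au reg1 reg2 reg3 hLo.
have est2 := doubling_estimate T0 hT mom mde mch mps bu0 u0M av au reg1 reg2 reg3 hLo.
rewrite -(ler_pM2l pcm0).
have rL1 : r1 * L <= rho0 * L by rewrite ler_wpM2r.
have rL2 : r2 * L <= rho0 * L by rewrite ler_wpM2r.
have TL1 : T * (r1 * L) <= T * (rho0 * L) by rewrite ler_wpM2l // ltW.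
have TL2 : T * (r2 * L) <= T * (rho0 * L) by rewrite ler_wpM2l // ltW.
move: hdist est1 est2 hOm; rewrite -/C.
move: (itg4 T _) (itg4 T _) (itg 0 T _) (itg 0 1 _) => i1 i2 d om0 hdist est1 est2 hOm.
apply: (le_trans hdist).
move: hD hN TL1 TL2 rL1 rL2; rewrite /D /N.
have -> : (2 * (1 + 2 * T) * L + 1) * rho0 = 2 * (rho0 * L) + 4 * (T * (rho0 * L)) + rho0 by ring.
have -> : (2 * C + p * (c * m) * (2 * M) + 1) * h = 2 * (C * h) + p * (c * m) * (2 * M) * h + h by ring.
move: hOm; have -> : p * c * e / 8 * m = p * (c * m) * e / 8 by ring.
move: est1 est2 pcme0.
move: (p * (c * m) * (2 * M) * h) (p * (c * m) * e) (C * h) (T * (rho0 * L)) (rho0 * L).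
move: (r1 * L) (r2 * L) => *; lra.
Qed.

End Stability.

(** * Null sets of the plane and uniqueness *)

Section Uniqueness.
Context {R : realType}.
Notation leb := (@lebesgue_measure R).

#[local] Instance ae_leb2_filter : Filter (nbhs (almost_everywhere (leb \x leb)%E)).
Proof. exact: (ae_filter_ringOfSetsType (leb \x leb)%E). Qed.

(** Tonelli for the indicator of a measurable null set containing the exceptional points; [P] itself
    may be non-measurable. *)
Lemma ae_sections (P : R * R -> Prop) : {ae (leb \x leb)%E, forall p, P p} ->
  {ae leb, forall t, {ae leb, forall x, P (x, t)}}.
Proof.
move=> [N [mN N0 hN]].
pose f (z : R * R) : \bar R := (\1_N z)%:E.
have mf : measurable_fun setT f by apply/measurable_EFinP; exact: measurable_indic.
have f0 z : (0 <= f z)%E by rewrite lee_fin.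
have mG : measurable_fun setT (fubini_G leb f) by exact: measurable_fun_fubini_tonelli_G.
have : (\int[leb]_t `|fubini_G leb f t| = 0)%E.
  transitivity (\int[leb]_t fubini_G leb f t)%E.
    by apply: eq_integral => t _; rewrite gee0_abs //; apply: integral_ge0.
  rewrite -(fubini_tonelli2 (m1 := leb) (m2 := leb) f) //.
  by rewrite integral_indic // setIT.
move/(ae_eq_integral_abs leb measurableT mG) => [N' [mN' N'0 hN']].
exists N'; split => // t nPt; apply: hN' => /= h; apply: nPt.
have {}h := h I.
have mNt : measurable (ysection N t) by exact: measurable_ysection.
exists (ysection N t); split => //.
- rewrite -[RHS]h /fubini_G.
  transitivity (\int[leb]_x (\1_(ysection N t) x)%:E)%E; first by rewrite integral_indic // setIT.
  by apply: eq_integral => x _; rewrite /f !indicE mem_ysection.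
- by move=> x nP; apply/set_mem; rewrite mem_ysection inE; apply: hN => hP; apply: nP.
Qed.

(** A weak solution is measurable only on the strip up to time [T]; extension by zero makes it
    measurable on the plane and leaves the entropy form unchanged. *)
Definition time_restrict (T : R) (u : R -> R -> R) (x t : R) : R :=
  if 0 <= t <= T then u x t else 0.

Lemma measurable_time_restrict (T : R) (u : R -> R -> R) :
  measurable_fun (setT `*` `[0, T]) (fun p : R * R => u p.1 p.2) ->
  measurable_fun setT (fun p : R * R => time_restrict T u p.1 p.2).
Proof.
move=> mu.
have mD : measurable (setT `*` `[0, T]%classic : set (R * R)) by exact: measurableX.
have := (measurable_restrictT _ mD).1 mu; congr measurable_fun.
apply/funext => -[x t]; rewrite /patch /time_restrict /=.
by have -> : ((x, t) \in (setT `*` `[0, T]%classic : set (R * R))) = (0 <= t <= T);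
  [rewrite in_setX in_setT mem_setE in_itv|].
Qed.

Lemma test_fun_measurable (phi phix phit : R -> R -> R) : test_fun phi phix phit ->
  [/\ measurable_fun setT (fun p : R * R => phi p.1 p.2),
      measurable_fun setT (fun p : R * R => phix p.1 p.2) &
      measurable_fun setT (fun p : R * R => phit p.1 p.2)].
Proof.
by move=> [_ [_ [c1 [c2 [c3 _]]]]]; split; exact: continuous2_measurable.
Qed.

(** For almost every [t] the two sections agree almost everywhere, and then their convolutions agree
    at every [x]; so the nonlocal term too depends only on the class of the function. *)
Lemma entropy_form_ae_eq (T lam : R) (u v phi phix phit : R -> R -> R) :
  measurable_fun (setT `*` `[0, T]) (fun p : R * R => u p.1 p.2) ->
  measurable_fun setT (fun p : R * R => v p.1 p.2) ->
  {ae (leb \x leb)%E, forall p : R * R, p.2 \in `[0, T] -> u p.1 p.2 = v p.1 p.2} ->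
  test_fun phi phix phit ->
  entropy_form T u lam phi phix phit = entropy_form T v lam phi phix phit.
Proof.
move=> mu mv uv tf; have [m1 m2 m3] := test_fun_measurable tf.
have mru := measurable_time_restrict mu.
have bK := @bm_Kp R.
rewrite /entropy_form.
transitivity (itg 0 T (fun t => itg 0 1 (fun x =>
    entropy_integrand (time_restrict T u) lam phi phix phit x t))).
  apply: eq_itg => t ht; apply: eq_itg => x _.
  by rewrite /entropy_integrand /time_restrict ht.
apply: ae_eq_itg.
- by rewrite /entropy_integrand; mtac.
- by rewrite /entropy_integrand; mtac.
have := ae_sections uv; apply: filterS => t ht tT.
have {}ht : {ae leb, forall x, 0 <= x <= 1 -> time_restrict T u x t = v x t}.
  by apply: filterS ht => x /= hx _; rewrite /time_restrict tT hx // in_itv.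
have conv_eq x : convKp (fun y => time_restrict T u y t - lam) x = convKp (fun y => v y t - lam) x.
  rewrite !convKpE; apply: ae_eq_itg; [mtac|mtac|].
  by apply: filterS ht => y hy hy'; rewrite hy.
rewrite /entropy_integrand; apply: ae_eq_itg; [mtac|mtac|].
by apply: filterS ht => x hx hx'; rewrite conv_eq hx.
Qed.

(** The bridge between the two notions: up to a null set a weak solution is an approximate one with
    defect zero, so [stability] applies to it for every accuracy. *)
Lemma weak_entropy_solution_clamp (T M : R) (u0 : R -> R) (u : R -> R -> R) :
  measurable_fun setT u0 -> {ae leb, forall x, `|u0 x| <= M} ->
  {ae (leb \x leb)%E, forall p : R * R, p.2 \in `[0, T] -> `|u p.1 p.2| <= M} -> 0 <= M ->
  weak_entropy_solution T u0 u ->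
  approx_entropy_solution T M 0 (fun x => clamp M (u0 x)) (fun x t => clamp M (time_restrict T u x t)) /\
  {ae (leb \x leb)%E, forall p : R * R, p.2 \in `[0, T] ->
     u p.1 p.2 = clamp M (time_restrict T u p.1 p.2)}.
Proof.
move=> mu0 u0M uM M0 [[pu [mu _]] hu].
have mr := measurable_time_restrict mu.
have mc : measurable_fun setT (fun p : R * R => clamp M (time_restrict T u p.1 p.2)).
  exact: measurable_clamp.
have ae1 : {ae (leb \x leb)%E, forall p : R * R, p.2 \in `[0, T] ->
     u p.1 p.2 = clamp M (time_restrict T u p.1 p.2)}.
  apply: filterS uM => p hp pT; rewrite clamp_id.
    by rewrite /time_restrict; move: pT; rewrite in_itv /= => ->.
  by rewrite /time_restrict; move: (pT); rewrite in_itv /= => ->; exact: hp.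
split => //; split.
- by split => //; exists M => p; exact: clamp_norm.
- by move=> x t; exact: clamp_norm.
- by move=> t x; rewrite /time_restrict pu.
- move=> lam L phi phix phit _ tf _; rewrite mul0r addr0.
  have [m1 m2 m3] := test_fun_measurable tf.
  rewrite -(entropy_form_ae_eq lam mu mc ae1 tf).
  have -> : itg 0 1 (fun x => `|clamp M (u0 x) - lam| * phi x 0) = itg 0 1 (fun x => `|u0 x - lam| * phi x 0).
    have mcu := measurable_clamp M mu0.
    apply: ae_eq_itg; [by mtac|by mtac|].
    by apply: filterS u0M => x hx _; rewrite clamp_id.
  exact: hu.
Qed.

(** Measurability of [P] makes the exceptional set measurable, so that Tonelli recovers its measure
    from its sections. *)
Lemma ae_of_sections (P : R * R -> bool) : measurable_fun setT P ->
  {ae leb, forall t, {ae leb, forall x, P (x, t)}} -> {ae (leb \x leb)%E, forall p, P p}.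
Proof.
move=> mP aeP.
pose N := [set p | ~~ P p].
have mN : measurable N.
  have := mP measurableT [set false] I; rewrite setTI; congr measurable.
  by apply/seteqP; split => p; rewrite /N /=; [move=> ->|move/negbTE].
exists N; split => //; last by move=> p /= /negP.
pose f (z : R * R) : \bar R := (\1_N z)%:E.
have mf : measurable_fun setT f by apply/measurable_EFinP; exact: measurable_indic.
have f0 z : (0 <= f z)%E by rewrite lee_fin.
have mG : measurable_fun setT (fubini_G leb f) by exact: measurable_fun_fubini_tonelli_G.
have -> : (leb \x leb)%E N = (\int[leb]_t `|fubini_G leb f t|)%E.
  transitivity (\int[leb]_t fubini_G leb f t)%E; last first.
    by apply: eq_integral => t _; rewrite gee0_abs //; apply: integral_ge0.
  rewrite -(fubini_tonelli2 (m1 := leb) (m2 := leb) f) //.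
  by rewrite integral_indic // setIT.
apply/(ae_eq_integral_abs leb measurableT mG).
apply: filterS aeP => t [A [mA A0 hA]] _.
have mNt : measurable (ysection N t) by exact: measurable_ysection.
transitivity (leb (ysection N t)).
  rewrite /fubini_G; transitivity (\int[leb]_x (\1_(ysection N t) x)%:E)%E.
    by apply: eq_integral => x _; rewrite /f !indicE mem_ysection.
  by rewrite integral_indic // setIT.
apply: (subset_measure0 (mu := leb) mNt mA _ A0) => x /mem_set; rewrite mem_ysection inE => nP.
by apply: hA => /= hP; move: nP; rewrite /N /= hP.
Qed.

Lemma itg_periodic_int (f : R -> R) (k : int) : bm f -> periodic1 f ->
  itg k%:~R (k%:~R + 1) f = itg 0 1 f.
Proof.
move=> bf pf; have := itg_translation 0 1 k%:~R bf; rewrite add0r (addrC 1) => <-.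
by apply: eq_itg => x _; exact: periodicZ.
Qed.

Lemma itg2_eq0_ae (T : R) (u v : R -> R -> R) :
  (forall t, periodic1 (u ^~ t)) -> (forall t, periodic1 (v ^~ t)) ->
  bm (fun p : R * R => u p.1 p.2) -> bm (fun p : R * R => v p.1 p.2) ->
  itg 0 T (fun t => itg 0 1 (fun x => `|u x t - v x t|)) = 0 ->
  ae_eq_TT T u v.
Proof.
move=> pu pv bu bv h0.
pose P (p : R * R) := (p.2 \in `[0, T]) ==> (u p.1 p.2 == v p.1 p.2).
have mP : measurable_fun setT P.
  have -> : P = fun p => ~~ (p.2 \in `[0, T]) || (u p.1 p.2 == v p.1 p.2).
    by apply/funext => p; rewrite /P implybE.
  apply: measurable_or; last by apply: measurable_fun_eqr; exact: bm_meas.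
  apply: measurable_neg; apply: (measurableT_comp _ measurable_snd).
  by apply: (measurable_fun_bool true); rewrite setTI; exact: (measurable_itv `[0, T]).
suff : {ae (leb \x leb)%E, forall p, P p}.
  by apply: filterS => p /implyP hp pT; apply/eqP/hp.
apply: ae_of_sections => //.
have bh : bm (fun t => itg 0 1 (fun x => `|u x t - v x t|)) by btac.
have := itg_eq0_ae bh (fun t _ => itg_ge0 (fun x _ => normr_ge0 _)) h0.
apply: filterS => t ht.
have [tT|tT] := boolP (t \in `[0, T]); last by apply: aeW => x; rewrite /P /= (negbTE tT).
have {}ht := ht tT.
have bf : bm (fun x => `|u x t - v x t|) by btac.
have pf : periodic1 (fun x => `|u x t - v x t|) by move=> x; rewrite pu pv.
(* The integral sees one period, while [ae_eq_TT] speaks of all real [x]: the statement is copied to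
   every integer translate of [0, 1], and countably many null sets are united. *)
have unit_ae (k : int) : {ae leb, forall x, k%:~R <= x <= k%:~R + 1 -> `|u x t - v x t| = 0}.
  by apply: itg_eq0_ae => //; rewrite itg_periodic_int.
have h1 := ae_foralln (fun n => unit_ae (Posz n)).
have h2 := ae_foralln (fun n => unit_ae (Negz n)).
apply: filterS2 h1 h2 => x hx1 hx2.
apply/implyP => _ /=; rewrite -subr_eq0 -normr_eq0; apply/eqP.
have xk : (Num.floor x)%:~R <= x <= (Num.floor x)%:~R + 1.
  by rewrite floor_le /=; have := floorD1_gt x; rewrite intrD => /ltW.
by case: (Num.floor x) xk => n; [exact: hx1|exact: hx2].
Qed.

Lemma approx_entropy_solution_unique (T M : R) (u0 : R -> R) (u v : R -> R -> R) : 0 < T ->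
  measurable_fun setT u0 -> periodic1 u0 -> (forall x, `|u0 x| <= M) ->
  approx_entropy_solution T M 0 u0 u -> approx_entropy_solution T M 0 u0 v ->
  ae_eq_TT T u v.
Proof.
move=> T0 mu0 pu0 u0M au av.
have [bu _ pu _] := au; have [bv _ pv _] := av.
apply: itg2_eq0_ae => //; apply/eqP; rewrite eq_le; apply/andP; split; last first.
  by apply: itg_ge0 => t _; apply: itg_ge0 => x _; exact: normr_ge0.
apply/ler_addgt0Pr => e e0; rewrite add0r.
have [r0 r00 h] := stability T0 mu0 pu0 u0M e0.
by apply: (h 0 0) => //; rewrite lexx /= ltW.
Qed.

Lemma weak_entropy_solution_unique (T : R) (u0 : R -> R) (u v : R -> R -> R) : 0 < T ->
  Linf_T u0 -> weak_entropy_solution T u0 u -> weak_entropy_solution T u0 v ->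
  ae_eq_TT T u v.
Proof.
move=> T0 [mu0 [pu0 [M0 hM0]]] wu wv.
have [[_ [_ [M1 hM1]]] _] := wu; have [[_ [_ [M2 hM2]]] _] := wv.
pose M := `|M0| + `|M1| + `|M2|.
have n0 := normr_ge0 M0; have n1 := normr_ge0 M1; have n2 := normr_ge0 M2.
have l0 := ler_norm M0; have l1 := ler_norm M1; have l2 := ler_norm M2.
have hM : 0 <= M by rewrite /M; lra.
have a0 : {ae leb, forall x, `|u0 x| <= M}.
  by apply: filterS hM0 => x /le_trans; apply; rewrite /M; lra.
have a1 : {ae (leb \x leb)%E, forall p : R * R, p.2 \in `[0, T] -> `|u p.1 p.2| <= M}.
  by apply: filterS hM1 => p hp /hp /le_trans; apply; rewrite /M; lra.
have a2 : {ae (leb \x leb)%E, forall p : R * R, p.2 \in `[0, T] -> `|v p.1 p.2| <= M}.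
  by apply: filterS hM2 => p hp /hp /le_trans; apply; rewrite /M; lra.
have [au eu] := weak_entropy_solution_clamp mu0 a0 a1 hM wu.
have [av ev] := weak_entropy_solution_clamp mu0 a0 a2 hM wv.
have uv := approx_entropy_solution_unique T0 (measurable_clamp M mu0)
  (fun x => congr1 (clamp M) (pu0 x)) (fun x => clamp_norm _ hM) au av.
apply: filterS3 eu ev uv => p hu hv huv pT.
by rewrite hu // hv //; exact: huv.
Qed.

End Uniqueness.

(** * Test functions *)

Section TestFunctions.
Context {R : realType}.

Lemma is_derive_unique (f : R -> R) (x a b : R) : is_derive x 1 f a -> is_derive x 1 f b -> a = b.
Proof. by move=> [_ <-] [_ <-]. Qed.

Lemma test_fun_periodic (phi phix phit : R -> R -> R) : test_fun phi phix phit ->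
  (forall t, periodic1 (phix ^~ t)) /\ (forall t, periodic1 (phit ^~ t)).
Proof.
move=> [_ [per [_ [_ [_ [dx [dt _]]]]]]]; split => t x.
  have h1 := dx (x + 1) t.
  have h2 : is_derive x 1 (fun y : R => phi (1 * y + 1) t) (phix (1 * x + 1) t * 1).
    by apply: (is_derive_affine (f := phi ^~ t) (f' := phix ^~ t)) => z; exact: dx.
  rewrite mul1r mulr1 in h2; apply: (is_derive_unique h2).
  have -> : (fun y : R => phi (1 * y + 1) t) = (fun y => phi y t).
    by apply/funext => y; rewrite mul1r per.
  exact: dx.
apply: (is_derive_unique (dt (x + 1) t)).
have -> : (fun s : R => phi (x + 1) s) = (fun s => phi x s) by apply/funext => s; rewrite per.
exact: dt.
Qed.

Lemma test_fun_support (phi phix phit : R -> R -> R) : test_fun phi phix phit ->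
  exists2 B : R, 0 < B & forall x t, B < `|t| -> [/\ phi x t = 0, phix x t = 0 & phit x t = 0].
Proof.
move=> [_ [_ [_ [_ [_ [dx [dt [B hB]]]]]]]].
(* The margin 1 keeps a whole neighbourhood of [t] outside the support, as the time derivative
   requires. *)
exists (`|B| + 1) => [|x t ht]; first by rewrite ltr_wpDl.
have Bt : B < `|t| by apply: le_lt_trans ht; have := ler_norm B; lra.
split; first exact: hB.
  apply: (is_derive_unique (dx x t)).
  have -> : (fun y : R => phi y t) = cst 0 by apply/funext => y; rewrite hB.
  exact: is_derive_cst.
apply: (is_derive_unique (dt x t)).
have d0 : is_derive (t : R^o) (1 : R^o) (cst 0 : R^o -> R^o) 0 by exact: is_derive_cst.
apply: (near_eq_is_derive _ d0).
apply/nbhs_ballP; exists 1 => //= s; rewrite /ball /= => st.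
rewrite hB //; have := ler_normD s (t - s); rewrite addrC subrK.
have := ler_norm B; lra.
Qed.

Lemma test_fun_bound (phi phix phit : R -> R -> R) : test_fun phi phix phit ->
  exists2 L : R, 0 <= L & forall x t, [/\ `|phi x t| <= L, `|phix x t| <= L & `|phit x t| <= L].
Proof.
move=> tf; have [p1 p2] := test_fun_periodic tf.
have [B B0 hB] := test_fun_support tf.
have [_ [p0 [c0 [c1 [c2 _]]]]] := tf.
have bnd (f : R -> R -> R) : continuous (fun p : R * R => f p.1 p.2) ->
    (forall t, periodic1 (f ^~ t)) -> (forall x t, B < `|t| -> f x t = 0) ->
    exists2 L, 0 <= L & forall x t, `|f x t| <= L.
  move=> cf pf f0.
  have cK : compact (`[0, 1]%classic `*` `[- B, B]%classic : set (R * R)).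
    by apply: compact_setX; exact: segment_compact.
  have := continuous_compact (continuous_subspaceT cf) cK.
  move/compact_bounded => [M [_ hM]].
  exists (`|M| + 1); first by rewrite addr_ge0.
  move=> x t; have [tB|tB] := leP `|t| B; last by rewrite f0 // normr0 addr_ge0.
  rewrite -(periodicZ (- Num.floor x) x (pf t)).
  apply: (hM (`|M| + 1)); first by have := ler_norm M; lra.
  exists (x + (- Num.floor x)%:~R, t) => //=; split => /=; rewrite in_itv /=.
    rewrite mulrNz; have := floor_le x; have := floorD1_gt x; rewrite intrD => h1 h2.
    by apply/andP; split; lra.
  by rewrite -ler_norml.
have [L0 L00 h0] := bnd phi c0 p0 (fun x t h => let: And3 a _ _ := hB x t h in a).
have [L1 L10 h1] := bnd phix c1 p1 (fun x t h => let: And3 _ a _ := hB x t h in a).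
have [L2 L20 h2] := bnd phit c2 p2 (fun x t h => let: And3 _ _ a := hB x t h in a).
exists (L0 + L1 + L2); first by rewrite !addr_ge0.
by move=> x t; have := h0 x t; have := h1 x t; have := h2 x t; split; lra.
Qed.

Lemma test_fun_bm (phi phix phit : R -> R -> R) : test_fun phi phix phit ->
  [/\ bm (fun p : R * R => phi p.1 p.2), bm (fun p : R * R => phix p.1 p.2) &
      bm (fun p : R * R => phit p.1 p.2)].
Proof.
move=> tf; have [m0 m1 m2] := test_fun_measurable tf; have [L _ hL] := test_fun_bound tf.
by split; split => //; exists L => p; have [] := hL p.1 p.2.
Qed.

(** A general test function is only C^1: its derivatives have a modulus of continuity but no
    Lipschitz bound. In the existence proof this takes the place of [regular]. *)
Lemma test_fun_modulus (phi phix phit : R -> R -> R) (T e : R) : test_fun phi phix phit -> 0 < e ->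
  exists2 r : R, 0 < r & forall x t x' t', 0 <= t <= T -> `|x' - x| <= r -> `|t' - t| <= r ->
    `|phix x' t' - phix x t| <= e /\ `|phit x' t' - phit x t| <= e.
Proof.
move=> tf e0; have [p1 p2] := test_fun_periodic tf.
have [_ [p0 [_ [c1 [c2 _]]]]] := tf.
have modu (f : R -> R -> R) : continuous (fun p : R * R => f p.1 p.2) ->
    (forall t, periodic1 (f ^~ t)) ->
    exists2 r : R, 0 < r & forall x t x' t', 0 <= t <= T -> `|x' - x| <= r -> `|t' - t| <= r ->
      `|f x' t' - f x t| <= e.
  move=> cf pf.
  have cK : compact (`[0, 1]%classic `*` `[0, T]%classic : set (R * R)).
    by apply: compact_setX; exact: segment_compact.
  have [r r0 hr] := uniform_continuity2 cf cK e0.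
  exists r => // x t x' t' tT xx tt.
  rewrite -(periodicZ (- Num.floor x) x (pf t)) -(periodicZ (- Num.floor x) x' (pf t')).
  apply: (hr (x + (- Num.floor x)%:~R, t) (x' + (- Num.floor x)%:~R, t')) => //=.
    split => /=; rewrite in_itv //=.
    rewrite mulrNz; have := floor_le x; have := floorD1_gt x; rewrite intrD => h1 h2.
    by apply/andP; split; lra.
  by rewrite opprD addrACA subrr addr0.
have [r1 r10 h1] := modu phix c1 p1; have [r2 r20 h2] := modu phit c2 p2.
exists (Num.min r1 r2); first by rewrite lt_min r10.
move=> x t x' t' tT; rewrite !le_min => /andP[a1 a2] /andP[b1 b2].
by split; [exact: h1|exact: h2].
Qed.

End TestFunctions.

(** * Summation in time *)

Section TimeTelescope.
Context {R : realType}.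
Notation leb := (@lebesgue_measure R).

(** The right endpoint is a null set. The half-open form fits the scheme, which equals its datum for
    t < tau but has jumped at t = tau. *)
Lemma le_itg_co (a b : R) (f g : R -> R) : bm f -> bm g ->
  (forall x, a <= x < b -> f x <= g x) -> itg a b f <= itg a b g.
Proof.
move=> bf bg fg.
pose f' x := if x == b then g x else f x.
have bf' : bm f'.
  have -> : f' = fun x => f x + (if x == b then 1 else 0) * (g x - f x).
    by apply/funext => x; rewrite /f'; case: ifP => _; ring.
  apply: bmD => //; apply: bmM; last exact: bmB.
  by apply: bm_indicator; apply: measurable_fun_eqr.
have -> : itg a b f = itg a b f'.
  apply: ae_eq_itg; [exact: bm_meas|exact: bm_meas|].
  exists [set b]; split; [exact: measurable_set1|exact: lebesgue_measure_set1|].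
  move=> x /= h; apply: contrapT => /eqP xb; apply: h => _.
  by rewrite /f' (negbTE xb).
apply: le_itg => // x /andP[ax xb]; rewrite /f'; case: eqVneq => // nxb.
by apply: fg; rewrite ax lt_neqAle nxb.
Qed.

(* Integrating the one-step inequality in [t] telescopes the energy [a]. *)
Lemma time_telescope (T tau A er Kb Ks : R) (a b S : R -> R) :
  0 < tau <= T -> bm a -> bm b -> bm S -> 0 <= er ->
  (forall t, 0 <= a t) -> (forall t, 0 <= t <= T -> `|b t| <= Kb) ->
  (forall t, 0 <= t <= T -> `|S t| <= Ks) ->
  (forall t, tau <= t <= T -> a t <= a (t - tau) + tau * (b (t - tau) - S t + er)) ->
  (forall t, 0 <= t < tau -> a t <= A) ->
  0 <= itg 0 T (fun t => b t - S t) + A + T * er + tau * (Kb + Ks).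
Proof.
move=> /andP[tau0 tauT] ba bb bS er0 a0 hb hS rec hA.
have T0 : 0 < T by exact: lt_le_trans tauT.
have T1 : 0 <= T - tau by rewrite subr_ge0.
have le1 : T - tau <= T by rewrite gerBl ltW.
have hb' t : T - tau <= t <= T -> `|b t| <= Kb.
  by move=> /andP[h1 h2]; apply: hb; rewrite h2 (le_trans T1 h1).
have hS' t : 0 <= t <= tau -> `|S t| <= Ks.
  by move=> /andP[h1 h2]; apply: hS; rewrite h1 (le_trans h2 tauT).
have [bas bbs] := (bm_shift (- tau) ba, bm_shift (- tau) bb).
have s1 : itg tau T a <= itg tau T (fun t => a (t - tau) + tau * (b (t - tau) - S t + er)).
  by apply: le_itg => //; btac.
have e1 : itg tau T (fun t => a (t - tau) + tau * (b (t - tau) - S t + er)) =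
   itg 0 (T - tau) a + tau * (itg 0 (T - tau) b - itg tau T S + er * (T - tau)).
  rewrite itgD; [|btac|btac].
  rewrite itg_translation // subrr; congr (_ + _).
  rewrite itgZl; [|btac]; congr (_ * _).
  rewrite itgD; [|btac|btac].
  rewrite itg_cst // itgB; [|btac|btac].
  by rewrite itg_translation // subrr.
have sa1 : itg 0 T a = itg 0 tau a + itg tau T a by apply: itg_split => //; exact: ltW.
have sa2 : itg 0 T a = itg 0 (T - tau) a + itg (T - tau) T a by apply: itg_split.
have sb : itg 0 T b = itg 0 (T - tau) b + itg (T - tau) T b by apply: itg_split.
have sS : itg 0 T S = itg 0 tau S + itg tau T S by apply: itg_split => //; exact: ltW.
have a1 : 0 <= itg (T - tau) T a by apply: itg_ge0.
have a2 : itg 0 tau a <= A * tau.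
  rewrite -[X in _ * X]subr0 -(itg_cst A (ltW tau0)); apply: le_itg_co => //; exact: bm_cst.
have b1 : `|itg (T - tau) T b| <= Kb * tau.
  by have := norm_itg_le le1 bb hb'; rewrite (_ : T - (T - tau) = tau) //; ring.
have S1 : `|itg 0 tau S| <= Ks * tau.
  by have := norm_itg_le (ltW tau0) bS hS'; rewrite subr0.
(* All boundary terms are integrals over windows of length [tau], so the claim is proved after
   multiplication by [tau]. *)
rewrite itgB // -(pmulr_rge0 _ tau0).
move: s1; rewrite e1 {e1}.
move: sa1 sa2 sb sS a1 a2 b1 S1; rewrite !ler_norml.
move: (itg 0 T a) (itg 0 tau a) (itg tau T a) (itg 0 (T - tau) a) (itg (T - tau) T a)
  (itg 0 T b) (itg 0 (T - tau) b) (itg (T - tau) T b) (itg 0 T S) (itg 0 tau S) (itg tau T S).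
move=> v1 v2 v3 v4 v5 v6 v7 v8 v9 v10 v11 e1 e2 -> -> a1 a2 /andP[b1 b2] /andP[S1 S2] s1.
have h1 : 0 <= tau * (er * tau) by rewrite !mulr_ge0 // ltW.
have h2 : v5 <= v2 + tau * (v7 - v11 + er * (T - tau)) by lra.
have h3 : tau * v8 >= - (tau * (Kb * tau)) by rewrite -mulrN ler_wpM2l // ltW.
have h4 : tau * v10 <= tau * (Ks * tau) by rewrite ler_wpM2l // ltW.
rewrite !mulrDr !mulrN; move: h2; rewrite !mulrDr !mulrN; lra.
Qed.

End TimeTelescope.

(** * The Lax-Friedrichs scheme *)

Section LaxFriedrichs.
Context {R : realType}.
Implicit Types (w : R -> R) (B tau : R).

(** The Lax-Friedrichs step for the flux w^2/2 when space step over time step is [B], which makes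
    |w| <= B the CFL condition. It is evaluated at every real [x], so that sums over a grid become
    integrals over a period. *)
Definition lax_friedrichs B d w (x : R) : R :=
  (w (x - d) + w (x + d)) / 2 - (w (x + d) ^+ 2 - w (x - d) ^+ 2) / (4 * B).

Lemma lax_friedrichs_bound B d m w : 0 < B -> m <= B -> (forall x, `|w x| <= m) ->
  forall x, `|lax_friedrichs B d w x| <= m.
Proof.
move=> B0 mB wm x; rewrite /lax_friedrichs.
have := wm (x - d); have := wm (x + d); rewrite !ler_norml.
move: (w (x + d)) (w (x - d)) => b a /andP[b1 b2] /andP[a1 a2].
have -> : (a + b) / 2 - (b ^+ 2 - a ^+ 2) / (4 * B) =
  (2 * B * (a + b) - (b ^+ 2 - a ^+ 2)) / (4 * B) by field; rewrite gt_eqF.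
have B4 : 0 < 4 * B by lra.
rewrite ler_pdivrMr // ler_pdivlMr //.
by apply/andP; split; nra.
Qed.

(* The scheme is monotone under the CFL condition; here the entropy inequality
   comes from writing [H - lam] as a combination of [w (x +- d) - lam] with
   nonnegative weights when [|lam| <= B], and of terms of equal sign otherwise. *)
Lemma lax_friedrichs_entropy B d w lam x : 0 < B -> (forall x, `|w x| <= B) ->
  `|lax_friedrichs B d w x - lam| <=
  (`|w (x - d) - lam| + `|w (x + d) - lam|) / 2
  - (eflux (w (x + d)) lam - eflux (w (x - d)) lam) / (2 * B).
Proof.
move=> B0 wB; have := lax_friedrichs_bound d B0 (lexx B) wB x.
rewrite /lax_friedrichs !efluxE; have := wB (x - d); have := wB (x + d); rewrite !ler_norml.
move: (w (x + d)) (w (x - d)) => b a /andP[b1 b2] /andP[a1 a2].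
pose al := (2 * B + a + lam) / (4 * B); pose be := (2 * B - b - lam) / (4 * B).
have B4 : 0 < 4 * B by lra.
have -> : (a + b) / 2 - (b ^+ 2 - a ^+ 2) / (4 * B) = lam + (al * (a - lam) + be * (b - lam)).
  by rewrite /al /be; field; rewrite gt_eqF.
have -> : (`|a - lam| + `|b - lam|) / 2 - (`|b - lam| * ((b + lam) / 2) - `|a - lam| * ((a + lam) / 2)) / (2 * B)
   = al * `|a - lam| + be * `|b - lam|.
  by rewrite /al /be; field; rewrite gt_eqF.
move=> /andP[H1 H2].
have -> : lam + (al * (a - lam) + be * (b - lam)) - lam = al * (a - lam) + be * (b - lam) by ring.
rewrite -ler_norml.
have [l1|l1] := leP `|lam| B.
  have /andP[l1' l2'] : - B <= lam <= B by rewrite -ler_norml.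
  have al0 : 0 <= al by apply: divr_ge0; lra.
  have be0 : 0 <= be by apply: divr_ge0; lra.
  clearbody al be; apply: (le_trans (ler_normD _ _)); rewrite !normrM.
  by rewrite (ger0_norm al0) (ger0_norm be0).
clearbody al be; have [l0|l0] := leP 0 lam.
  rewrite ger0_norm // in l1.
  rewrite (@ler0_norm _ (a - lam)) ?(@ler0_norm _ (b - lam)); [|lra|lra].
  by rewrite ler0_norm; lra.
rewrite ltr0_norm // in l1.
rewrite (@ger0_norm _ (a - lam)) ?(@ger0_norm _ (b - lam)); [|lra|lra].
by rewrite ger0_norm; lra.
Qed.

Definition scheme_step B tau w (x : R) : R :=
  lax_friedrichs B (B * tau) w x - tau * convKp (lax_friedrichs B (B * tau) w) x.

Definition scheme B tau (u0 : R -> R) (n : nat) : R -> R := iter n (scheme_step B tau) u0.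

Lemma lax_friedrichs_bm B d w : bm w -> bm (lax_friedrichs B d w).
Proof. by move=> bw; rewrite /lax_friedrichs; btac. Qed.

Lemma lax_friedrichs_periodic B d w : periodic1 w -> periodic1 (lax_friedrichs B d w).
Proof.
by move=> pw x; rewrite /lax_friedrichs (addrAC x 1 (- d)) (addrAC x 1 d) !pw.
Qed.

Lemma scheme_step_bm B tau w : bm w -> bm (scheme_step B tau w).
Proof.
move=> bw; have bK := @bm_Kp R; have bl := lax_friedrichs_bm B (B * tau) bw.
by rewrite /scheme_step; btac.
Qed.

Lemma scheme_step_periodic B tau w : bm w -> periodic1 w -> periodic1 (scheme_step B tau w).
Proof.
move=> bw pw x; rewrite /scheme_step (lax_friedrichs_periodic _ _ pw x).
by rewrite (conv_periodic (lax_friedrichs_bm B (B * tau) bw)).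
Qed.

Lemma scheme_step_bound B tau m w : 0 < B -> 0 <= tau -> m <= B -> bm w -> (forall x, `|w x| <= m) ->
  forall x, `|scheme_step B tau w x| <= m * (1 + kappa * tau).
Proof.
move=> B0 t0 mB bw wm x; rewrite /scheme_step.
have vm := lax_friedrichs_bound (B * tau) B0 mB wm.
have hG := conv_bound x (lax_friedrichs_bm B (B * tau) bw) vm.
apply: (le_trans (ler_normB _ _)); rewrite mulrDr mulr1; apply: lerD => //.
rewrite normrM (ger0_norm t0) (mulrC m) (mulrC kappa) -mulrA; exact: ler_wpM2l.
Qed.

(** The source is computed from the transported function, but the entropy form wants sign and
    convolution at one and the same function. Expressing the convolution through the new value costs
    one further convolution with factor [tau ^+ 2], at most [kappa ^+ 2 * B] in size. *)
Lemma scheme_step_entropy B tau w lam x : 0 < B -> 0 <= tau -> bm w -> (forall x, `|w x| <= B) ->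
  `|scheme_step B tau w x - lam| <=
  (`|w (x - B * tau) - lam| + `|w (x + B * tau) - lam|) / 2
  - (eflux (w (x + B * tau)) lam - eflux (w (x - B * tau)) lam) / (2 * B)
  - tau * (Num.sg (scheme_step B tau w x - lam) * convKp (scheme_step B tau w) x)
  + tau ^+ 2 * (kappa ^+ 2 * B).
Proof.
move=> B0 t0 bw wB.
have h1 := lax_friedrichs_entropy (B * tau) lam x B0 wB.
have vB := lax_friedrichs_bound (B * tau) B0 (lexx B) wB.
have bv := lax_friedrichs_bm B (B * tau) bw.
have bK := @bm_Kp R.
have k0 : 0 <= @kappa R by apply: le_trans kappa_ge1.
set v := lax_friedrichs B (B * tau) w in h1 vB bv *.
have zE y : scheme_step B tau w y = v y - tau * convKp v y by [].
have cz : convKp (scheme_step B tau w) x = convKp v x - tau * convKp (convKp v) x.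
  rewrite (_ : scheme_step B tau w = fun y => v y - tau * convKp v y) //.
  rewrite convB //; last by btac.
  by rewrite convZ //; btac.
have hcc : `|convKp (convKp v) x| <= kappa * (kappa * B).
  by apply: conv_bound; [btac|move=> y; exact: conv_bound].
rewrite cz; move: hcc h1; rewrite zE.
move: (convKp (convKp v) x) (convKp v x) (v x) => gg g vx hcc h1.
set s := Num.sg _.
have s1 : `|s| <= 1 by rewrite normr_sg; case: (_ != _).
have e1 : `|vx - tau * g - lam| = s * (vx - lam) - tau * (s * g).
  by rewrite normrEsg /s; ring.
have e2 : s * (vx - lam) <= `|vx - lam|.
  apply: (le_trans (ler_norm _)); rewrite normrM -[leRHS]mul1r; exact: ler_wpM2r.
have e3 : - (s * gg) <= kappa ^+ 2 * B.
  apply: (le_trans (ler_norm _)); rewrite normrN normrM expr2 -mulrA -[leRHS]mul1r.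
  exact: ler_pM.
have e4 : tau ^+ 2 * - (s * gg) <= tau ^+ 2 * (kappa ^+ 2 * B).
  by apply: ler_wpM2l => //; exact: sqr_ge0.
rewrite e1.
have -> : tau * (s * (g - tau * gg)) = tau * (s * g) + tau ^+ 2 * - (s * gg) by ring.
lra.
Qed.

Lemma scheme_bm B tau u0 n : bm u0 -> periodic1 u0 ->
  bm (scheme B tau u0 n) /\ periodic1 (scheme B tau u0 n).
Proof.
move=> bu pu; elim: n => [//|n [IH1 IH2]]; split; first exact: scheme_step_bm.
exact: scheme_step_periodic.
Qed.

(** A discrete Gronwall bound from 1 + y <= exp y. The assumption that the bound at step [n] is
    below [B] propagates down to all earlier steps and supplies their CFL condition. *)
Lemma scheme_bound B tau M u0 n : 0 < B -> 0 <= tau -> 0 <= M -> bm u0 -> periodic1 u0 ->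
  (forall x, `|u0 x| <= M) -> M * expR (kappa * (tau * n%:R)) <= B ->
  forall x, `|scheme B tau u0 n x| <= M * expR (kappa * (tau * n%:R)).
Proof.
move=> B0 t0 M0 bu pu uM; have k0 : 0 <= @kappa R by apply: le_trans kappa_ge1.
elim: n => [|n IH] hB x; first by rewrite !mulr0 expR0 mulr1.
have mono : M * expR (kappa * (tau * n%:R)) <= M * expR (kappa * (tau * n.+1%:R)).
  by rewrite ler_wpM2l // ler_expR !ler_wpM2l // ler_nat.
have hBn := le_trans mono hB.
have [bs _] := scheme_bm B tau n bu pu.
apply: (le_trans (scheme_step_bound B0 t0 hBn bs (IH hBn) x)).
have -> : M * expR (kappa * (tau * n.+1%:R)) = M * expR (kappa * (tau * n%:R)) * expR (kappa * tau).
  by rewrite -mulrA -expRD; congr (M * expR _); rewrite -natr1; ring.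
apply: ler_wpM2l; last exact: expR_ge1Dx.
by apply: mulr_ge0 => //; exact: expR_ge0.
Qed.

(** Piecewise constant in time. Freezing at [T] keeps the growth bound valid for every real [t], as
    [bm] requires; at negative times [Num.truncn] is 0 and the value is the datum. *)
Definition scheme_sol (T B tau : R) (u0 : R -> R) (x t : R) : R :=
  scheme B tau u0 (Num.truncn (Num.min t T / tau)) x.

Section SchemeSolution.
Context {T B tau M : R} {u0 : R -> R}.
Hypothesis T0 : 0 < T.
Hypothesis tau0 : 0 < tau.
Hypothesis M0 : 0 <= M.
Hypothesis MB : M * expR (kappa * T) <= B.
Hypothesis B0 : 0 < B.
Hypothesis bu0 : bm u0.
Hypothesis pu0 : periodic1 u0.
Hypothesis u0M : forall x, `|u0 x| <= M.

Lemma truncn_scaled_le (t : R) : tau * (Num.truncn (Num.min t T / tau))%:R <= T.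
Proof.
have [h|h] := leP 0 (Num.min t T / tau).
  have /andP[h1 _] := truncn_itv h.
  rewrite mulrC -ler_pdivlMr //; apply: (le_trans h1).
  by rewrite ler_pM2r ?invr_gt0 // ge_min lexx orbT.
have -> : Num.truncn (Num.min t T / tau) = 0%N by apply/truncn0Pn; rewrite -ltNge (lt_trans h).
by rewrite mulr0 ltW.
Qed.

Lemma scheme_sol_bound x t : `|scheme_sol T B tau u0 x t| <= B.
Proof.
have h := truncn_scaled_le t.
have k0 : 0 <= @kappa R by apply: le_trans kappa_ge1.
have hB : M * expR (kappa * (tau * (Num.truncn (Num.min t T / tau))%:R)) <= B.
  by apply: le_trans MB; rewrite ler_wpM2l // ler_expR ler_wpM2l.
apply: le_trans hB; apply: scheme_bound => //; first exact: ltW.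
by apply: le_trans MB; rewrite ler_wpM2l // ler_expR ler_wpM2l.
Qed.

Lemma scheme_sol_bm : bm (fun p : R * R => scheme_sol T B tau u0 p.1 p.2).
Proof.
split; last by exists B => p; exact: scheme_sol_bound.
rewrite /scheme_sol.
apply: (@measurable_countable_glue _ _ _ nat (fun p : R * R => Num.truncn (Num.min p.2 T / tau))
  (fun k p => scheme B tau u0 k p.1)) => k.
  pose g (t : R) : R := (Num.truncn (Num.min t T / tau))%:R.
  have mg : measurable_fun setT g.
    apply: nondecreasing_measurable => // s t st; rewrite /g ler_nat.
    apply: le_truncn; rewrite ler_pM2r ?invr_gt0 // le_min !ge_min st lexx /= orbT.
    by [].
  have := (measurableT_comp mg (@measurable_snd _ _ R R)) measurableT [set k%:R] (measurable_set1 _).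
  rewrite setTI; congr measurable; apply/seteqP; split => p /=; rewrite /g.
    by move/eqP; rewrite eqr_nat => /eqP.
  by move=> ->.
have [bk _] := scheme_bm B tau k bu0 pu0.
exact: (measurableT_comp (bm_meas bk) measurable_fst).
Qed.

Lemma scheme_sol_periodic t : periodic1 (scheme_sol T B tau u0 ^~ t).
Proof. by move=> x; rewrite /scheme_sol (scheme_bm B tau _ bu0 pu0).2. Qed.

Lemma scheme_sol_initial x t : t < tau -> scheme_sol T B tau u0 x t = u0 x.
Proof.
move=> tt; rewrite /scheme_sol; have -> // : Num.truncn (Num.min t T / tau) = 0%N.
apply/truncn0Pn; rewrite -ltNge ltr_pdivrMr // mul1r gt_min tt //.
Qed.

Lemma scheme_sol_step x t : tau <= t <= T ->
  scheme_sol T B tau u0 x t = scheme_step B tau (scheme_sol T B tau u0 ^~ (t - tau)) x.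
Proof.
move=> /andP[t1 t2]; have tau_gt0 := tau0.
rewrite /scheme_sol min_l // min_l; last by lra.
have h0 : 0 <= (t - tau) / tau by rewrite divr_ge0 ?subr_ge0 // ltW.
have -> // : Num.truncn (t / tau) = (Num.truncn ((t - tau) / tau)).+1.
apply: truncn_def; have := truncn_itv h0.
rewrite mulrBl divff ?gt_eqF // -!natr1 => /andP[h1 h2]; apply/andP; split; lra.
Qed.

End SchemeSolution.
End LaxFriedrichs.

(** * Entropy inequality of the scheme *)

Section SchemeEntropy.
Context {R : realType} {T B tau M : R} {u0 : R -> R}.
Hypothesis T0 : 0 < T.
Hypothesis tau0 : 0 < tau.
Hypothesis tauT : tau <= T.
Hypothesis M0 : 0 <= M.
Hypothesis MB : M * expR (kappa * T) <= B.
Hypothesis B0 : 0 < B.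
Hypothesis bu0 : bm u0.
Hypothesis pu0 : periodic1 u0.
Hypothesis u0M : forall x, `|u0 x| <= M.

Let v := scheme_sol T B tau u0.
Let bK : bm (@Kp R). Proof. exact: bm_Kp. Qed.
Let bv : bm (fun p : R * R => v p.1 p.2).
Proof. exact: (scheme_sol_bm T0 tau0 M0 MB B0). Qed.
Let vB x t : `|v x t| <= B.
Proof. exact: (scheme_sol_bound T0 tau0 M0 MB B0). Qed.
Let pv t : periodic1 (v ^~ t).
Proof. exact: scheme_sol_periodic. Qed.

Section Test.
Context {lam Lam L e : R} {phi phix phit : R -> R -> R}.
Hypothesis lamL : `|lam| <= Lam.
Hypothesis tf : test_fun phi phix phit.
Hypothesis e0 : 0 <= e.
Hypothesis hL : forall x t, 0 <= t <= T -> [/\ `|phi x t| <= L, `|phix x t| <= L & `|phit x t| <= L].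
Hypothesis he : forall x t x' t', 0 <= t <= T -> 0 <= t' <= T ->
  `|x' - x| <= B * tau -> `|t' - t| <= tau ->
  `|phix x' t' - phix x t| <= e /\ `|phit x' t' - phit x t| <= e.

Let bphi : bm (fun p : R * R => phi p.1 p.2). Proof. by case: (test_fun_bm tf). Qed.
Let bphix : bm (fun p : R * R => phix p.1 p.2). Proof. by case: (test_fun_bm tf). Qed.
Let bphit : bm (fun p : R * R => phit p.1 p.2). Proof. by case: (test_fun_bm tf). Qed.

(** [Bl] bounds |v - lam|. The energy is [a], its transport part [b] and its source part [S]: the
    entropy form is the time integral of b - S. *)
Let Bl := B + Lam.
Let a t := itg 0 1 (fun x => `|v x t - lam| * phi x t).
Let b t := itg 0 1 (fun x => `|v x t - lam| * phit x t + eflux (v x t) lam * phix x t).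
Let S t := itg 0 1 (fun x => Num.sg (v x t - lam) * convKp (v ^~ t) x * phi x t).

(** By the mean value theorem the average of the two shifts of [phi] is phi + tau phit at the
    earlier time and the centred difference is tau phix, with errors measured by the modulus [e] of
    the derivatives. *)
Lemma discrete_transport x t s : tau <= t <= T -> s = t - tau ->
  (phi (x + B * tau) t + phi (x - B * tau) t) / 2 <= phi x s + tau * phit x s + (tau + B * tau) * e /\
  `|(phi (x + B * tau) t - phi (x - B * tau) t) / (2 * B) - tau * phix x s| <= tau * e.
Proof.
move=> /andP[tt tT] sE; have tau_gt0 := tau0; have B_gt0 := B0.
have [_ [_ [_ [_ [_ [dx [dt _]]]]]]] := tf.
have d0 : 0 < B * tau by rewrite mulr_gt0.
have t0T : 0 <= t <= T by apply/andP; split; lra.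
have s0T : 0 <= s <= T by apply/andP; split; lra.
have [c1 /andP[c1a c1b] e1] := mean_value (f := phi ^~ t) (f' := phix ^~ t) x (x + B * tau) (fun z => dx z t).
have [c2 /andP[c2a c2b] e2] := mean_value (f := phi ^~ t) (f' := phix ^~ t) x (x - B * tau) (fun z => dx z t).
have [c3 /andP[c3a c3b] e3] := mean_value (f := phi x) (f' := phit x) s t (fun z => dt x z).
rewrite min_l in c1a; last by lra.
rewrite max_r in c1b; last by lra.
rewrite min_r in c2a; last by lra.
rewrite max_l in c2b; last by lra.
rewrite min_l in c3a; last by lra.
rewrite max_r in c3b; last by lra.
have c30T : 0 <= c3 <= T by apply/andP; split; lra.
have nt : `|t - t| <= tau by rewrite subrr normr0 ltW.
have nx : `|x - x| <= B * tau by rewrite subrr normr0 ltW.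
have n1 : `|c1 - x| <= B * tau by rewrite ler_norml; apply/andP; split; lra.
have n2 : `|c2 - x| <= B * tau by rewrite ler_norml; apply/andP; split; lra.
have n3 : `|c3 - s| <= tau by rewrite ler_norml; apply/andP; split; lra.
have nts : `|t - s| <= tau by rewrite ler_norml; apply/andP; split; lra.
have [f1 _] := he t0T t0T n1 nt.
have [f2 _] := he t0T t0T n2 nt.
have [_ f3] := he s0T c30T nx n3.
have [f4 _] := he s0T t0T n1 nts.
have [f5 _] := he s0T t0T n2 nts.
have ts : t - s = tau by rewrite sE; ring.
move: e1 e2 e3; rewrite ts addrAC subrr add0r (addrAC x) subrr add0r => e1 e2 e3.
move: f1 f2 f3 f4 f5; rewrite !ler_norml.
move: (phix c1 t) (phix c2 t) (phit x c3) (phix x t) (phix x s) (phit x s) e1 e2 e3.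
move: (phi (x + B * tau) t) (phi (x - B * tau) t) (phi x t) (phi x s) => p1 p2 p3 p4.
move=> q1 q2 q3 q4 q5 q6 e1 e2 e3 /andP[f1 f1'] /andP[f2 f2'] /andP[f3 f3'] /andP[f4 f4'] /andP[f5 f5'].
have -> : p1 = p3 + q1 * (B * tau) by rewrite -e1; ring.
have -> : p2 = p3 - q2 * (B * tau) by rewrite -mulrN -e2; ring.
have -> : p3 = p4 + q3 * tau by rewrite -e3; ring.
split.
  have h1 : (B * tau) * ((q1 - q2) / 2) <= (B * tau) * e by apply: ler_wpM2l; lra.
  have h2 : tau * q3 <= tau * (q6 + e) by apply: ler_wpM2l; lra.
  by move: h1 h2; rewrite !mulrDr; lra.
have -> : (p4 + q3 * tau + q1 * (B * tau) - (p4 + q3 * tau - q2 * (B * tau))) / (2 * B) - tau * q5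
   = tau * ((q1 + q2) / 2 - q5) by field; rewrite gt_eqF.
rewrite -mulrN.
by apply/andP; split; apply: ler_wpM2l; lra.
Qed.

Let abs_bound x t : `|v x t - lam| <= Bl.
Proof. by apply: (le_trans (ler_normB _ _)); exact: lerD. Qed.

Let Bl0 : 0 <= Bl. Proof. exact: le_trans (abs_bound 0 0). Qed.

Let flux_bound x t : `|eflux (v x t) lam| <= Bl ^+ 2.
Proof.
have Lam0 : 0 <= Lam by apply: le_trans lamL.
have B_gt0 := B0.
have h1 : `|v x t| <= Bl by apply: (le_trans (vB _ _)); rewrite /Bl lerDl.
have h2 : `|lam| <= Bl by apply: (le_trans lamL); rewrite /Bl; lra.
by apply: (le_trans (eflux_bound h1 h2)); rewrite expr2; apply: ler_wpM2l.
Qed.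

(** The one-step entropy inequality is multiplied by [phi] at the new time and integrated over a
    period; once the shifts rest on [phi], [discrete_transport] brings everything except the source
    back to time t - tau. *)
Lemma scheme_energy_step t : tau <= t <= T ->
  a t <= a (t - tau) + tau * (b (t - tau) - S t
    + (Bl * (1 + B) * e + Bl ^+ 2 * e + tau * (kappa ^+ 2 * B) * L)).
Proof.
move=> ht; have /andP[t1 t2] := ht; have tau_gt0 := tau0; have B_gt0 := B0.
have t0T : 0 <= t <= T by apply/andP; split; lra.
have k0 : 0 <= @kappa R by apply: le_trans kappa_ge1.
set s := t - tau; set d := B * tau.
pose E x := `|v x s - lam|; pose Q x := eflux (v x s) lam.
have phi0 x : 0 <= phi x t by case: tf.
have bt : bm (v ^~ t) by btac.
have bs : bm (v ^~ s) by btac.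
have bE : bm E by rewrite /E; btac.
have bQ : bm Q by rewrite /Q; btac.
have bp : bm (phi ^~ t) by btac.
have pphi x : phi (x + 1) t = phi x t by have [_ [p _]] := tf; exact: p.
have pE x : E (x + 1) = E x by rewrite /E pv.
have pQ x : Q (x + 1) = Q x by rewrite /Q pv.
have pw x : `|v x t - lam| * phi x t <=
    ((E (x - d) + E (x + d)) / 2 - (Q (x + d) - Q (x - d)) / (2 * B)) * phi x t
    - tau * (Num.sg (v x t - lam) * convKp (v ^~ t) x * phi x t) + tau ^+ 2 * (kappa ^+ 2 * B) * L.
  have := scheme_step_entropy lam x B0 (ltW tau0) bs (fun x => vB x s).
  have stepE : scheme_step B tau (v ^~ s) = v ^~ t.
    by apply/funext => y; rewrite /v (scheme_sol_step tau0).
  rewrite stepE -/d -/(E (x - d)) -/(E (x + d)) -/(Q (x + d)) -/(Q (x - d)).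
  move/(ler_wpM2r (phi0 x)) => h; apply: (le_trans h).
  rewrite [leLHS]mulrDl; apply: lerD.
    by rewrite le_eqVlt; apply/orP; left; apply/eqP; ring.
  have [hp _ _] := hL x t0T; rewrite ler_wpM2l //.
    by rewrite !mulr_ge0 // ?ltW // ?exprn_ge0.
  exact: le_trans (ler_norm _) hp.
have i1 : a t <= itg 0 1 (fun x => ((E (x - d) + E (x + d)) / 2 - (Q (x + d) - Q (x - d)) / (2 * B)) * phi x t)
    - tau * S t + tau ^+ 2 * (kappa ^+ 2 * B) * L.
  apply: (@le_trans _ _ (itg 0 1 (fun x => ((E (x - d) + E (x + d)) / 2 - (Q (x + d) - Q (x - d)) / (2 * B)) * phi x t
    - tau * (Num.sg (v x t - lam) * convKp (v ^~ t) x * phi x t) + tau ^+ 2 * (kappa ^+ 2 * B) * L))).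
    by apply: le_itg => [||x _]; [btac|btac|exact: pw].
  rewrite itgD; [|btac|btac]; rewrite itgB; [|btac|btac]; rewrite itgZl; [|btac].
  by rewrite itg_cst ?ler01 // subr0 mulr1.
(* Discrete integration by parts: periodicity moves the shifts from the solution to the test
   function. *)
have i2 : itg 0 1 (fun x => ((E (x - d) + E (x + d)) / 2 - (Q (x + d) - Q (x - d)) / (2 * B)) * phi x t) =
   itg 0 1 (fun x => E x * ((phi (x + d) t + phi (x - d) t) / 2)
      + Q x * ((phi (x + d) t - phi (x - d) t) / (2 * B))).
  have sh (F : R -> R) (c : R) : bm F -> periodic1 F ->
      itg 0 1 (fun x => F (x + c) * phi x t) = itg 0 1 (fun x => F x * phi (x - c) t).
    move=> bF pF; rewrite -(itg_periodic_shift c (f := fun x => F x * phi (x - c) t)).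
    - by apply: eq_itg => x _; rewrite addrK.
    - by btac.
    - by move=> x; rewrite pF addrAC pphi.
  transitivity (itg 0 1 (fun x => E (x + - d) * phi x t) / 2 + itg 0 1 (fun x => E (x + d) * phi x t) / 2
    - (itg 0 1 (fun x => Q (x + d) * phi x t) / (2 * B) - itg 0 1 (fun x => Q (x + - d) * phi x t) / (2 * B))).
    rewrite -!itgZr; [|btac|btac|btac|btac].
    rewrite -itgD; [|btac|btac].
    rewrite -itgB; [|btac|btac].
    rewrite -itgB; [|btac|btac].
    by apply: eq_itg => x _; field; rewrite gt_eqF.
  rewrite !sh // opprK -!itgZr; [|btac|btac|btac|btac].
  rewrite -itgD; [|btac|btac].
  rewrite -itgB; [|btac|btac].
  rewrite -itgB; [|btac|btac].
  by apply: eq_itg => x _; field; rewrite gt_eqF.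
have i3 : itg 0 1 (fun x => E x * ((phi (x + d) t + phi (x - d) t) / 2)
      + Q x * ((phi (x + d) t - phi (x - d) t) / (2 * B))) <=
    a s + tau * b s + (Bl * ((tau + d) * e) + Bl ^+ 2 * (tau * e)).
  rewrite /a /b -itgZl; [|btac]; rewrite -itgD; [|btac|btac].
  rewrite -[X in _ <= _ + X]mulr1 -[X in _ <= _ + _ * X](subr0 1) -itg_cst ?ler01 // -itgD; [|btac|btac].
  apply: le_itg => [||x _]; [btac|btac|].
  have [h1 h2] := discrete_transport x ht erefl.
  rewrite -/s -/d in h1 h2.
  rewrite -/(E x) -/(Q x).
  have E0 : 0 <= E x by exact: normr_ge0.
  have EB : E x <= Bl by exact: abs_bound.
  have QB : `|Q x| <= Bl ^+ 2 by exact: flux_bound.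
  have g1 := ler_wpM2l E0 h1.
  have g2 : E x * ((tau + d) * e) <= Bl * ((tau + d) * e).
    by apply: ler_wpM2r => //; rewrite mulr_ge0 // addr_ge0 ?mulr_ge0 // ltW.
  have g3 : Q x * ((phi (x + d) t - phi (x - d) t) / (2 * B) - tau * phix x s) <= Bl ^+ 2 * (tau * e).
    by apply: (le_trans (ler_norm _)); rewrite normrM; apply: ler_pM.
  move: g1 g2 g3; rewrite !mulrDr !mulrN.
  move: (E x * _) (E x * _) => *; lra.
rewrite i2 in i1.
apply: (le_trans i1).
apply: (@le_trans _ _ (a s + tau * b s + (Bl * ((tau + d) * e) + Bl ^+ 2 * (tau * e)) - tau * S t + tau ^+ 2 * (kappa ^+ 2 * B) * L)).
  by rewrite lerD2r lerD2r.
have -> : a s + tau * b s + (Bl * ((tau + d) * e) + Bl ^+ 2 * (tau * e)) - tau * S t + tau ^+ 2 * (kappa ^+ 2 * B) * L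
  = a s + tau * (b s - S t + (Bl * (1 + B) * e + Bl ^+ 2 * e + tau * (kappa ^+ 2 * B) * L)).
  by rewrite /d; ring.
by [].
Qed.

(** The terms in [e] are the transport errors accumulated over [T]. Those in [tau * L] come from the
    source error, from the two time windows lost in telescoping, and from replacing phi(x, t) by
    phi(x, 0) in the first step. Keeping [e] apart from [L] serves both Lipschitz and merely C^1
    derivatives. *)
Lemma scheme_sol_entropy :
  0 <= entropy_form T v lam phi phix phit + itg 0 1 (fun x => `|u0 x - lam| * phi x 0)
  + (T * (Bl * (1 + B) + Bl ^+ 2) * e
     + (2 * Bl + T * (kappa ^+ 2 * B) + Bl ^+ 2 + kappa * B) * (tau * L)).
Proof.
have tau_gt0 := tau0; have B_gt0 := B0; have T_gt0 := T0; have tau_le := tauT.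
have k0 : 0 <= @kappa R by apply: le_trans kappa_ge1.
have phi0 x t : 0 <= phi x t by case: tf.
have L0 : 0 <= L.
  have h0 : 0 <= (0 : R) <= T by rewrite lexx ltW.
  by have [h _ _] := hL 0 h0; exact: le_trans h.
have ba : bm a by rewrite /a; btac.
have bb : bm b by rewrite /b; btac.
have bS : bm S by rewrite /S; btac.
have er0 : 0 <= Bl * (1 + B) * e + Bl ^+ 2 * e + tau * (kappa ^+ 2 * B) * L.
  by rewrite !addr_ge0 // !mulr_ge0 // ?addr_ge0 // ?exprn_ge0 // ltW.
have tT : 0 < tau <= T by rewrite tau0 tauT.
have a0 t : 0 <= a t.
  by apply: itg_ge0 => // x _; rewrite mulr_ge0.
have hb t : 0 <= t <= T -> `|b t| <= Bl * L + Bl ^+ 2 * L.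
  move=> t0; rewrite -[leRHS]mulr1 -[X in _ * X](subr0 1); apply: norm_itg_le => [||x _]; [exact: ler01|by btac|].
  have [_ h1 h2] := hL x t0; apply: (le_trans (ler_normD _ _)).
  apply: lerD; rewrite normrM ?normr_id; apply: ler_pM => //.
have hS t : 0 <= t <= T -> `|S t| <= kappa * B * L.
  move=> t0; rewrite -[leRHS]mulr1 -[X in _ * X](subr0 1); apply: norm_itg_le => [||x _]; [exact: ler01|by btac|].
  have [h1 _ _] := hL x t0.
  have hc : `|convKp (v ^~ t) x| <= kappa * B by apply: conv_bound => //; btac.
  rewrite normrM; apply: ler_pM => //.
  rewrite normrM -[leRHS]mul1r; apply: ler_pM => //.
  by rewrite normr_sg; case: (_ != _).
have hA t : 0 <= t < tau -> a t <= itg 0 1 (fun x => `|u0 x - lam| * phi x 0) + Bl * (tau * L).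
  move=> /andP[t0 t1].
  rewrite -[X in _ <= _ + X]mulr1 -[X in _ <= _ + _ * X](subr0 1) -itg_cst ?ler01 // -itgD; [|btac|btac].
  apply: le_itg => [||x _]; [btac|btac|].
  have [c /andP[c1 c2] hc] := mean_value (f := phi x) (f' := phit x) 0 t (fun z => (proj1 (proj2 (proj2 (proj2 (proj2 (proj2 (proj2 tf))))))) x z).
  rewrite min_l // in c1; rewrite max_r // in c2.
  have cT : 0 <= c <= T by apply/andP; split; lra.
  have [_ _ h] := hL x cT.
  have -> : phi x t = phi x 0 + phit x c * t by rewrite -[t in RHS]subr0 -hc; ring.
  rewrite mulrDr; apply: lerD.
    by rewrite /v scheme_sol_initial.
  apply: (@le_trans _ _ (`|v x t - lam| * (tau * L))).
    apply: ler_wpM2l => //; rewrite mulrC; apply: (@le_trans _ _ (t * L)).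
      by apply: ler_wpM2l => //; exact: le_trans (ler_norm _) h.
    by apply: ler_wpM2r => //; exact: ltW.
  by apply: ler_wpM2r => //; rewrite mulr_ge0 // ltW.
have := time_telescope tT ba bb bS er0 a0 hb hS (fun t => scheme_energy_step (t := t)) hA.
have -> : itg 0 T (fun t => b t - S t) = entropy_form T v lam phi phix phit.
  apply: eq_itg => t _; rewrite /b /S -itgB; [|btac|btac].
  by apply: eq_itg => x _; rewrite entropy_integrandE.
move=> h; apply: (le_trans h); rewrite le_eqVlt; apply/orP; left; apply/eqP; ring.
Qed.

End Test.
End SchemeEntropy.

Lemma scheme_sol_approx {R : realType} (T B M : R) (u0 : R -> R) (rho : R) : 0 < T -> 0 <= M ->
  M * expR (kappa * T) <= B -> 0 < B -> bm u0 -> periodic1 u0 -> (forall x, `|u0 x| <= M) -> 0 < rho ->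
  exists2 tau1 : R, 0 < tau1 & forall tau, 0 < tau <= tau1 ->
    approx_entropy_solution T B rho u0 (scheme_sol T B tau u0).
Proof.
move=> T0 M0 MB B0 bu0 pu0 u0M rho0.
have k0 : 0 <= @kappa R by apply: le_trans kappa_ge1.
(* Levels are bounded by [B], so |v - lam| is at most B + B; the factor B + 1 comes from the modulus
   e = L (B + 1) tau of Lipschitz derivatives. *)
pose C := T * ((B + B) * (1 + B) + (B + B) ^+ 2) * (B + 1)
  + (2 * (B + B) + T * (kappa ^+ 2 * B) + (B + B) ^+ 2 + kappa * B).
have C0 : 0 <= C.
  by rewrite /C; repeat (apply: addr_ge0 || apply: mulr_ge0 || apply: exprn_ge0 || apply: ltW) => //; rewrite ltW.
exists (Num.min T (rho / (C + 1))) => [|tau /andP[tau0]].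
  by rewrite lt_min T0 divr_gt0 // ltr_wpDl.
rewrite le_min => /andP[tauT]; rewrite ler_pdivlMr ?ltr_wpDl // => tauC.
split.
- exact: (scheme_sol_bm T0 tau0 M0 MB B0).
- exact: (scheme_sol_bound T0 tau0 M0 MB B0).
- exact: scheme_sol_periodic.
move=> lam L phi phix phit lamB tf reg.
have h0T : 0 <= (0 : R) <= T by rewrite lexx ltW.
have L0 : 0 <= L by have [h _ _ _ _] := reg 0 0 0 0 h0T h0T; exact: le_trans h.
have hL x t : 0 <= t <= T -> [/\ `|phi x t| <= L, `|phix x t| <= L & `|phit x t| <= L].
  by move=> ht; have [] := reg x t x t ht ht.
have he x t x' t' : 0 <= t <= T -> 0 <= t' <= T -> `|x' - x| <= B * tau -> `|t' - t| <= tau ->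
    `|phix x' t' - phix x t| <= L * ((B + 1) * tau) /\ `|phit x' t' - phit x t| <= L * ((B + 1) * tau).
  move=> h1 h2 h3 h4; have [_ _ _ h5 h6] := reg x' t' x t h2 h1.
  have h7 : L * (`|x' - x| + `|t' - t|) <= L * ((B + 1) * tau).
    by apply: ler_wpM2l => //; rewrite mulrDl mul1r; exact: lerD.
  by split; [exact: le_trans h7 | exact: le_trans h7].
have e0 : 0 <= L * ((B + 1) * tau) by rewrite mulr_ge0 // mulr_ge0 ?addr_ge0 // ltW.
have := scheme_sol_entropy T0 tau0 tauT M0 MB B0 bu0 pu0 u0M lamB tf e0 hL he.
move=> h; apply: (le_trans h); apply: lerD => //.
apply: (@le_trans _ _ (tau * C * L)).
  by rewrite le_eqVlt /C; apply/orP; left; apply/eqP; ring.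
apply: ler_wpM2r => //; apply: le_trans tauC; apply: ler_wpM2l; [exact: ltW|by rewrite lerDl].
Qed.

(** * Passage to the limit *)

Section Limits.
Context {R : realType}.
Notation leb := (@lebesgue_measure R).
Implicit Types (T lam B : R).

Lemma itg2_cvg_dominated T (f_ : nat -> R -> R -> R) (f : R -> R -> R) (M : R) :
  (forall k, bm (fun p : R * R => f_ k p.1 p.2)) -> bm (fun p : R * R => f p.1 p.2) ->
  (forall k x t, `|f_ k x t| <= M) ->
  {ae leb, forall t, 0 <= t <= T -> {ae leb, forall x, 0 <= x <= 1 -> (fun k => f_ k x t) @ \oo --> f x t}} ->
  (fun k => itg 0 T (fun t => itg 0 1 (fun x => f_ k x t))) @ \oo
    --> itg 0 T (fun t => itg 0 1 (fun x => f x t)).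
Proof.
move=> bf_ bf fM hae.
have bf_k k : bm (fun t => itg 0 1 (fun x => f_ k x t)).
  by have bfk := bf_ k; move: (f_ k) bfk => g bg; btac.
apply: (itg_cvg_dominated (M := M * (1 - 0))) => [n|| n t _|].
- exact: (bm_meas (bf_k n)).
- by apply: bm_meas; btac.
- apply: norm_itg_le => [||x _]; [exact: ler01| |exact: fM].
  by have bfk := bf_ n; move: (f_ n) bfk => g bg; btac.
apply: filterS hae => t ht t0T.
apply: (itg_cvg_dominated (M := M)) => [n|| n x _|].
- by have bfk := bf_ n; move: (f_ n) bfk => g bg; apply: bm_meas; btac.
- by apply: bm_meas; btac.
- exact: fM.
by apply: filterS (ht t0T) => x; apply.
Qed.

(** Summability is passed inwards twice: for almost every [t] the inner integrals of the increments
    are summable, and then for almost every [x] so are the increments themselves. *)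
Lemma ae_cvg_of_summable T (u_ : nat -> R -> R -> R) :
  (forall k, bm (fun p : R * R => u_ k p.1 p.2)) ->
  (forall k, itg 0 T (fun t => itg 0 1 (fun x => `|u_ k.+1 x t - u_ k x t|)) <= 2^-1 ^+ k) ->
  {ae leb, forall t, 0 <= t <= T -> {ae leb, forall x, 0 <= x <= 1 -> cvgn (fun k => u_ k x t)}}.
Proof.
move=> bu hu.
pose D k x t := `|u_ k.+1 x t - u_ k x t|.
have bD k : bm (fun p : R * R => D k p.1 p.2).
  by rewrite /D; apply: bm_norm; apply: bmB.
have sum2 N : \sum_(n < N) (2^-1 : R) ^+ n <= 2.
  have -> : \sum_(n < N) (2^-1 : R) ^+ n = 2 - 2 * 2^-1 ^+ N.
    elim: N => [|N IH]; first by rewrite big_ord0 expr0; ring.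
    by rewrite big_ord_recr /= IH exprSr; field.
  by rewrite gerBl mulr_ge0 // exprn_ge0.
have h1 := @itg_series_ae R 0 T (fun k t => itg 0 1 (fun x => D k x t)) 2.
have {h1} h1 : {ae leb, forall t, 0 <= t <= T -> exists C', forall N, \sum_(n < N) itg 0 1 (fun x => D n x t) <= C'}.
  apply: h1 => [n|n x|N].
  - by have bDn := bD n; move: (D n) bDn => g bg; btac.
  - by apply: itg_ge0 => y _; exact: normr_ge0.
  - by apply: le_trans (sum2 N); apply: ler_sum => n _; exact: hu.
apply: filterS h1 => t h1 t0T; have [C hC] := h1 t0T.
have h2 := @itg_series_ae R 0 1 (fun k x => D k x t) C.
have {h2} h2 : {ae leb, forall x, 0 <= x <= 1 -> exists C', forall N, \sum_(n < N) D n x t <= C'}.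
  apply: h2 => [n|n x|N] //; last exact: normr_ge0.
  by have bDn := bD n; move: (D n) bDn => g bg; btac.
apply: filterS h2 => x h2 x01; have [C' hC'] := h2 x01.
exact: (cvg_of_bounded_variation (C := C')).
Qed.

Lemma ae_limit T B (u_ : nat -> R -> R -> R) : 0 <= B ->
  (forall k, bm (fun p : R * R => u_ k p.1 p.2)) -> (forall k x t, `|u_ k x t| <= B) ->
  (forall k t, periodic1 (u_ k ^~ t)) ->
  {ae leb, forall t, 0 <= t <= T -> {ae leb, forall x, 0 <= x <= 1 -> cvgn (fun k => u_ k x t)}} ->
  exists u : R -> R -> R, [/\ bm (fun p : R * R => u p.1 p.2), forall x t, `|u x t| <= B,
    forall t, periodic1 (u ^~ t) &
    {ae leb, forall t, 0 <= t <= T -> {ae leb, forall x, 0 <= x <= 1 -> (fun k => u_ k x t) @ \oo --> u x t}}].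
Proof.
move=> B0 bu uB pu hae.
(* The upper limit is defined everywhere, measurable and periodic, and it equals the limit wherever
   that exists. *)
exists (fun x t => clamp B (limn_sup (fun k => u_ k x t))).
have uB' x t : `|clamp B (limn_sup (fun k => u_ k x t))| <= B by exact: clamp_norm.
split; [|exact: uB'| |].
- split; last by exists B.
  apply: measurable_clamp.
  apply: (@measurable_fun_limn_sup _ _ _ setT (fun k (p : R * R) => u_ k p.1 p.2)) => [p _|p _|n].
  + by exists B => _ [n _ <-]; exact: le_trans (ler_norm _) (uB _ _ _).
  + exists (- B) => _ [n _ <-]; have := uB n p.1 p.2; rewrite ler_norml => /andP[].
    by [].
  + exact: (bm_meas (bu n)).
- by move=> t x; congr (clamp B (limn_sup _)); apply/funext => k; rewrite pu.
apply: filterS hae => t ht t0T; apply: filterS (ht t0T) => x hx x01.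
have hc := hx x01; rewrite cvg_limn_supE // clamp_id //.
rewrite ler_norml; apply/andP; split.
  apply: limr_ge => //; apply: nearW => k.
  by have := uB k x t; rewrite ler_norml => /andP[].
apply: limr_le => //; apply: nearW => k; exact: le_trans (ler_norm _) (uB _ _ _).
Qed.

Lemma eflux_cvg (a_ l_ : nat -> R) (a l : R) : a_ @ \oo --> a -> l_ @ \oo --> l ->
  (fun k => eflux (a_ k) (l_ k)) @ \oo --> eflux a l.
Proof.
move=> ca cl; rewrite efluxE; under eq_fun do rewrite efluxE.
apply: cvgM; first by apply: cvg_norm; exact: cvgB.
by apply: cvgM; [exact: cvgD|exact: cvg_cst].
Qed.

Lemma sg_cvg (a_ : nat -> R) (a : R) : a != 0 -> a_ @ \oo --> a ->
  (fun k => Num.sg (a_ k)) @ \oo --> Num.sg a.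
Proof.
move=> a0 ca; apply: cvg_near_cst.
have [ap|an|/eqP] := ltgtP a 0; last by rewrite (negbTE a0).
  near=> k; rewrite !ltr0_sg //; near: k.
  by apply: (cvgr_lt a ca).
near=> k; rewrite !gtr0_sg //; near: k.
by apply: (cvgr_gt a ca).
Unshelve. all: by end_near. Qed.

Lemma convKp_cvg (w_ : nat -> R -> R) (w : R -> R) B x :
  (forall k, bm (w_ k)) -> bm w -> (forall k y, `|w_ k y| <= B) ->
  {ae leb, forall y, 0 <= y <= 1 -> (fun k => w_ k y) @ \oo --> w y} ->
  (fun k => convKp (w_ k) x) @ \oo --> convKp w x.
Proof.
move=> bw_ bw wB hae; rewrite convKpE; under eq_fun do rewrite convKpE.
have bK := @bm_Kp R.
apply: (itg_cvg_dominated (M := kappa * B)) => [n||n y _|].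
- by have bn := bw_ n; move: (w_ n) bn => g bg; apply: bm_meas; btac.
- by apply: bm_meas; btac.
- rewrite normrM; apply: ler_pM => //; exact: Kp_bound.
by apply: filterS hae => y hy y01; apply: cvgM; [exact: cvg_cst|exact: hy].
Qed.
End Limits.

(** * Exceptional levels and the limit of the entropy inequality *)

Section EntropyLimit.
Context {R : realType}.
Notation leb := (@lebesgue_measure R).

(* [1 - `|Num.sg y|] is the indicator of [y = 0], so this is the measure of [u = lam]. *)
Definition level_measure (T : R) (u : R -> R -> R) (lam : R) : R :=
  itg 0 T (fun t => itg 0 1 (fun x => 1 - `|Num.sg (u x t - lam)|)).

Let sg_le1 (y : R) : `|Num.sg y| <= 1.
Proof. by rewrite normr_sg; case: (_ != _). Qed.

Lemma level_measure_eq0_ae T u lam : bm (fun p : R * R => u p.1 p.2) -> level_measure T u lam = 0 ->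
  {ae leb, forall t, 0 <= t <= T -> {ae leb, forall x, 0 <= x <= 1 -> u x t - lam != 0}}.
Proof.
move=> bu h0.
have ge0 x t : 0 <= 1 - `|Num.sg (u x t - lam)| by rewrite subr_ge0.
have h1 := itg_eq0_ae (f := fun t => itg 0 1 (fun x => 1 - `|Num.sg (u x t - lam)|)) _ _ h0.
have {}h1 : {ae leb, forall t, 0 <= t <= T -> itg 0 1 (fun x => 1 - `|Num.sg (u x t - lam)|) = 0}.
  by apply: h1 => [|t _]; [btac|apply: itg_ge0].
apply: filterS h1 => t h1 t0T.
have h2 := itg_eq0_ae (f := fun x => 1 - `|Num.sg (u x t - lam)|) _ _ (h1 t0T).
have {}h2 : {ae leb, forall x, 0 <= x <= 1 -> 1 - `|Num.sg (u x t - lam)| = 0}.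
  by apply: h2 => [|x _]; [btac|].
apply: filterS h2 => x h2 x01; have := h2 x01; rewrite normr_sg.
by case: (_ != _) => //; rewrite mulr0n subr0 => /eqP; rewrite oner_eq0.
Qed.

(** For fixed (x, t) at most one level equals u(x, t), so by Fubini the level measure has integral
    zero over [p, q]; being nonnegative, it cannot be positive throughout. *)
Lemma level_measure_zero_exists T u p q : bm (fun p : R * R => u p.1 p.2) -> p < q ->
  exists2 lam, p <= lam <= q & level_measure T u lam = 0.
Proof.
move=> bu pq.
have bl : bm (level_measure T u) by rewrite /level_measure; btac.
have ge0 lam : 0 <= level_measure T u lam.
  by apply: itg_ge0 => t _; apply: itg_ge0 => x _; rewrite subr_ge0.
have i0 : itg p q (level_measure T u) = 0.
  transitivity (itg 0 T (fun t => itg p q (fun lam => itg 0 1 (fun x => 1 - `|Num.sg (u x t - lam)|)))).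
    by apply: itg_swap; btac.
  transitivity (itg 0 T (fun t => itg 0 1 (fun x => itg p q (fun lam => 1 - `|Num.sg (u x t - lam)|)))).
    by apply: eq_itg => t _; apply: itg_swap; btac.
  transitivity (itg 0 T (fun _ => itg 0 1 (fun _ => 0))).
    apply: eq_itg => t _; apply: eq_itg => x _.
    transitivity (itg p q (fun _ => 0)); last by rewrite itg_cst ?mul0r // ltW.
    apply: ae_eq_itg => //; first by apply: bm_meas; btac.
    exists [set u x t]; split; [exact: measurable_set1|exact: lebesgue_measure_set1|].
    move=> lam /= h; apply/eqP; apply: contrapT => ne; apply: h => _.
    have -> : `|Num.sg (u x t - lam)| = 1; last by rewrite subrr.
    by rewrite normr_sg subr_eq0 eq_sym (introF eqP) //; move=> e; apply: ne; rewrite e.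
  transitivity (itg 0 T (fun _ => 0 : R)).
    by apply: eq_itg => t _; rewrite itg_cst ?ler01 // mul0r.
  (* [itg_cst] asks for an ordered interval; for T < 0 homogeneity of the integral gives the value
     0. *)
  have [T0|T0] := leP 0 T; first by rewrite itg_cst // mul0r.
  transitivity (0 * itg 0 T (fun _ : R => 0 : R)); last by rewrite mul0r.
  rewrite -itgZl; last exact: bm_cst.
  by apply: eq_itg => t _; rewrite mul0r.
apply: contrapT => hno.
have h1 := itg_eq0_ae bl (fun x _ => ge0 x) i0.
have : itg p q (fun _ => 0) = itg p q (fun _ => 1 : R).
  apply: ae_eq_itg => //; apply: filterS h1 => lam h1 hlam.
  by exfalso; apply: hno; exists lam; [exact: hlam|exact: h1].
rewrite !itg_cst ?(ltW pq) // mul0r mul1r => /esym/eqP; rewrite subr_eq0 => /eqP e.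
by rewrite e ltxx in pq.
Qed.

Lemma entropy_integrand_bound (B lam Lam L : R) u phi phix phit x t : `|lam| <= Lam ->
  bm (fun p : R * R => u p.1 p.2) -> (forall x t, `|u x t| <= B) ->
  (forall x t, [/\ `|phi x t| <= L, `|phix x t| <= L & `|phit x t| <= L]) ->
  `|entropy_integrand u lam phi phix phit x t| <=
     (B + Lam) * L + (B + Lam) ^+ 2 * L + kappa * B * L.
Proof.
move=> lamL bu uB hL; rewrite entropy_integrandE //.
have [h0 h1 h2] := hL x t; have B0 : 0 <= B by exact: le_trans (uB 0 0).
have Lam0 : 0 <= Lam by exact: le_trans lamL.
have ul : `|u x t - lam| <= B + Lam.
  by apply: (le_trans (ler_normB _ _)); exact: lerD.
have fl : `|eflux (u x t) lam| <= (B + Lam) ^+ 2.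
  rewrite expr2; apply: (le_trans (eflux_bound (M := B + Lam) _ _)).
  - by apply: (le_trans (uB _ _)); rewrite lerDl.
  - by apply: (le_trans lamL); rewrite lerDr.
  by apply: ler_wpM2l => //; rewrite addr_ge0.
apply: (le_trans (ler_normB _ _)); apply: lerD.
  by apply: (le_trans (ler_normD _ _)); apply: lerD; rewrite normrM ?normr_id; apply: ler_pM.
have bK := @bm_Kp R.
have hc : `|convKp (u ^~ t) x| <= kappa * B by apply: conv_bound => //; btac.
rewrite normrM; apply: ler_pM => //.
by rewrite normrM -[leRHS]mul1r; apply: ler_pM.
Qed.

Section Pass.
Context {T B : R} {u_ : nat -> R -> R -> R} {u : R -> R -> R} {u0 : R -> R}.
Hypothesis bu_ : forall k, bm (fun p : R * R => u_ k p.1 p.2).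
Hypothesis bu : bm (fun p : R * R => u p.1 p.2).
Hypothesis u_B : forall k x t, `|u_ k x t| <= B.
Hypothesis uB : forall x t, `|u x t| <= B.
Hypothesis ucvg : {ae leb, forall t, 0 <= t <= T ->
  {ae leb, forall x, 0 <= x <= 1 -> (fun k => u_ k x t) @ \oo --> u x t}}.
Context {phi phix phit : R -> R -> R}.
Hypothesis tf : test_fun phi phix phit.

(** Dominated convergence: the choice of level keeps u - lam away from the jump of the sign almost
    everywhere, and for almost every [t] the convolutions converge at every [x]. *)
Lemma entropy_form_cvg lam : level_measure T u lam = 0 ->
  (fun k => entropy_form T (u_ k) lam phi phix phit) @ \oo --> entropy_form T u lam phi phix phit.
Proof.
move=> good; have bK := @bm_Kp R.
have [b0 b1 b2] := test_fun_bm tf; have [L L0 hL] := test_fun_bound tf.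
have bE (w : R -> R -> R) : bm (fun p : R * R => w p.1 p.2) ->
    bm (fun p : R * R => entropy_integrand w lam phi phix phit p.1 p.2).
  move=> bw; under eq_fun do rewrite entropy_integrandE //.
  by btac.
apply: (itg2_cvg_dominated (M := (B + `|lam|) * L + (B + `|lam|) ^+ 2 * L + kappa * B * L)).
- by move=> k; apply: bE.
- exact: bE.
- by move=> k x t; apply: entropy_integrand_bound.
apply: filterS2 ucvg (level_measure_eq0_ae bu good) => t h1 h2 t0T.
have := h1 t0T; have := h2 t0T => {}h2 {}h1.
have hK x : (fun k => convKp (u_ k ^~ t) x) @ \oo --> convKp (u ^~ t) x.
  apply: (convKp_cvg (B := B)) => // [k|].
    by have bk := bu_ k; move: (u_ k) bk => w bw; btac.
  by btac.
apply: filterS2 h1 h2 => x h1 h2 x01; have {}h1 := h1 x01; have {}h2 := h2 x01.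
rewrite entropy_integrandE //; under eq_fun do rewrite entropy_integrandE //.
have hs : (fun k => u_ k x t - lam) @ \oo --> u x t - lam by apply: cvgB => //; exact: cvg_cst.
apply: cvgB.
  apply: cvgD; (apply: cvgM; last exact: cvg_cst).
    exact: cvg_norm.
  by apply: eflux_cvg => //; exact: cvg_cst.
apply: cvgM; last exact: cvg_cst.
by apply: cvgM => //; exact: sg_cvg.
Qed.

End Pass.

(* Average the inequalities at levels decreasing and increasing to [lam]: on
   [u = lam] the two signs cancel, giving [Num.sg 0 = 0]. *)
Lemma entropy_all_levels (T B : R) (u : R -> R -> R) (u0 : R -> R) (phi phix phit : R -> R -> R) :
  bm (fun p : R * R => u p.1 p.2) -> (forall x t, `|u x t| <= B) -> bm u0 -> test_fun phi phix phit ->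
  (forall lam, level_measure T u lam = 0 ->
     0 <= entropy_form T u lam phi phix phit + itg 0 1 (fun x => `|u0 x - lam| * phi x 0)) ->
  forall lam, 0 <= entropy_form T u lam phi phix phit + itg 0 1 (fun x => `|u0 x - lam| * phi x 0).
Proof.
move=> bu uB bu0 tf hgood lam; have bK := @bm_Kp R.
have [b0 b1 b2] := test_fun_bm tf; have [L L0 hL] := test_fun_bound tf.
pose s (j : nat) : R := j.+1%:R^-1.
have s0 j : 0 < s j by rewrite invr_gt0.
have s1 j : s j <= 1 by rewrite invf_le1 // ler1n.
have sS j : s j.+1 < s j by rewrite ltf_pV2 ?posrE // ltr_nat.
have cs : s @ \oo --> 0 by exact: cvg_harmonic.
(* The lower end lam + s_{j+1} keeps the good levels strictly above [lam], so that their signs on u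
   = lam are determined; symmetrically below. *)
have /choice[l_ hl] : forall j, exists l, lam + s j.+1 <= l <= lam + s j /\ level_measure T u l = 0.
  move=> j; have [|l h1 h2] := level_measure_zero_exists T bu (p := lam + s j.+1) (q := lam + s j).
    by rewrite ltrD2l.
  by exists l.
have /choice[m_ hm] : forall j, exists l, lam - s j <= l <= lam - s j.+1 /\ level_measure T u l = 0.
  move=> j; have [|l h1 h2] := level_measure_zero_exists T bu (p := lam - s j) (q := lam - s j.+1).
    by rewrite ltrD2l ltrN2.
  by exists l.
have lgt j : lam < l_ j by have [/andP[h _] _] := hl j; have := s0 j.+1; lra.
have mlt j : m_ j < lam by have [/andP[_ h] _] := hm j; have := s0 j.+1; lra.
have cl : l_ @ \oo --> lam.
  apply: (@squeeze_cvgr _ _ _ _ (fun _ => lam) (fun j => lam + s j)); last 2 first.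
  - exact: cvg_cst.
  - by rewrite -[X in _ --> X]addr0; apply: cvgD => //; exact: cvg_cst.
  by apply: nearW => j; rewrite (ltW (lgt j)); have [/andP[]] := hl j.
have cm : m_ @ \oo --> lam.
  apply: (@squeeze_cvgr _ _ _ _ (fun j => lam - s j) (fun _ => lam)); last 2 first.
  - by rewrite -[X in _ --> X]subr0; apply: cvgB => //; exact: cvg_cst.
  - exact: cvg_cst.
  by apply: nearW => j; rewrite (ltW (mlt j)) andbT; have [/andP[]] := hm j.
pose Lam := `|lam| + 1.
have lL j : `|l_ j| <= Lam.
  have [/andP[h1 h2] _] := hl j; have := lgt j; have := s1 j; rewrite /Lam => h3 h4.
  have h5 := ler_norm lam; have h6 := ler_norm (- lam); rewrite normrN in h6.
  by rewrite ler_norml; apply/andP; split; lra.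
have mL j : `|m_ j| <= Lam.
  have [/andP[h1 h2] _] := hm j; have := mlt j; have := s1 j; rewrite /Lam => h3 h4.
  have h5 := ler_norm lam; have h6 := ler_norm (- lam); rewrite normrN in h6.
  by rewrite ler_norml; apply/andP; split; lra.
pose E l x t := entropy_integrand u l phi phix phit x t.
pose M := (B + Lam) * L + (B + Lam) ^+ 2 * L + kappa * B * L.
have EM l x t : `|l| <= Lam -> `|E l x t| <= M by move=> h; apply: entropy_integrand_bound.
have bE l : bm (fun p : R * R => E l p.1 p.2).
  rewrite /E; under eq_fun do rewrite entropy_integrandE //.
  by btac.
have hE l : entropy_form T u l phi phix phit = itg 0 T (fun t => itg 0 1 (fun x => E l x t)) by [].
have c1 : (fun j => entropy_form T u (l_ j) phi phix phit + entropy_form T u (m_ j) phi phix phit)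
    @ \oo --> itg 0 T (fun t => itg 0 1 (fun x => 2 * E lam x t)).
  have -> : (fun j => entropy_form T u (l_ j) phi phix phit + entropy_form T u (m_ j) phi phix phit)
    = (fun j => itg 0 T (fun t => itg 0 1 (fun x => E (l_ j) x t + E (m_ j) x t))).
    apply/funext => j; have bl := bE (l_ j); have bm' := bE (m_ j).
    rewrite !hE; move: (E (l_ j)) (E (m_ j)) bl bm' => f g bf bg.
    rewrite -itgD; [|btac|btac]; apply: eq_itg => t _.
    by rewrite -itgD; [|btac|btac].
  apply: (itg2_cvg_dominated (M := M + M)) => [k||k x t|].
  - by apply: bmD.
  - by apply: bmM => //; exact: bm_cst.
  - by apply: (le_trans (ler_normD _ _)); apply: lerD; exact: EM.
  apply: aeW => t _; apply: aeW => x _.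
  rewrite /E entropy_integrandE //.
  have -> : (fun j => entropy_integrand u (l_ j) phi phix phit x t + entropy_integrand u (m_ j) phi phix phit x t)
    = (fun j => (`|u x t - l_ j| + `|u x t - m_ j|) * phit x t
         + (eflux (u x t) (l_ j) + eflux (u x t) (m_ j)) * phix x t
         - (Num.sg (u x t - l_ j) + Num.sg (u x t - m_ j)) * convKp (u ^~ t) x * phi x t).
    by apply/funext => j; rewrite !entropy_integrandE //; ring.
  have -> : 2 * (`|u x t - lam| * phit x t + eflux (u x t) lam * phix x t
      - Num.sg (u x t - lam) * convKp (u ^~ t) x * phi x t) =
    (`|u x t - lam| + `|u x t - lam|) * phit x t + (eflux (u x t) lam + eflux (u x t) lam) * phix x t
      - (Num.sg (u x t - lam) + Num.sg (u x t - lam)) * convKp (u ^~ t) x * phi x t by ring.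
  have d1 : (fun j => u x t - l_ j) @ \oo --> u x t - lam by apply: cvgB => //; exact: cvg_cst.
  have d2 : (fun j => u x t - m_ j) @ \oo --> u x t - lam by apply: cvgB => //; exact: cvg_cst.
  apply: cvgB; last apply: cvgM; last exact: cvg_cst.
    apply: cvgD; (apply: cvgM; last exact: cvg_cst).
      by apply: cvgD; exact: cvg_norm.
    by apply: cvgD; apply: eflux_cvg => //; exact: cvg_cst.
  apply: cvgM; last exact: cvg_cst.
  have [e|ne] := eqVneq (u x t) lam; last by apply: cvgD; apply: sg_cvg => //; rewrite subr_eq0.
  rewrite e subrr sgr0 addr0.
  have -> : (fun j => Num.sg (lam - l_ j) + Num.sg (lam - m_ j)) = fun _ => 0; last exact: cvg_cst.
  by apply/funext => j; rewrite ltr0_sg ?subr_lt0 // gtr0_sg ?subr_gt0 // addNr.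
have c2 : (fun j => itg 0 1 (fun x => `|u0 x - l_ j| * phi x 0) + itg 0 1 (fun x => `|u0 x - m_ j| * phi x 0))
    @ \oo --> itg 0 1 (fun x => `|u0 x - lam| * phi x 0) + itg 0 1 (fun x => `|u0 x - lam| * phi x 0).
  have [_ [C hC]] := bu0.
  have main (l : nat -> R) : (forall j, `|l j| <= Lam) -> l @ \oo --> lam ->
      (fun j => itg 0 1 (fun x => `|u0 x - l j| * phi x 0)) @ \oo --> itg 0 1 (fun x => `|u0 x - lam| * phi x 0).
    move=> hl' cl'; apply: (itg_cvg_dominated (M := (C + Lam) * L)) => [j||j x _|].
    - by apply: bm_meas; btac.
    - by apply: bm_meas; btac.
    - rewrite normrM normr_id; have [h _ _] := hL x 0; apply: ler_pM => //.
      by apply: (le_trans (ler_normB _ _)); exact: lerD.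
    apply: aeW => x _; apply: cvgM; last exact: cvg_cst.
    by apply: cvg_norm; apply: cvgB => //; exact: cvg_cst.
  by apply: cvgD; apply: main.
have := cvgD c1 c2.
have -> : itg 0 T (fun t => itg 0 1 (fun x => 2 * E lam x t)) = 2 * entropy_form T u lam phi phix phit.
  have bl := bE lam; rewrite hE; move: (E lam) bl => f bf.
  rewrite -itgZl; last by btac.
  by apply: eq_itg => t _; rewrite -itgZl //; btac.
move=> c3; have {}c3 := c3 ltac:(typeclasses eauto); suff : 0 <= 2 * (entropy_form T u lam phi phix phit + itg 0 1 (fun x => `|u0 x - lam| * phi x 0)).
  by rewrite pmulr_rge0.
rewrite mulrDr; move: (itg 0 1 (fun x => `|u0 x - lam| * phi x 0)) c3 => I0 c3.
have -> : 2 * I0 = I0 + I0 by ring.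
rewrite -(cvg_lim _ c3) //; apply: limr_ge; first by apply/cvg_ex; eexists; exact: c3.
apply: nearW => j; have [_ g1] := hl j; have [_ g2] := hm j.
have := addr_ge0 (hgood _ g1) (hgood _ g2); rewrite addrACA; exact.
Qed.

End EntropyLimit.

(** * Existence *)

Section Existence.
Context {R : realType}.
Notation leb := (@lebesgue_measure R).

Lemma scheme_sol_summable (T B M : R) (u0 : R -> R) : 0 < T -> 0 <= M ->
  M * expR (kappa * T) <= B -> 0 < B -> bm u0 -> periodic1 u0 -> (forall x, `|u0 x| <= M) ->
  exists tau : nat -> R, (forall k, 0 < tau k <= k.+1%:R^-1) /\
    forall k, itg 0 T (fun t => itg 0 1 (fun x =>
      `|scheme_sol T B (tau k.+1) u0 x t - scheme_sol T B (tau k) u0 x t|)) <= 2^-1 ^+ k.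
Proof.
move=> T0 M0 MB B0 bu0 pu0 u0M.
have k0 : 0 <= @kappa R by apply: le_trans kappa_ge1.
have u0B x : `|u0 x| <= B.
  apply: (le_trans (u0M x)); apply: le_trans MB; rewrite -[leLHS]mulr1 ler_wpM2l //.
  by rewrite -expR0 ler_expR mulr_ge0 // ltW.
have e0 k : 0 < (2^-1 : R) ^+ k by rewrite exprn_gt0.
have /choice[rho hrho] : forall k, exists rho, 0 < rho /\ forall r1 r2 u v,
    0 <= r1 <= rho -> 0 <= r2 <= rho ->
    approx_entropy_solution T B r1 u0 u -> approx_entropy_solution T B r2 u0 v ->
    itg 0 T (fun t => itg 0 1 (fun x => `|u x t - v x t|)) <= 2^-1 ^+ k.
  move=> k; have [r h1 h2] := stability T0 (bm_meas bu0) pu0 u0B (e0 k).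
  by exists r.
(* Nonincreasing and below [rho]: the defects of two consecutive schemes both meet the stability
   threshold of the earlier one. *)
pose r := fix r k := if k is k'.+1 then Num.min (r k') (rho k) else rho 0%N.
have r0 k : 0 < r k.
  by elim: k => [|k IH] /=; [have [] := hrho 0%N|rewrite lt_min IH; have [] := hrho k.+1].
have rS k : r k.+1 <= r k by rewrite /= ge_min lexx.
have rrho k : r k <= rho k by case: k => [|k] //=; rewrite ge_min lexx orbT.
have /choice[tau htau] : forall k, exists tau, 0 < tau <= k.+1%:R^-1 /\
    approx_entropy_solution T B (r k) u0 (scheme_sol T B tau u0).
  move=> k; have [t1 t10 ht1] := scheme_sol_approx T0 M0 MB B0 bu0 pu0 u0M (r0 k).
  exists (Num.min t1 k.+1%:R^-1); split.
    by rewrite lt_min t10 invr_gt0 ltr0n /= ge_min lexx orbT.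
  by apply: ht1; rewrite lt_min t10 invr_gt0 ltr0n /= ge_min lexx.
exists tau; split => k; first by have [] := htau k.
have [_ h1] := htau k.+1; have [_ h2] := htau k; have [_ hk] := hrho k.
apply: (hk _ _ _ _ _ _ h1 h2); apply/andP; split; rewrite ?(ltW (r0 _)) //.
exact: le_trans (rS k) (rrho k).
Qed.

Lemma entropy_solution_exists_bounded (T M : R) (u0 : R -> R) : 0 < T -> 0 <= M ->
  bm u0 -> periodic1 u0 -> (forall x, `|u0 x| <= M) ->
  exists u : R -> R -> R, [/\ bm (fun p : R * R => u p.1 p.2), forall t, periodic1 (u ^~ t) &
    forall lam phi phix phit, test_fun phi phix phit ->
      0 <= entropy_form T u lam phi phix phit + itg 0 1 (fun x => `|u0 x - lam| * phi x 0)].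
Proof.
move=> T0 M0 bu0 pu0 u0M.
have k0 : 0 <= @kappa R by apply: le_trans kappa_ge1.
(* The summand 1 makes [B] positive also for the zero datum. *)
pose B := M * expR (kappa * T) + 1.
have MB : M * expR (kappa * T) <= B by rewrite lerDl.
have B0 : 0 < B by rewrite ltr_wpDl // mulr_ge0 // expR_ge0.
clearbody B.
have [tau [htau hsum]] := scheme_sol_summable T0 M0 MB B0 bu0 pu0 u0M.
have tau0 k : 0 < tau k by have /andP[] := htau k.
pose u_ k := scheme_sol T B (tau k) u0.
have bu_ k : bm (fun p : R * R => u_ k p.1 p.2) by exact: (scheme_sol_bm T0 (tau0 k) M0 MB B0).
have u_B k x t : `|u_ k x t| <= B by exact: (scheme_sol_bound T0 (tau0 k) M0 MB B0).
have pu_ k t : periodic1 (u_ k ^~ t) by exact: scheme_sol_periodic.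
have [u [bu uB pu ucvg]] := ae_limit (ltW B0) bu_ u_B pu_ (ae_cvg_of_summable bu_ hsum).
exists u; split => // lam phi phix phit tf.
move: lam; apply: (entropy_all_levels bu uB bu0 tf) => lam good.
have c1 := entropy_form_cvg bu_ bu u_B ucvg tf good.
have [L L0 hL] := test_fun_bound tf.
set I0 := itg 0 1 _.
pose Bl := B + `|lam|.
have Bl0 : 0 <= Bl by rewrite addr_ge0 // ltW.
pose C1 := T * (Bl * (1 + B) + Bl ^+ 2).
pose C2 := 2 * Bl + T * (kappa ^+ 2 * B) + Bl ^+ 2 + kappa * B.
have C10 : 0 <= C1 by rewrite !mulr_ge0 ?addr_ge0 ?mulr_ge0 ?exprn_ge0 ?addr_ge0 // ltW.
have C20 : 0 <= C2 by rewrite !addr_ge0 ?mulr_ge0 ?exprn_ge0 // ltW.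
apply/ler_addgt0Pr => eps eps0.
(* Half of [eps] pays for the modulus of continuity of the test function, the other half for the
   terms in [tau * L]. *)
pose e := eps / 2 / (C1 + 1).
have e0 : 0 < e by rewrite divr_gt0 ?divr_gt0 // ltr_wpDl.
have [rr rr0 hr] := test_fun_modulus T tf e0.
(* The three bounds ensure, in this order, that a full step fits into [0, T], that the displacements
   [B * tau] and [tau] stay within the radius [rr], and that [C2 * (tau * L)] is at most eps/2. *)
pose d := Num.min T (Num.min (rr / (B + 1)) (eps / 2 / (C2 * L + 1))).
have d0 : 0 < d.
  rewrite !lt_min T0 divr_gt0 ?ltr_wpDl // ?ltW // divr_gt0 ?divr_gt0 // ltr_wpDl // mulr_ge0 //.
have hnear : \forall k \near \oo, tau k <= d.
  near=> k; have /andP[_ h] := htau k; apply: (le_trans h); apply: ltW.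
  near: k; apply: (cvgr_lt (0 : R)) => //; exact: cvg_harmonic.
rewrite -addrA -lerBlDr sub0r.
rewrite -(cvg_lim _ c1) //; apply: limr_ge; first by apply/cvg_ex; eexists; exact: c1.
apply: filterS hnear => k; rewrite !le_min => /and3P[t1 t2 t3].
rewrite ler_pdivlMr ?ltr_wpDl ?(ltW B0) // in t2.
rewrite ler_pdivlMr ?ltr_wpDl ?mulr_ge0 // in t3.
have tk := tau0 k.
have he x t x' t' : 0 <= t <= T -> 0 <= t' <= T -> `|x' - x| <= B * tau k -> `|t' - t| <= tau k ->
    `|phix x' t' - phix x t| <= e /\ `|phit x' t' - phit x t| <= e.
  move=> h1 _ h2 h3; apply: hr => //.
    by apply: (le_trans h2); apply: le_trans t2; rewrite mulrC ler_wpM2l ?lerDl // ltW.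
  by apply: (le_trans h3); apply: le_trans t2; rewrite -[leLHS]mulr1 ler_wpM2l ?lerDr // ltW.
have := scheme_sol_entropy T0 tk t1 M0 MB B0 bu0 pu0 u0M (lexx `|lam|) tf (ltW e0) (fun x t _ => hL x t) he.
rewrite -/I0 -/(u_ k) -/Bl -/C1 -/C2.
have h1 : C1 * e <= eps / 2.
  have -> : C1 * e = eps / 2 * (C1 / (C1 + 1)) by rewrite /e; field; rewrite gt_eqF // ltr_wpDl.
  rewrite -[leRHS]mulr1 ler_wpM2l // ?divr_ge0 ?(ltW eps0) // ler_pdivrMr ?ltr_wpDl // mul1r lerDl.
  by [].
have h2 : C2 * (tau k * L) <= eps / 2.
  apply: le_trans t3; have -> : C2 * (tau k * L) = tau k * (C2 * L) by ring.
  by rewrite ler_wpM2l ?lerDl // ltW.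
move: (entropy_form _ _ _ _ _ _) (C1 * e) (C2 * _) I0 h1 h2 => F a b I h1 h2 h3.
by clear -h1 h2 h3; lra.
Unshelve. all: by end_near. Qed.

Lemma weak_entropy_solution_exists (T : R) (u0 : R -> R) : 0 < T -> Linf_T u0 ->
  exists u : R -> R -> R, weak_entropy_solution T u0 u.
Proof.
move=> T0 [mu0 [pu0 [M0 hM0]]].
pose M := `|M0|.
have M_ge0 : 0 <= M by exact: normr_ge0.
have bc : bm (fun x => clamp M (u0 x)).
  by split; [exact: measurable_clamp|exists M => x; exact: clamp_norm].
have pc : periodic1 (fun x => clamp M (u0 x)) by move=> x; rewrite pu0.
have [u [bu pu hu]] := entropy_solution_exists_bounded T0 M_ge0 bc pc (fun x => clamp_norm _ M_ge0).
have [_ [B hB]] := bu.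
exists u; split.
  split => //; split; first by apply: measurable_funTS; exact: bm_meas.
  by exists B; apply: aeW => p _; exact: hB.
move=> lam phi phix phit tf; have [b0 _ _] := test_fun_bm tf.
have := hu lam phi phix phit tf.
have -> : itg 0 1 (fun x => `|clamp M (u0 x) - lam| * phi x 0) = itg 0 1 (fun x => `|u0 x - lam| * phi x 0).
  apply: ae_eq_itg; [by apply: bm_meas; btac| |].
    by mtac.
  apply: filterS hM0 => x hx _; rewrite clamp_id //; exact: le_trans (ler_norm _).
by [].
Qed.

End Existence.

Theorem theorem2 (R : realType) (T : R) (hT : 0 < T) (u0 : R -> R)
  (hu0 : Linf_T u0) :
  (exists u : R -> R -> R, weak_entropy_solution T u0 u) /\
  (forall u v : R -> R -> R,
     weak_entropy_solution T u0 u -> weak_entropy_solution T u0 v ->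
     ae_eq_TT T u v).
Proof.
split; first exact: weak_entropy_solution_exists.
by move=> u v; exact: weak_entropy_solution_unique.
Qed.
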